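(* For any given smooth function $c(u)$, the bihamiltonian structure $$\{u(x),u(y)\}_1=\delta'(x-y),\qquad \{u(x),u(y)\}_2=u(x)\delta'(x-y)+\tfrac12u_x(x)\delta(x-y)$$ has a unique equivalence class of deformations with a representative of the form $$\{u(x),u(y)\}_1=\delta'(x-y),$$ $$\begin{aligned}\{u(x),u(y)\}_2=&\;u(x)\delta'(x-y)+\tfrac12u_x(x)\delta(x-y)\\&+\epsilon^2\Big(3c(u)\delta'''(x-y)+\tfrac92c'(u)u_x\delta''(x-y)+\tfrac32c''(u)u_x^2\delta'(x-y)+\tfrac32c'(u)u_{xx}\delta'(x-y)\Big)\\&+\sum_{g\ge2}\epsilon^{2g}\sum_{k=0}^{2g+1}A_{g,k}(u,u_x,\dots,u^{(k)})\,\delta^{(2g+1-k)}(x-y),\end{aligned}$$ where the $A_{g,k}$ are differential polynomials of degree $k$.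
   Context: Let $M=\mathbb R$ with coordinate $u$. A differential polynomial of degree $k$ is a polynomial in $u^{(s)}=\partial_x^su$, $s\ge1$, with coefficients smooth functions of $u$, homogeneous of degree $k$ for $\deg u^{(s)}=s$. Brackets and bivectors. Let $\hat{\mathcal A}$ be the supercommutative algebra generated by smooth functions of $u=u^0$, even variables $u^s$ ($s\ge1$, $u^s$ standing for $\partial_x^su$) and odd variables $\theta^s$ ($s\ge0$, $\theta^0=\theta$), polynomial in $u^s,\theta^s$ ($s\ge1$) and completed with respect to the standard gradation $\deg u^s=\deg\theta^s=s$ ($s\ge1$), $\deg=0$ for functions of $u,\theta$. The super gradation is $\deg\theta^s=1$, $\deg u^s=0$. Let $\partial=\sum_{s\ge0}\left(u^{s+1}\frac{\partial}{\partial u^s}+\theta^{s+1}\frac{\partial}{\partial\theta^s}\right)$, $\hat{\mathcal F}=\hat{\mathcal A}/\partial\hat{\mathcal A}$ with projection $\int$, and let $\hat{\mathcal F}^p$ be the super degree $p$ part. For $P\in\hat{\mathcal F}^p,Q\in\hat{\mathcal F}^q$ the Schouten bracket is $[P,Q]=\int\left(\delta^\theta P\,\delta_uQ+(-1)^p\delta_uP\,\delta^\theta Q\right)$, with $\delta^\theta=\sum_s(-\partial)^s\frac{\partial}{\partial\theta^s}$, $\delta_u=\sum_s(-\partial)^s\frac{\partial}{\partial u^s}$ (left derivatives in odd variables). A bracket $\{u(x),u(y)\}=\sum_sP_s\,\delta^{(s)}(x-y)$ (with $P_s$ evaluated at $u(x),u_x(x),\dots$ and $\sum_sP_s\partial^s$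 skew-adjoint) corresponds to the bivector $\frac12\int\sum_sP_s\,\theta\theta^s\in\hat{\mathcal F}^2$; powers of the formal parameter $\epsilon$ only record the standard degree (the coefficient of $\epsilon^k$ has standard degree $k+1$). A pair of bivectors $(\tilde P_1,\tilde P_2)$ is a bihamiltonian structure if $[\tilde P_1,\tilde P_1]=[\tilde P_1,\tilde P_2]=[\tilde P_2,\tilde P_2]=0$. The undeformed structure corresponds to $P_1=\frac12\int\theta\theta^1$, $P_2=\frac12\int u\theta\theta^1$. A deformation of $(P_1,P_2)$ is a bihamiltonian structure $(\tilde P_1,\tilde P_2)$ such that all homogeneous components of $\tilde P_a-P_a$ have standard degree $\ge2$. Two deformations are equivalent if they are related by a Miura type transformation $u\mapsto\tilde u=u+\sum_{k\ge1}\epsilon^kF_k(u,u_x,\dots,u^{(k)})$ with $F_k$ differential polynomials of degree $k$; equivalently, by simultaneous application of $\exp(\mathrm{ad}_X)$, $\mathrm{ad}_X=[X,\cdot\,]$, to both bivectors for some $X\in\hat{\mathcal F}^1$ all of whose components have positive standard degree. *)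

(* Defs.v *)
From HB Require Import structures.
From mathcomp Require Import all_boot all_order all_algebra.
From mathcomp Require Import finmap multiset.
From mathcomp Require Import all_classical all_reals all_analysis.

Set Implicit Arguments.
Unset Strict Implicit.
Unset Printing Implicit Defensive.

Import Order.TTheory GRing.Theory Num.Theory.
Import numFieldNormedType.Exports.
Local Open Scope classical_set_scope.
Local Open Scope ring_scope.

Section SmoothFunctions.
Variable R : realType.
Implicit Types (f g : R -> R) (n : nat).

Definition is_smooth f : Prop :=
  forall n (x : R), derivable (derive1n n f) x 1.

Definition smooth : {pred R -> R} := fun f => `[< is_smooth f >].

Let Ck n f := forall k, (k <= n)%N -> forall x : R, derivable (derive1n k f) x 1.

Let CkS n f : (forall x : R, derivable f x 1) -> Ck n (derive1 f) -> Ck n.+1 f.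
Proof.
by move=> df Cf [|k] kn x; [rewrite derive1n0|rewrite derive1Sn; exact: Cf].
Qed.

Let Ck0 n f : Ck n f -> forall x : R, derivable f x 1.
Proof. by move=> Cf x; have := Cf 0%N (leq0n _) x. Qed.

Let Ck1 n f : Ck n.+1 f -> Ck n (derive1 f).
Proof. by move=> Cf k kn x; rewrite -derive1Sn; exact: Cf. Qed.

Let CkW n f : Ck n.+1 f -> Ck n f.
Proof. by move=> Cf k kn x; apply: Cf; exact: leqW. Qed.

Let CkB n f g : Ck n f -> Ck n g -> Ck n (f - g).
Proof.
elim: n f g => [|n IHn] f g Cf Cg.
  case=> // _ x; rewrite derive1n0.
  by apply: derivableB; [exact: (Ck0 Cf)|exact: (Ck0 Cg)].
apply: CkS => [x|].
  by apply: derivableB; [exact: (Ck0 Cf)|exact: (Ck0 Cg)].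
have -> : derive1 (f - g) = derive1 f - derive1 g.
  apply/funext => x; rewrite derive1E.
  by rewrite (deriveB (@Ck0 _ _ Cf x) (@Ck0 _ _ Cg x)) -!derive1E.
by apply: IHn; exact: Ck1.
Qed.

Let Ck_cst n (a : R) : Ck n (cst a).
Proof.
elim: n a => [|n IHn] a.
  by case=> // _ x; rewrite derive1n0; exact: derivable_cst.
apply: CkS => [x|]; first exact: derivable_cst.
have -> : derive1 (cst a) = cst (0 : R).
  by apply/funext => x; exact: derive1_cst.
exact: IHn.
Qed.

Let CkD n f g : Ck n f -> Ck n g -> Ck n (f + g).
Proof.
move=> Cf Cg; have -> : f + g = f - (cst 0 - g) by apply/funext => x /=; rewrite !fctE sub0r opprK.
by apply: CkB => //; apply: CkB.
Qed.

Let CkM n f g : Ck n f -> Ck n g -> Ck n (f * g).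
Proof.
elim: n f g => [|n IHn] f g Cf Cg.
  case=> // _ x; rewrite derive1n0.
  by apply: derivableM; [exact: (Ck0 Cf)|exact: (Ck0 Cg)].
apply: CkS => [x|].
  by apply: derivableM; [exact: (Ck0 Cf)|exact: (Ck0 Cg)].
have -> : derive1 (f * g) = f * derive1 g + g * derive1 f.
  apply/funext => x; rewrite derive1E.
  by rewrite (deriveM (@Ck0 _ _ Cf x) (@Ck0 _ _ Cg x)) -!derive1E.
by apply: CkD; apply: IHn; by [exact: CkW|exact: Ck1].
Qed.

Let smoothP f : reflect (forall n, Ck n f) (f \in smooth).
Proof.
apply: (iffP (asboolP _)) => [sf n k _ x|Cf n x]; first exact: sf.
exact: (Cf n n).
Qed.

Lemma smooth_subring_closed : subring_closed smooth.
Proof.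
split=> [|f g /smoothP Cf /smoothP Cg|f g /smoothP Cf /smoothP Cg].
- by apply/smoothP => n; exact: Ck_cst.
- by apply/smoothP => n; exact: CkB.
- by apply/smoothP => n; exact: CkM.
Qed.

HB.instance Definition _ :=
  GRing.isSubringClosed.Build (R -> R) smooth smooth_subring_closed.

Record Cinf := MkCinf { Cfun :> R -> R; Cinf_smooth : Cfun \in smooth }.

HB.instance Definition _ := [isSub for Cfun].
HB.instance Definition _ := [Choice of Cinf by <:].
HB.instance Definition _ :=
  GRing.SubChoice_isSubComPzRing.Build (R -> R) smooth Cinf
    smooth_subring_closed.

Lemma smooth_cst (a : R) : cst a \in smooth.
Proof. by apply/smoothP => n; exact: Ck_cst. Qed.

Lemma smooth_id : id \in smooth.
Proof.
apply/smoothP => n [|k] _ x; first by rewrite derive1n0; exact: derivable_id.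
have -> : derive1n k.+1 id = derive1n k (cst (1 : R)).
  rewrite derive1Sn; congr derive1n.
  by apply/funext => y; rewrite derive1E derive_id.
exact: (@Ck_cst k).
Qed.

Lemma smooth_derive1 f : f \in smooth -> derive1 f \in smooth.
Proof. by move=> /smoothP Cf; apply/smoothP => n; exact: Ck1. Qed.

Definition Ccst (a : R) : Cinf := MkCinf (smooth_cst a).

Definition Cid : Cinf := MkCinf smooth_id.

Definition Cderiv (f : Cinf) : Cinf := MkCinf (smooth_derive1 (Cinf_smooth f)).

Lemma derivable_Cinf (p : Cinf) (x : R) : derivable p x 1.
Proof. by have /smoothP/(_ 0%N)/Ck0 := Cinf_smooth p; apply. Qed.

Lemma CderivB : {morph Cderiv : p q / p - q}.
Proof.
move=> p q; apply/val_inj/funext => x; rewrite /= derive1E.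
by rewrite (deriveB (@derivable_Cinf p x) (@derivable_Cinf q x)) -!derive1E.
Qed.

Let scaleC (a : R) (p : Cinf) : Cinf := Ccst a * p.

Let scaleCA a b p : scaleC a (scaleC b p) = scaleC (a * b) p.
Proof. by rewrite /scaleC mulrA; congr (_ * _); apply: val_inj. Qed.

Let scaleC1 : left_id 1 scaleC.
Proof. by move=> p; rewrite /scaleC -[RHS]mul1r; congr (_ * _); apply: val_inj. Qed.

Let scaleCDr : right_distributive scaleC +%R.
Proof. by move=> a p q; rewrite /scaleC mulrDr. Qed.

Let scaleCDl p : {morph scaleC^~ p : a b / a + b}.
Proof.
by move=> a b; rewrite /scaleC -mulrDl; congr (_ * _); apply: val_inj.
Qed.

HB.instance Definition _ := GRing.Zmodule_isLmodule.Build R Cinf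
  scaleCA scaleC1 scaleCDr scaleCDl.

End SmoothFunctions.

(* The pair (E, O) encodes the monomial
     \prod_(i in E) u^{i+1} * \prod_(j in O) theta^j,
   the odd factors being taken in increasing order of j: the index of an even
   variable is shifted because u^0 = u only enters through the coefficients. *)
Definition monomial : Type := ({mset nat}%mset * {fset nat}%fset)%type.

Definition mon1 : monomial := (mset0, fset0).

Definition stddeg (m : monomial) : nat :=
  (\sum_(i <- m.1) i.+1 + \sum_(j <- m.2) j)%N.

Definition superdeg (m : monomial) : nat := #|` m.2|.

(* theta_A * theta_B = (-1) ^ (inversions A B) * theta_(A u B) for disjoint
   A and B, where theta_A is the increasing product of the theta^j, j in A *)
Definition inversions (A B : {fset nat}%fset) : nat :=
  (\sum_(a <- A) \sum_(b <- B) (b < a))%N.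

Section FormalCalculus.
Variable R : realType.

(* There are finitely many monomials of each standard degree, so that an
   element of the completion (an infinite sum of components, one for each
   standard degree) is an arbitrary family of coefficients. *)
Definition Ahat : Type := monomial -> Cinf R.

HB.instance Definition _ := GRing.Lmodule.on Ahat.
HB.instance Definition _ := Choice.on Ahat.

Implicit Types (f g : Ahat) (m : monomial) (s : nat).

Definition amonom (a : Cinf R) m : Ahat := fun m' => if m' == m then a else 0.

Definition coef_fun (a : Cinf R) : Ahat := amonom a mon1.

Definition uvar s : Ahat :=
  if s is s'.+1 then amonom 1 ([mset s']%mset, fset0) else coef_fun (Cid R).

Definition thvar s : Ahat := amonom 1 (mset0, [fset s]%fset).

Definition amul f g : Ahat := fun m =>
  \sum_(E \in [set E : {mset nat}%mset | (E `<=` m.1)%mset])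
    \sum_(O <- fpowerset m.2)
      (-1) ^+ inversions O (m.2 `\` O)%fset *
      (f (E, O) * g ((m.1 `\` E)%mset, (m.2 `\` O)%fset)).

Definition d_u s f : Ahat := fun m =>
  if s is s'.+1 then f ((s' +` m.1)%mset, m.2) *+ (m.1 s').+1
  else Cderiv (f m).

(* left derivative *)
Definition d_th s f : Ahat := fun m =>
  if s \in m.2 then 0
  else (-1) ^+ (\sum_(j <- m.2) (j < s))%N * f (m.1, (s |` m.2)%fset).

(* The sum of a series whose s-th term only has components of standard degree
   at least s: the coefficient of m receives no contribution from s > stddeg m.
   All the infinite sums below are of this kind. *)
Definition asum (F : nat -> Ahat) : Ahat := fun m =>
  \sum_(s < (stddeg m).+1) F s m.

Definition dx f : Ahat := asum (fun s =>
  amul (uvar s.+1) (d_u s f) + amul (thvar s.+1) (d_th s f)).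

Definition dx_image : {pred Ahat} := fun f => `[< exists g, f = dx g >].

Lemma finite_submset (M : {mset nat}%mset) :
  finite_set [set E : {mset nat}%mset | (E `<=` M)%mset].
Proof.
rewrite -[M]seq_mset_id; elim: (M : seq nat) => [|x s IHs].
  apply: (@sub_finite_set _ _ [set mset0]) => // E /msubsetP E0.
  apply/msetP => y; apply/eqP; rewrite mset0E -leqn0.
  by rewrite (leq_trans (E0 y)) // mset_seqE.
apply: (@sub_finite_set _ _ ([set E | (E `<=` seq_mset s)%mset] `|`
    (fun E => (x +` E)%mset) @` [set E | (E `<=` seq_mset s)%mset])).
  move=> E /= /msubsetP Es; have [xE|xE] := boolP (x \in E).
    right; exists (E `\ x)%mset; last by rewrite msetB1K.
    apply/msubsetP => y; rewrite msetB1E mset_seqE leq_subLR.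
    by have := Es y; rewrite !mset_seqE /= eq_sym.
  left; apply/msubsetP => y; rewrite mset_seqE.
  have [->|yx] := eqVneq y x; first by rewrite (mset_eq0P xE).
  by have := Es y; rewrite !mset_seqE /= eq_sym (negPf yx).
by rewrite finite_setU; split=> //; exact: finite_image.
Qed.

Lemma amulDr f : {morph amul f : g h / g + h}.
Proof.
move=> g h; apply/funext => m; rewrite /amul.
rewrite [RHS]/GRing.add /= -fsbig_split; last exact: finite_submset.
apply: eq_fsbigr => E _; rewrite -big_split /=.
by apply: eq_bigr => O _; rewrite -mulrDr -mulrDr.
Qed.

Lemma amulBr f : {morph amul f : g h / g - h}.
Proof. by move=> g h; apply/eqP; rewrite eq_sym subr_eq -amulDr subrK. Qed.

Lemma d_uB s : {morph d_u s : f g / f - g}.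
Proof.
move=> f g; apply/funext => m; case: s => [|s] /=; first exact: CderivB.
by rewrite -[RHS]/(_ - _) -mulrnBl.
Qed.

Lemma d_thB s : {morph d_th s : f g / f - g}.
Proof.
move=> f g; apply/funext => m; rewrite /d_th -[RHS]/(_ - _).
by case: ifP => _; rewrite ?subr0 // -mulrBr.
Qed.

Lemma dxB : {morph dx : f g / f - g}.
Proof.
move=> f g; apply/funext => m; rewrite -[RHS]/(_ - _) -sumrB.
apply: eq_bigr => s _; rewrite -[RHS]/((_ - _) m); congr (_ m).
by rewrite d_uB d_thB !amulBr opprD addrACA.
Qed.

Lemma dx_image_zmod_closed : zmod_closed dx_image.
Proof.
split=> [|f g /asboolP[f' ->] /asboolP[g' ->]].
  by apply/asboolP; exists (0 - 0); rewrite dxB !subrr.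
by apply/asboolP; exists (f' - g'); rewrite dxB.
Qed.

HB.instance Definition _ :=
  GRing.isZmodClosed.Build Ahat dx_image dx_image_zmod_closed.

Definition Fhat : Type := Quotient.quot dx_image.

Definition Fint f : Fhat := \pi_(Quotient.quot dx_image)%qT f.

Definition super_homog p f : Prop :=
  forall m, superdeg m <> p -> f m = 0.

Definition std_homog d f : Prop :=
  forall m, stddeg m <> d -> f m = 0.

Definition std_ge d f : Prop :=
  forall m, (stddeg m < d)%N -> f m = 0.

Definition Fsuper p (P : Fhat) : Prop :=
  exists2 f, super_homog p f & P = Fint f.

(* dx is homogeneous for both gradations, which therefore descend to Fhat *)
Definition Fstd_ge d (P : Fhat) : Prop :=
  exists2 f, std_ge d f & P = Fint f.

Definition dx_opp_iter s f : Ahat := (-1) ^+ s *: iter s dx f.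

Definition var_u f : Ahat := asum (fun s => dx_opp_iter s (d_u s f)).

Definition var_th f : Ahat := asum (fun s => dx_opp_iter s (d_th s f)).

Definition schouten_rep p f g : Ahat :=
  amul (var_th f) (var_u g) + (-1) ^+ p *: amul (var_u f) (var_th g).

(* The Schouten bracket of P in Fhat^p with Q; it does not depend on the
   representatives, as both variational derivatives vanish on the image of
   dx. *)
Definition schouten p (P Q : Fhat) : Fhat :=
  Fint (schouten_rep p (repr P : Ahat) (repr Q : Ahat)).

(* exp (ad_X) P for X = Fint x in Fhat^1; when x has positive standard degree,
   ad_X raises the standard degree by at least 1 *)
Definition exp_ad (x : Ahat) (P : Fhat) : Fhat :=
  Fint (asum (fun n => (n`!%:R : R)^-1 *: iter n (schouten_rep 1 x) (repr P))).

Definition is_bihamiltonian (P : Fhat * Fhat) : Prop :=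
  [/\ Fsuper 2 P.1, Fsuper 2 P.2 &
   [/\ schouten 2 P.1 P.1 = 0, schouten 2 P.1 P.2 = 0
     & schouten 2 P.2 P.2 = 0]].

Definition P1 : Fhat := Fint (2^-1 *: amul (thvar 0) (thvar 1)).

Definition P2 : Fhat :=
  Fint (2^-1 *: amul (uvar 0) (amul (thvar 0) (thvar 1))).

Definition is_deformation (P : Fhat * Fhat) : Prop :=
  [/\ is_bihamiltonian P, Fstd_ge 2 (P.1 - P1) & Fstd_ge 2 (P.2 - P2)].

Definition equivalent (P Q : Fhat * Fhat) : Prop :=
  exists x, [/\ super_homog 1 x, std_ge 1 x,
                Q.1 = exp_ad x P.1 & Q.2 = exp_ad x P.2].

Definition is_deformation_class (C : set (Fhat * Fhat)) : Prop :=
  exists2 P, is_deformation P & C = [set Q | is_deformation Q /\ equivalent P Q].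

Definition diffpoly k f : Prop := super_homog 0 f /\ std_homog k f.

(* B n s is the coefficient of epsilon^n delta^(s)(x - y) *)
Definition bracket := nat -> nat -> Ahat.

(* skew-adjointness of the differential operator \sum_(s <= N) P s dx^s *)
Definition skew_adjoint (N : nat) (P : nat -> Ahat) : Prop := forall f,
  \sum_(s < N.+1) dx_opp_iter s (amul (P s) f) =
  - \sum_(s < N.+1) amul (P s) (iter s dx f).

Definition is_bracket (B : bracket) : Prop := forall n,
  [/\ forall s, (s <= n.+1)%N -> diffpoly (n.+1 - s)%N (B n s),
      forall s, (n.+1 < s)%N -> B n s = 0
    & skew_adjoint n.+1 (B n)].

Definition bivector (B : bracket) : Fhat :=
  Fint (2^-1 *: asum (fun n =>
    \sum_(s < n.+2) amul (B n s) (amul (thvar 0) (thvar s)))).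

(* the bracket f epsilon^n delta^(s)(x - y) *)
Definition eps_delta n s f : bracket :=
  fun n' s' => if (n' == n) && (s' == s) then f else 0.

(* \sum_(g >= 2) epsilon^(2g)
     \sum_(0 <= k <= 2g+1) A g k delta^(2g+1-k)(x - y);
   only the indices g <= n can contribute to epsilon^n *)
Definition higher_terms (A : nat -> nat -> Ahat) : bracket := fun n s =>
  \sum_(2 <= g < n.+1) \sum_(k < (2 * g)%N.+2)
    eps_delta (2 * g)%N ((2 * g).+1 - k)%N (A g k) n s.

Definition first_bracket : bracket := eps_delta 0 1 (coef_fun 1).

Definition second_bracket (c : Cinf R) (A : nat -> nat -> Ahat) : bracket :=
  let u := uvar 0 in
  let u_x := uvar 1 in
  let u_xx := uvar 2 in
  let c0 := coef_fun c in
  let c1 := coef_fun (Cderiv c) in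
  let c2 := coef_fun (Cderiv (Cderiv c)) in
  eps_delta 0 1 u + eps_delta 0 0 (2^-1 *: u_x)
  + (eps_delta 2 3 (3 *: c0) + eps_delta 2 2 ((9 / 2) *: amul c1 u_x)
     + eps_delta 2 1 ((3 / 2) *: amul c2 (amul u_x u_x))
     + eps_delta 2 1 ((3 / 2) *: amul c1 u_xx))
  + higher_terms A.

Definition standard_form (c : Cinf R) (P : Fhat * Fhat) : Prop :=
  exists A : nat -> nat -> Ahat,
    [/\ forall (g k : nat), (2 <= g)%N -> (k <= (2 * g).+1)%N ->
       diffpoly k (A g k),
        is_bracket (second_bracket c A),
        P.1 = bivector first_bracket
      & P.2 = bivector (second_bracket c A)].

End FormalCalculus.

Arguments is_deformation_class {R} C.
Arguments standard_form {R} c P.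

(* Main.v *)
From HB Require Import structures.
Require Import Defs.
From mathcomp Require Import all_boot all_order all_algebra.
From mathcomp Require Import finmap multiset.
From mathcomp Require Import all_classical all_reals all_analysis.
From mathcomp Require Import ring.

(** The brackets with the two undeformed bivectors are anticommuting
    differentials D1 and D2 on functionals, induced by odd derivations of the
    densities. In the lowest degree where two deformations differ, the
    difference (f1, f2) satisfies the linearised equations D1 f1 = 0,
    D1 f2 + D2 f1 = 0, D2 f2 = 0, and a vector field y changes it by
    (D1 y, D2 y). The theorem therefore rests on the cohomology of this pair of
    differentials in three places.

    In standard degree 2 and more, every solution (f1, f2) is of the form
    (D1 y, D2 y), with one obstruction in degree 3 ([bivector_pair_exact]): if
    [alpha] denotes the coefficient of theta^3 in the variational derivative,
    the function alpha f2 - u alpha f1 has to vanish.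

    This function does not change under equivalences ([gam_expad]), so it
    classifies deformations ([classification]). On a standard form it only
    depends on the terms of order epsilon^2, hence on c
    ([standard_form_Fgam]). This proves uniqueness.

    In standard degree 4 and more, a trivector closed for both differentials
    is D2 z for some z with D1 z = 0 ([trivector_exact]). Hence the prescribed
    terms of order epsilon^2, which do form a cocycle, extend to a
    bihamiltonian structure ([standard_exists]). The coefficients of its
    brackets are the derivatives along theta^s of its variational derivative,
    which gives the standard form ([standard_bracket], [bracket_of_skew]).

    The cohomology is computed on densities, filtered by the number m of jet
    variables u^s, s >= 1. The leading part of D1 is a Koszul differential
    with an explicit homotopy ([delta_exact]), so that D1 is exact
    ([d1_exact]). For D2, the homotopy is the derivative along theta^1: its
    anticommutator with D2 - u D1 is the multiplication by m + (d - p) / 2 in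
    standard degree d and super degree p ([DP_iota1]). Where this weight does
    not vanish, a common cocycle is D2 (D1 b) ([bh_exact]). The passage to
    functionals uses the injectivity of the total derivative in positive
    degrees ([bh_functional]); the weight does vanish for bivectors of degree 2
    and 3, which are treated by hand, and there the obstruction appears. *)

Set Implicit Arguments.
Unset Strict Implicit.
Unset Printing Implicit Defensive.
Import Order.TTheory GRing.Theory Num.Theory.
Local Open Scope ring_scope.

(** * Identities in abelian groups, by reflection *)

Inductive zexpr := ZVar of nat | ZZero | ZAdd of zexpr & zexpr | ZOpp of zexpr.

Fixpoint zeval (V : zmodType) (env : seq V) (e : zexpr) : V :=
  match e with
  | ZVar i => nth 0 env i
  | ZZero => 0
  | ZAdd a b => zeval env a + zeval env b
  | ZOpp a => - zeval env a
  end.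

Fixpoint zcoef (e : zexpr) (i : nat) : int :=
  match e with
  | ZVar j => (i == j)%:Z
  | ZZero => 0
  | ZAdd a b => zcoef a i + zcoef b i
  | ZOpp a => - zcoef a i
  end.

(** A reflected expression is determined by its integer coefficients, so that
    comparing coefficients is sound. *)
Lemma zevalE (V : zmodType) (env : seq V) e :
  zeval env e = \sum_(i < size env) nth 0 env i *~ zcoef e i.
Proof.
elim: e => [j||a IHa b IHb|a IHa] /=.
- have [jn|nj] := ltnP j (size env).
    rewrite (bigD1 (Ordinal jn)) //= eqxx mulr1z big1 ?addr0 // => i.
    by rewrite -val_eqE /= => /negPf ->; rewrite mulr0z.
  rewrite nth_default // big1 // => i _.
  by rewrite ltn_eqF ?mulr0z // (leq_trans (ltn_ord i)).
- by rewrite big1 // => i _; rewrite mulr0z.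
- by rewrite IHa IHb -big_split; apply: eq_bigr => i _; rewrite mulrzDr.
- by rewrite IHa -sumrN; apply: eq_bigr => i _; rewrite mulrNz.
Qed.

Lemma zeval_eq (V : zmodType) (env : seq V) a b :
  all (fun i => zcoef a i == zcoef b i) (iota 0 (size env)) ->
  zeval env a = zeval env b.
Proof.
move=> /allP ab; rewrite !zevalE; apply: eq_bigr => i _.
by rewrite (eqP (ab i _)) // mem_iota ltn_ord.
Qed.

Ltac zm_index x env :=
  match env with
  | ?y :: _ => let _ := match goal with _ => unify x y end in constr:(0%N)
  | _ :: ?l => let i := zm_index x l in constr:(i.+1)
  end.
Ltac zm_env env t :=
  lazymatch t with
  | ?a + ?b => let e := zm_env env a in zm_env e b
  | - ?a => zm_env env a
  | 0 => env
  | _ => match env with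
         | _ => let i := zm_index t env in env
         | _ => constr:(t :: env)
         end
  end.
Ltac zm_reify env t :=
  lazymatch t with
  | ?a + ?b => let x := zm_reify env a in let y := zm_reify env b in
               constr:(ZAdd x y)
  | - ?a => let x := zm_reify env a in constr:(ZOpp x)
  | 0 => constr:(ZZero)
  | _ => let i := zm_index t env in constr:(ZVar i)
  end.
(** Used in the algebra of densities, which is not commutative: only the additive
    structure can be normalised blindly, with products as atoms. *)
Ltac zmodule :=
  lazymatch goal with
  | |- @eq ?T ?a ?b =>
    let e0 := zm_env (@nil T) a in let env := zm_env e0 b in
    let x := zm_reify env a in let y := zm_reify env b in
    apply: (@zeval_eq _ env x y); vm_compute; exact: erefl
  end.

(** * Monomials *)

Section Monomials.
Implicit Types (x y z m : monomial).

Definition mmul x y : monomial := ((x.1 `+` y.1)%mset, (x.2 `|` y.2)%fset).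
Definition mdvd x m := (x.1 `<=` m.1)%mset && (x.2 `<=` m.2)%fset.
Definition mdiv m x : monomial := ((m.1 `\` x.1)%mset, (m.2 `\` x.2)%fset).
Definition mdisj x y := [disjoint x.2 & y.2]%fset.

Lemma perm_msetD (A B : {mset nat}%mset) :
  perm_eq (A `+` B)%mset ((A : seq nat) ++ (B : seq nat)).
Proof.
by apply/allP => x _ /=; rewrite count_cat !count_mem_mset msetE2.
Qed.

Lemma perm_fsetU (A B : {fset nat}%fset) : [disjoint A & B]%fset ->
  perm_eq (A `|` B)%fset ((A : seq nat) ++ (B : seq nat)).
Proof.
move=> dAB; apply: uniq_perm; first exact: fset_uniq.
  rewrite cat_uniq !fset_uniq /= andbT; apply/hasPn => b bB.
  by apply/negP => bA; move/fdisjointP: dAB => /(_ _ bA); rewrite bB.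
by move=> i; rewrite mem_cat inE.
Qed.

Lemma perm_big_fsetU (A B : {fset nat}%fset) (F : nat -> nat) :
  [disjoint A & B]%fset ->
  (\sum_(i <- (A `|` B)%fset) F i = \sum_(i <- A) F i + \sum_(i <- B) F i)%N.
Proof. by move=> dAB; rewrite (perm_big _ (perm_fsetU dAB)) big_cat. Qed.

(** The gradations in use are all of this shape: a weight for each variable. *)
Definition wt (a b : nat -> nat) m : nat :=
  (\sum_(i <- m.1) a i + \sum_(j <- m.2) b j)%N.

(** The number of jet variables u^s, s >= 1. It filters the algebra, and the
    cohomology computations proceed from the component without jet variables
    upwards. *)
Definition ulen : monomial -> nat := wt (fun=> 1%N) (fun=> 0%N).

Lemma stddegE : stddeg =1 wt succn id.
Proof. by []. Qed.

Lemma superdegE : superdeg =1 wt (fun=> 0%N) (fun=> 1%N).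
Proof.
by move=> m; rewrite /superdeg /wt big1 // add0n sum1_size.
Qed.

Lemma ulenE m : ulen m = size m.1.
Proof. by rewrite /ulen /wt [X in (_ + X)%N]big1 // addn0 sum1_size. Qed.

Lemma wtM a b x y : mdisj x y -> wt a b (mmul x y) = (wt a b x + wt a b y)%N.
Proof.
move=> dxy; rewrite /wt /= (perm_big _ (perm_msetD _ _)) big_cat /=.
by rewrite perm_big_fsetU // addnACA.
Qed.

Lemma mdvd_mul x m : mdvd x m -> mmul x (mdiv m x) = m.
Proof.
case: m => M T /andP[/= xM xT]; rewrite /mmul /mdiv /= msetBDKC //.
congr (_, _); apply/fsetP => i; rewrite !inE.
by have [ix|//] := boolP (i \in x.2); rewrite (fsubsetP xT).
Qed.

Lemma mdisj_div x m : mdisj x (mdiv m x).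
Proof. by rewrite /mdisj /=; apply/fdisjointP => i iX; rewrite !inE iX. Qed.

Lemma mdvdr x y : mdvd x (mmul x y).
Proof.
rewrite /mdvd /= fsubsetUl andbT; apply/msubsetP => i.
by rewrite msetE2 leq_addr.
Qed.

Lemma mdivK x y : mdisj x y -> mdiv (mmul x y) x = y.
Proof.
case: y => M T dxy; rewrite /mdiv /mmul /= msetDKB; congr (_, _).
apply/fsetP => i; rewrite !inE; have [ix|//] := boolP (i \in x.2).
by move/fdisjointP: dxy => /(_ _ ix) /= /negbTE ->.
Qed.

Lemma wt_mon1 a b : wt a b mon1 = 0%N.
Proof. by rewrite /wt big_mset0 big_seq_fset0. Qed.

Lemma wt_div a b x m : mdvd x m -> wt a b m = (wt a b x + wt a b (mdiv m x))%N.
Proof. by move=> xm; rewrite -{1}(mdvd_mul xm) wtM // mdisj_div. Qed.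

Lemma mmulA x y z : mmul x (mmul y z) = mmul (mmul x y) z.
Proof. by rewrite /mmul /= msetDA fsetUA. Qed.

Lemma mmulC x y : mmul x y = mmul y x.
Proof. by rewrite /mmul /= msetDC fsetUC. Qed.

Lemma inversionsUl (A B C : {fset nat}%fset) : [disjoint A & B]%fset ->
  inversions (A `|` B)%fset C = (inversions A C + inversions B C)%N.
Proof. by move=> dAB; rewrite /inversions perm_big_fsetU. Qed.

Lemma inversionsUr (A B C : {fset nat}%fset) : [disjoint B & C]%fset ->
  inversions A (B `|` C)%fset = (inversions A B + inversions A C)%N.
Proof.
by move=> dBC; rewrite /inversions -big_split; apply: eq_bigr => a _;
  rewrite perm_big_fsetU.
Qed.

(** Each pair is inverted in exactly one of the two orders; this is the origin
    of the sign rule. *)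
Lemma inversionsC (A B : {fset nat}%fset) : [disjoint A & B]%fset ->
  (inversions A B + inversions B A = #|` A| * #|` B|)%N.
Proof.
move=> dAB; rewrite /inversions [X in (_ + X)%N]exchange_big -big_split /=.
rewrite (eq_big_seq (fun=> #|` B|)); last first.
  move=> a aA; rewrite -big_split /= -sum1_size; apply: eq_big_seq => b bB.
  have: a != b by apply: contraTneq bB => <-; exact: (fdisjointP dAB).
  by case: ltngtP.
by rewrite big_const_seq iter_addn addn0 count_predT mulnC.
Qed.

Lemma mdisjMl x y z : mdisj (mmul x y) z = mdisj x z && mdisj y z.
Proof. by rewrite /mdisj /= fdisjointUX. Qed.

Lemma mdisjMr x y z : mdisj x (mmul y z) = mdisj x y && mdisj x z.
Proof. by rewrite /mdisj /= fdisjointXU. Qed.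

Definition submsets (M : {mset nat}%mset) : {fset {mset nat}%mset} :=
  fset_set [set E : {mset nat}%mset | (E `<=` M)%mset].

Lemma in_submsets M E : (E \in submsets M) = (E `<=` M)%mset.
Proof. by rewrite in_fset_set ?mem_setE //; exact: finite_submset. Qed.

Definition mdivisors m : seq monomial :=
  [seq (E, T) | E <- submsets m.1, T <- fpowerset m.2].

Lemma mem_mdivisors x m : (x \in mdivisors m) = mdvd x m.
Proof.
rewrite /mdvd; apply/allpairsP/andP => [[[E T] /= [+ + ->]]|[xE xT]] /=.
  by rewrite in_submsets fpowersetE.
by exists x; rewrite in_submsets fpowersetE; split=> //; case: x {xE xT}.
Qed.

Lemma uniq_mdivisors m : uniq (mdivisors m).
Proof. by apply: allpairs_uniq => [||[a b] [c d] _ _ /=]. Qed.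

(** This finiteness allows identities in the completion to be checked on
    finite sums of monomials. *)
Lemma finite_stddeg_le k : exists2 s : seq monomial, uniq s &
  forall m, (m \in s) = (stddeg m <= k)%N.
Proof.
(* all these monomials divide the one with the largest possible exponents *)
pose E := seq_mset (flatten (nseq k (iota 0 k))).
pose T := [fset i in iota 0 k.+1]%fset.
exists [seq m <- mdivisors (E, T) | (stddeg m <= k)%N].
  by rewrite filter_uniq // uniq_mdivisors.
move=> m; rewrite mem_filter andb_idr // => mk; rewrite mem_mdivisors.
apply/andP; split=> /=.
  apply/msubsetP => i; rewrite mset_seqE count_flatten map_nseq sumn_nseq.
  have [->//|mi] := posnP (m.1 i).
  have /leq_trans/(_ mk) : (m.1 i * i.+1 <= stddeg m)%N.
    rewrite /stddeg sum_mset (big_rem i) /= -?addnA ?leq_addr //.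
    by rewrite msuppE -mset_gt0.
  move=> mik; rewrite (count_uniq_mem _ (iota_uniq _ _)) mem_iota /=.
  have -> : (i < 0 + k)%N by rewrite add0n (leq_trans _ mik) // leq_pmull.
  by rewrite mul1n (leq_trans _ mik) // leq_pmulr.
apply/fsubsetP => j jm; rewrite in_fset mem_iota leq0n add0n ltnS /=.
rewrite (leq_trans _ mk) // /stddeg [X in (_ + X)%N](big_rem j) //=.
by rewrite addnCA leq_addr.
Qed.

End Monomials.

(** * The supercommutative algebra *)

Lemma shuffle (C : comPzRingType) (p q s a b c : C) :
  p * q * (a * (s * (b * c))) = q * s * (p * (a * b) * c).
Proof.
by rewrite !mulrA (mulrAC _ a s) -(mulrA p q s) (mulrC p).
Qed.

Lemma signr_parity (C : pzRingType) (n k : nat) :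
  odd n = odd k -> (-1) ^+ n = (-1) ^+ k :> C.
Proof. by move=> nk; rewrite -signr_odd nk signr_odd. Qed.

Section Algebra.
Variable R : realType.
Local Notation A := (Ahat R).
Implicit Types (f g h : A) (a b : Cinf R) (x y z m : monomial) (r : R).

Lemma amul_sum f g m : amul f g m =
  \sum_(x <- mdivisors m) (-1) ^+ inversions x.2 (mdiv m x).2 *
    (f x * g (mdiv m x)).
Proof.
rewrite /amul fsbig_finite /=; last exact: finite_submset.
by rewrite /mdivisors big_allpairs_dep.
Qed.

Lemma scaleCinfE r a : r *: a = Ccst r * a.
Proof. by []. Qed.

Lemma ahatDE f g m : (f + g) m = f m + g m.
Proof. by []. Qed.

Lemma ahatBE f g m : (f - g) m = f m - g m.
Proof. by []. Qed.

Lemma ahatZE r f m : (r *: f) m = r *: f m.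
Proof. by []. Qed.

Lemma ahat0E m : (0 : A) m = 0.
Proof. by []. Qed.

Lemma ahat_sumE I (s : seq I) (F : I -> A) m :
  (\sum_(i <- s) F i) m = \sum_(i <- s) F i m.
Proof. exact: (big_morph (fun f : A => f m)). Qed.

Lemma amulZl r f g : amul (r *: f) g = r *: amul f g.
Proof.
apply/funext => m; rewrite ahatZE !amul_sum scaler_sumr; apply: eq_bigr => x _.
by rewrite ahatZE !scaleCinfE -mulrA mulrCA mulrA.
Qed.

Lemma amulZr r f g : amul f (r *: g) = r *: amul f g.
Proof.
apply/funext => m; rewrite ahatZE !amul_sum scaler_sumr; apply: eq_bigr => x _.
by rewrite ahatZE !scaleCinfE (mulrCA (f x)) [LHS]mulrCA.
Qed.

Lemma amulDl : left_distributive (@amul R) +%R.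
Proof.
move=> f g h; apply/funext => m; rewrite ahatDE !amul_sum -big_split.
by apply: eq_bigr => x _; rewrite ahatDE mulrDl mulrDr.
Qed.

Lemma a0mul f : amul 0 f = 0.
Proof. by apply: (addrI (amul 0 f)); rewrite -amulDl !addr0. Qed.

Lemma amul0 f : amul f 0 = 0.
Proof. by apply: (addrI (amul f 0)); rewrite -amulDr !addr0. Qed.

Lemma amul_suml I (s : seq I) (F : I -> A) g :
  amul (\sum_(i <- s) F i) g = \sum_(i <- s) amul (F i) g.
Proof.
apply: (big_morph (fun f => amul f g)) => [f h|]; first exact: amulDl.
exact: a0mul.
Qed.

Lemma amul_sumr I (s : seq I) (F : I -> A) g :
  amul g (\sum_(i <- s) F i) = \sum_(i <- s) amul g (F i).
Proof.
apply: (big_morph (amul g)) => [f h|]; first exact: amulDr.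
exact: amul0.
Qed.

Lemma amonomE a x m : amonom a x m = if m == x then a else 0.
Proof. by []. Qed.

Lemma amulL_amonom a x f m : amul (amonom a x) f m =
  if mdvd x m then (-1) ^+ inversions x.2 (mdiv m x).2 * (a * f (mdiv m x))
  else 0.
Proof.
rewrite amul_sum; have [xm|xm] := ifPn.
  rewrite (bigD1_seq x) ?mem_mdivisors ?uniq_mdivisors //= amonomE eqxx.
  rewrite big1 ?addr0 // => y /negPf yx.
  by rewrite amonomE yx mul0r mulr0.
rewrite big_seq big1 // => y; rewrite mem_mdivisors amonomE.
by have [->|_ _] := eqVneq y x; rewrite ?(negPf xm) // mul0r mulr0.
Qed.

Lemma amonomM a b x y : amul (amonom a x) (amonom b y) =
  if mdisj x y then amonom ((-1) ^+ inversions x.2 y.2 * (a * b)) (mmul x y)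
  else 0.
Proof.
apply/funext => m; rewrite amulL_amonom; have [xm|xm] := ifPn.
  rewrite amonomE; have [ym|ym] := eqVneq.
    by rewrite -ym mdisj_div mdvd_mul // amonomE eqxx.
  rewrite !mulr0; have [dxy|//] := ifP; rewrite amonomE.
  by case: eqVneq => // mE; move: ym; rewrite mE mdivK // eqxx.
case: ifP => // dxy; rewrite amonomE; case: eqVneq xm => // ->.
by rewrite mdvdr.
Qed.

(** Closeness in the topology of the completion. *)
Definition eqto (k : nat) f g := forall m, (stddeg m <= k)%N -> f m = g m.

Lemma trunc_ex f k : exists s : seq monomial, forall m,
  (\sum_(x <- s) amonom (f x) x) m = if (stddeg m <= k)%N then f m else 0.
Proof.
have [s us ms] := finite_stddeg_le k; exists s => m; rewrite ahat_sumE -ms.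
have [mS|mS] := ifPn.
  rewrite (bigD1_seq m) //= amonomE eqxx big1 ?addr0 // => y /negPf.
  by rewrite amonomE eq_sym => ->.
rewrite big_seq big1 // => y ys; rewrite amonomE.
by case: eqVneq ys mS => // <- ->.
Qed.

Lemma stddeg_dvd x m : mdvd x m -> (stddeg x <= stddeg m)%N.
Proof. by move=> xm; rewrite !stddegE (wt_div _ _ xm) leq_addr. Qed.

Lemma stddeg_div x m : mdvd x m -> (stddeg (mdiv m x) <= stddeg m)%N.
Proof. by move=> xm; rewrite !stddegE (wt_div _ _ xm) leq_addl. Qed.

Lemma amul_eqto k f f' g g' : eqto k f f' -> eqto k g g' ->
  eqto k (amul f g) (amul f' g').
Proof.
move=> ff gg m mk; rewrite !amul_sum big_seq [RHS]big_seq.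
apply: eq_bigr => x; rewrite mem_mdivisors => xm.
rewrite (ff x) ?(gg (mdiv m x)) // (leq_trans _ mk) //.
  exact: stddeg_div.
exact: stddeg_dvd.
Qed.

Lemma eqto_trunc f k : exists s : seq monomial,
  eqto k f (\sum_(x <- s) amonom (f x) x).
Proof. by have [s sE] := trunc_ex f k; exists s => m mk; rewrite sE mk. Qed.

Lemma amulA_amonom a b c x y z :
  amul (amonom a x) (amul (amonom b y) (amonom c z)) =
  amul (amul (amonom a x) (amonom b y)) (amonom c z).
Proof.
rewrite !amonomM; have [yz|yz] := ifPn; have [xy|xy] := ifPn.
- rewrite !amonomM mdisjMl mdisjMr xy yz andbT.
  rewrite andbC andbT; have [xz|//] := ifPn; rewrite mmulA; congr amonom.
  rewrite /= inversionsUr // inversionsUl // !exprD.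
  exact: shuffle.
- by rewrite a0mul amonomM mdisjMr (negPf xy).
- by rewrite amul0 amonomM mdisjMl (negPf yz) andbF.
- by rewrite a0mul amul0.
Qed.

(** By continuity it suffices to treat monomials, where the signs agree
    because inversions are additive on disjoint unions. *)
Lemma amulA : associative (@amul R).
Proof.
move=> f g h; apply/funext => m; set k := stddeg m.
have [s fs] := eqto_trunc f k; have [t gt] := eqto_trunc g k.
have [v hv] := eqto_trunc h k.
have km : (stddeg m <= k)%N by [].
rewrite (amul_eqto fs (amul_eqto gt hv) km).
rewrite (amul_eqto (amul_eqto fs gt) hv km); congr (_ m).
rewrite !amul_suml; apply: eq_bigr => x _.
rewrite (amul_sumr t (fun y => amonom (g y) y)) amul_suml.
rewrite [LHS]amul_sumr.
apply: eq_bigr => y _.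
rewrite !amul_sumr; apply: eq_bigr => z _; exact: amulA_amonom.
Qed.

Lemma coef_amul a f m : amul (coef_fun a) f m = a * f m.
Proof.
rewrite amulL_amonom /mdvd /= fsub0set msub0set /inversions big_seq_fset0 /=.
rewrite expr0 mul1r; case: m => M T.
by rewrite /mdiv /= msetB0 fsetD0.
Qed.

(** * Parity *)

Implicit Types (d e : bool) (c : Cinf R).

(** The value true stands for odd elements. *)
Definition par (d : bool) f := forall m, odd (superdeg m) != d -> f m = 0.

(** The sign with which an operator of parity d passes f. *)
Definition sg (d : bool) f : A := fun m => (-1) ^+ (d * superdeg m) * f m.

Lemma signZ n a : ((-1) ^+ n : R) *: a = (-1) ^+ n * a.
Proof. by rewrite -signr_odd scaler_sign -signr_odd mulr_sign. Qed.

Lemma sgE d f m : sg d f m = (-1) ^+ (d * superdeg m) *: f m.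
Proof. by rewrite signZ. Qed.

Lemma amulC_amonom a c x y : amul (amonom a x) (amonom c y) =
  (-1) ^+ (superdeg x * superdeg y) *: amul (amonom c y) (amonom a x).
Proof.
rewrite !amonomM /mdisj fdisjoint_sym; have [yx|_] := ifP; last by rewrite scaler0.
rewrite mmulC; apply/funext => m; rewrite ahatZE !amonomE.
case: ifP => _; rewrite ?scaler0 // signZ mulrA -exprD (mulrC c a).
congr (_ * _); rewrite -signr_odd -[RHS]signr_odd; congr (_ ^+ _); congr nat_of_bool.
rewrite /superdeg mulnC -(inversionsC yx) !oddD addbAC addbb /=.
by case: (odd _).
Qed.

Lemma sg_eqto k d f g : eqto k f g -> eqto k (sg d f) (sg d g).
Proof. by move=> fg m mk; rewrite /sg fg. Qed.

Lemma sgD d : {morph sg d : f g / f + g}.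
Proof. by move=> f g; apply/funext => m; rewrite ahatDE !sgE ahatDE scalerDr. Qed.

Lemma sg0 d : sg d 0 = 0.
Proof. by apply/funext => m; rewrite sgE ahat0E scaler0. Qed.

Lemma sgZ d r f : sg d (r *: f) = r *: sg d f.
Proof.
by apply/funext => m; rewrite ahatZE !sgE ahatZE !scalerA mulrC.
Qed.

Lemma sg_sum d I (s : seq I) (F : I -> A) :
  sg d (\sum_(i <- s) F i) = \sum_(i <- s) sg d (F i).
Proof. by apply: (big_morph (sg d)); [exact: sgD|exact: sg0]. Qed.

Lemma sg_amonom d a x :
  sg d (amonom a x) = (-1) ^+ (d * superdeg x) *: amonom a x.
Proof.
apply/funext => m; rewrite sgE ahatZE amonomE.
by case: eqVneq => [->|]; rewrite ?scaler0.
Qed.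

Lemma sg_par d e f : par d f -> sg e f = (-1) ^+ (e * d) *: f.
Proof.
move=> bf; apply/funext => m; rewrite sgE ahatZE.
have [mb|/bf->] := eqVneq (odd (superdeg m)) d; last by rewrite !scaler0.
by congr (_ *: _); apply: signr_parity; rewrite !oddM !oddb mb.
Qed.

Lemma sgF f : sg false f = f.
Proof. by apply/funext => m; rewrite sgE mul0n expr0 scale1r. Qed.

Lemma sgg d e f : sg d (sg e f) = sg (d (+) e) f.
Proof.
apply/funext => m; rewrite !sgE scalerA -exprD -mulnDl; congr (_ *: _).
by rewrite -signr_odd -[RHS]signr_odd !oddM oddD !oddb.
Qed.

Lemma sgM d f g : sg d (amul f g) = amul (sg d f) (sg d g).
Proof.
apply/funext => m; rewrite /sg !amul_sum mulr_sumr big_seq [RHS]big_seq.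
apply: eq_bigr => x; rewrite mem_mdivisors => xm.
rewrite superdegE (wt_div _ _ xm) -!superdegE mulnDr exprD.
by rewrite mulrCA; congr (_ * _); rewrite -!mulrA; congr (_ * _); rewrite mulrCA.
Qed.

(** Again by continuity from the case of monomials. *)
Lemma amulC d f g : par d f -> amul f g = amul (sg d g) f.
Proof.
move=> bf; apply/funext => m; set k := stddeg m.
have [s fs] := eqto_trunc f k; have [t gt] := eqto_trunc g k.
have km : (stddeg m <= k)%N by [].
rewrite (amul_eqto fs gt km) (amul_eqto (sg_eqto d gt) fs km); congr (_ m).
rewrite sg_sum amul_suml amul_sumr; apply: eq_bigr => x _.
rewrite amul_sumr amul_suml; apply: eq_bigr => y _.
rewrite amulC_amonom sg_amonom amulZl.
have [xb|/bf->] := eqVneq (odd (superdeg x)) d; last first.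
  have -> : amonom 0 x = 0 :> A.
    by apply/funext => z; rewrite amonomE; case: ifP.
  by rewrite amul0 !scaler0.
by congr (_ *: _); apply: signr_parity; rewrite !oddM oddb xb.
Qed.

Lemma par_coef a : par false (coef_fun a).
Proof.
move=> m om; rewrite /coef_fun amonomE; have [mE|//] := eqVneq.
by move: om; rewrite mE superdegE wt_mon1.
Qed.

Lemma amul1l : left_id (coef_fun 1) (@amul R).
Proof. by move=> f; apply/funext => m; rewrite coef_amul mul1r. Qed.

Lemma amul1r : right_id (coef_fun 1) (@amul R).
Proof. by move=> f; rewrite -[RHS]amul1l (amulC _ (@par_coef 1)) sgF. Qed.

Lemma ahat_oner_neq0 : coef_fun 1 != 0 :> A.
Proof.
apply/eqP => /(congr1 (fun f : A => f mon1 0)) /= /eqP.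
by rewrite /coef_fun amonomE eqxx oner_eq0.
Qed.

End Algebra.

(* The product, the generators and the derivations are sealed: unification
   would otherwise unfold them into sums over monomials. *)
Fact seal : unit. Proof. exact: tt. Qed.
Definition lmul (R : realType) : Ahat R -> Ahat R -> Ahat R :=
  locked_with seal (@amul R).
Definition cf (R : realType) : Cinf R -> Ahat R := locked_with seal (@coef_fun R).
Definition uv (R : realType) : nat -> Ahat R := locked_with seal (@uvar R).
Definition tv (R : realType) : nat -> Ahat R := locked_with seal (@thvar R).
Definition du (R : realType) : nat -> Ahat R -> Ahat R := locked_with seal (@d_u R).
Definition dt (R : realType) : nat -> Ahat R -> Ahat R := locked_with seal (@d_th R).
Definition Dx (R : realType) : Ahat R -> Ahat R := locked_with seal (@dx R).

Lemma lmulE (R : realType) : @lmul R = @amul R.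
Proof. by rewrite /lmul unlock. Qed.

Lemma cfE (R : realType) : @coef_fun R = @cf R.
Proof. by rewrite /cf unlock. Qed.
Lemma uvE (R : realType) : @uvar R = @uv R.
Proof. by rewrite /uv unlock. Qed.
Lemma tvE (R : realType) : @thvar R = @tv R.
Proof. by rewrite /tv unlock. Qed.
Lemma duE (R : realType) : @d_u R = @du R.
Proof. by rewrite /du unlock. Qed.
Lemma dtE (R : realType) : @d_th R = @dt R.
Proof. by rewrite /dt unlock. Qed.
Lemma DxE (R : realType) : @dx R = @Dx R.
Proof. by rewrite /Dx unlock. Qed.

Section AlgebraInstances.
Variable R : realType.
Local Notation A := (Ahat R).
Implicit Types (f g h : A) (r : R).

Let lmulA : associative (@lmul R).
Proof. by rewrite lmulE; exact: amulA. Qed.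
Let lmul1l : left_id (coef_fun 1) (@lmul R).
Proof. by rewrite lmulE; exact: amul1l. Qed.
Let lmul1r : right_id (coef_fun 1) (@lmul R).
Proof. by rewrite lmulE; exact: amul1r. Qed.
Let lmulDl : left_distributive (@lmul R) +%R.
Proof. by rewrite lmulE; exact: amulDl. Qed.
Let lmulDr : right_distributive (@lmul R) +%R.
Proof. by rewrite lmulE => f; exact: amulDr. Qed.
Let lmulZl r f g : r *: lmul f g = lmul (r *: f) g.
Proof. by rewrite lmulE amulZl. Qed.
Let lmulZr r f g : r *: lmul f g = lmul f (r *: g).
Proof. by rewrite lmulE amulZr. Qed.

HB.instance Definition _ := GRing.Zmodule_isNzRing.Build A
  lmulA lmul1l lmul1r lmulDl lmulDr (@ahat_oner_neq0 R).
HB.instance Definition _ := GRing.Lmodule_isLalgebra.Build R A lmulZl.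
HB.instance Definition _ := GRing.Lalgebra_isAlgebra.Build R A lmulZr.

End AlgebraInstances.

Section Derivations.
Variable R : realType.
Local Notation A := (Ahat R).
Implicit Types (f g h : A) (a c : Cinf R) (x y z m : monomial) (r : R).
Implicit Types (b e : bool) (s t k : nat).

Lemma amulE f g : amul f g = f * g.
Proof. by rewrite -lmulE. Qed.

Lemma coef1 : cf 1 = 1 :> A.
Proof. by rewrite -cfE. Qed.

Lemma coefM a f m : (cf a * f) m = a * f m.
Proof. by rewrite -cfE -amulE coef_amul. Qed.

Lemma coef_funZ r a : cf (r *: a) = r *: cf a.
Proof.
by apply/funext => m; rewrite ahatZE -cfE /coef_fun !amonomE; case: ifP; rewrite ?scaler0.
Qed.

(** * Derivatives of smooth functions *)

Lemma CderivM a c : Cderiv (a * c) = Cderiv a * c + a * Cderiv c.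
Proof.
apply/val_inj/funext => x; rewrite /= derive1E.
rewrite (deriveM (@derivable_Cinf _ a x) (@derivable_Cinf _ c x)) -!derive1E.
by rewrite addrC [X in X + _]mulrC.
Qed.

Lemma CderivD a c : Cderiv (a + c) = Cderiv a + Cderiv c.
Proof.
have C0 : Cderiv (0 : Cinf R) = 0 by rewrite -[X in Cderiv X](subrr 0) CderivB subrr.
have CN d : Cderiv (- d) = - Cderiv d :> Cinf R by rewrite -[- d]add0r CderivB C0 add0r.
by rewrite -[c in LHS]opprK CderivB CN opprK.
Qed.

Lemma Cderiv0 : Cderiv 0 = 0 :> Cinf R.
Proof. by rewrite -[X in Cderiv X](subrr 0) CderivB subrr. Qed.

Lemma Cderiv_cst r : Cderiv (Ccst r) = 0.
Proof. by apply/val_inj/funext => x /=; rewrite derive1_cst. Qed.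

Lemma Cderiv1 : Cderiv 1 = 0 :> Cinf R.
Proof. by rewrite -(Cderiv_cst 1); congr Cderiv; apply: val_inj. Qed.

Lemma Cderiv_id : Cderiv (Cid R) = 1.
Proof. by apply/val_inj/funext => x /=; rewrite derive1E derive_id. Qed.

Lemma CderivZ r a : Cderiv (r *: a) = r *: Cderiv a.
Proof. by rewrite !scaleCinfE CderivM Cderiv_cst mul0r add0r. Qed.

Lemma Cderiv_sign n a : Cderiv ((-1) ^+ n * a) = (-1) ^+ n * Cderiv a.
Proof. by rewrite -!signZ CderivZ. Qed.

(** * Products with a generator *)

Lemma uvarM s f m : (uv R s.+1 * f) m =
  if s \in m.1 then f ((m.1 `\ s)%mset, m.2) else 0.
Proof.
rewrite -uvE /uvar -amulE amulL_amonom /mdvd /= fsub0set andbT msub1set.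
by case: ifP => // sm; rewrite /inversions big_seq_fset0 expr0 !mul1r /mdiv /= fsetD0.
Qed.

(** The exponent of the sign that inserts theta^s into a sorted product. *)
Definition nlt s (T : {fset nat}%fset) := (\sum_(j <- T) (j < s))%N.

Lemma thvarM s f m : (tv R s * f) m =
  if s \in m.2 then (-1) ^+ nlt s m.2 * f (m.1, (m.2 `\ s)%fset) else 0.
Proof.
rewrite -tvE /thvar -amulE amulL_amonom /mdvd /= msub0set fsub1set /=.
case: ifP => // sm; rewrite mul1r /mdiv /= msetB0 /inversions big_seq_fset1.
by rewrite /nlt [in RHS](big_fsetD1 s) //= ltnn.
Qed.

Lemma nltU1 s t T : t \notin T -> nlt s (t |` T)%fset = ((t < s) + nlt s T)%N.
Proof. by move=> tT; rewrite /nlt big_fsetU1. Qed.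

Lemma nltD1 s t T : t \in T -> nlt s T = ((t < s) + nlt s (T `\ t)%fset)%N.
Proof. by move=> tT; rewrite /nlt (big_fsetD1 t). Qed.

Lemma d_thE s f m : dt s f m =
  if s \in m.2 then 0 else (-1) ^+ nlt s m.2 * f (m.1, (s |` m.2)%fset).
Proof. by rewrite -dtE. Qed.

Lemma d_uE s f m : du s.+1 f m = f ((s +` m.1)%mset, m.2) *+ (m.1 s).+1.
Proof. by rewrite -duE. Qed.

Lemma d_u0E f m : du 0 f m = Cderiv (f m).
Proof. by rewrite -duE. Qed.

Lemma d_th_coefM s a f : dt s (cf a * f) = cf a * dt s f.
Proof.
apply/funext => m; rewrite coefM !d_thE; case: ifP => _; rewrite ?mulr0 //.
by rewrite coefM mulrCA.
Qed.

Lemma d_th_uvarM s t f : dt s (uv R t.+1 * f) = uv R t.+1 * dt s f.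
Proof.
apply/funext => m; rewrite uvarM !d_thE uvarM /=.
by case: ifP; case: ifP; rewrite ?mulr0.
Qed.

Lemma signr_mulK (C : pzRingType) n (z : C) : (-1) ^+ n * ((-1) ^+ n * z) = z.
Proof. by rewrite mulrA -exprD addnn -signr_odd odd_double mul1r. Qed.

(** The only sign computation for derivations: theta^s is inserted into a
    sorted product from which theta^t is removed, and the two positions may
    pass each other. *)
Lemma d_th_thvarM s t f :
  dt s (tv R t * f) = (s == t)%:R *: f - tv R t * dt s f.
Proof.
apply/funext => -[M T]; rewrite ahatBE ahatZE d_thE !thvarM d_thE /= !inE.
have [->|st] /= := eqVneq s t.
  rewrite scale1r; have [tT|tT] := ifPn.
    by rewrite fsetD1K // (nltD1 t tT) ltnn add0n signr_mulK subrr.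
  by rewrite (nltU1 _ tT) ltnn add0n signr_mulK fsetU1K // subr0.
rewrite scale0r sub0r.
have [tT|tT] := boolP (t \in T); last by rewrite mulr0 if_same oppr0.
have [sT|sT] := boolP (s \in T); first by rewrite mulr0 oppr0.
rewrite (nltU1 _ sT) (nltD1 s tT).
have -> : ((s |` T) `\ t = s |` T `\ t)%fset.
  apply/fsetP => i; rewrite !inE; case: (eqVneq i s) => [->|]; rewrite ?st //.
rewrite [LHS]mulrA [in RHS]mulrA -!exprD -[RHS]mulN1r mulrA -exprS.
congr (_ * _); apply: signr_parity; rewrite /= !oddD.
by case: (ltngtP s t) st => // _ _ /=; rewrite ?addbF ?addFb; do 2!case: (odd _).
Qed.

Lemma d_uS_coefM s a f : du s.+1 (cf a * f) = cf a * du s.+1 f.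
Proof. by apply/funext => m; rewrite coefM !d_uE coefM mulrnAr. Qed.

Lemma d_u0_coefM a f :
  du 0 (cf a * f) = cf (Cderiv a) * f + cf a * du 0 f.
Proof. by apply/funext => m; rewrite ahatDE !coefM !d_u0E coefM CderivM. Qed.

Lemma d_u0_uvarM t f : du 0 (uv R t.+1 * f) = uv R t.+1 * du 0 f.
Proof.
by apply/funext => m; rewrite uvarM !d_u0E uvarM; case: ifP => //; rewrite Cderiv0.
Qed.

Lemma d_uS_uvarM s t f :
  du s.+1 (uv R t.+1 * f) = (s == t)%:R *: f + uv R t.+1 * du s.+1 f.
Proof.
apply/funext => -[M T]; rewrite ahatDE ahatZE d_uE !uvarM d_uE /= in_mset1D.
rewrite msetB1E [t == s]eq_sym; have [->|st] /= := eqVneq s t.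
  rewrite scale1r msetD1K; have [tM|tM] := ifPn.
    by rewrite msetB1K // subn1 prednK ?mset_gt0 // mulrS.
  by rewrite (mset_eq0P tM) addr0.
rewrite scale0r add0r subn0; have [tM|_] := ifPn; last by rewrite mul0rn.
congr (f (_, _) *+ _); apply/msetP => i; rewrite !(mset1DE, msetB1E).
case: (eqVneq i t) => [->|]; last by rewrite !subn0.
by rewrite [t == s]eq_sym (negPf st).
Qed.

Lemma d_u_thvarM s t f : du s (tv R t * f) = tv R t * du s f.
Proof.
apply/funext => m; case: s => [|s]; rewrite thvarM ?d_u0E ?d_uE !thvarM /=.
  by case: ifP; rewrite ?Cderiv0 // Cderiv_sign.
by case: ifP; rewrite ?mul0rn // mulrnAr.
Qed.

Lemma par_amonom a x : par (odd (superdeg x)) (amonom a x).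
Proof. by move=> m; rewrite amonomE; have [->|//] := eqVneq m x; rewrite eqxx. Qed.

Lemma par_cf a : par false (cf a).
Proof. by rewrite -cfE; exact: par_coef. Qed.

Lemma par_uvar s : par false (uv R s).
Proof.
rewrite -uvE; case: s => [|s]; first exact: par_coef.
have <- : odd (superdeg ([mset s]%mset, fset0)) = false.
  by rewrite superdegE /wt big_seq_fset0 big1.
exact: par_amonom.
Qed.

Lemma par_thvar s : par true (tv R s).
Proof.
have <- : odd (superdeg (mset0, [fset s]%fset)) = true.
  by rewrite superdegE /wt big_seq_fset1 big1.
rewrite -tvE; exact: par_amonom.
Qed.

(** * Superderivations *)

Lemma sgMr b f g : sg b (f * g) = sg b f * sg b g.
Proof. by rewrite -!amulE sgM. Qed.

Lemma mul_eqto k f f' g g' : eqto k f f' -> eqto k g g' -> eqto k (f * g) (f' * g').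
Proof. by rewrite -!amulE; exact: amul_eqto. Qed.

(** Polynomials are reached by successive multiplication by generators. *)
Lemma amonom_ind (P : A -> Prop) :
  (forall a, P (cf a)) ->
  (forall s f, P f -> P (uv R s.+1 * f)) ->
  (forall s f, P f -> P (tv R s * f)) ->
  forall a x, P (amonom a x).
Proof.
rewrite -cfE -uvE -tvE => Pc Pu Pt a [M T]; elim/fset1U_rect: T a => [|s T sT IH] a.
  rewrite -[M]seq_mset_id; elim: (M : seq nat) a => [|i l IH] a.
    have -> : seq_mset [::] = mset0 :> {mset nat}%mset.
      by apply/msetP => j; rewrite mset_seqE mset0E.
    have -> : amonom a (mset0, fset0) = coef_fun a by [].
    exact: Pc.
  have -> : amonom a (seq_mset (i :: l), fset0) =
            uvar R i.+1 * amonom a (seq_mset l, fset0); last exact/Pu/IH.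
  rewrite -amulE /uvar amonomM /mdisj fdisjoint0X /inversions big_seq_fset0.
  by rewrite !mul1r /mmul /= fsetU0 mset_cons.
have dsT : [disjoint [fset s] & T]%fset by rewrite fdisjoint1X.
set n := inversions [fset s]%fset T.
have -> : amonom a (M, (s |` T)%fset) = thvar R s * amonom ((-1) ^+ n * a) (M, T).
  by rewrite -amulE /thvar amonomM /mdisj dsT mul1r signr_mulK /mmul /= mset0D.
exact/Pt/IH.
Qed.

Lemma signZK n f : (-1) ^+ n *: ((-1) ^+ n *: f) = f.
Proof. by rewrite scalerA -exprD addnn -signr_odd odd_double scale1r. Qed.

(** Superderivations of parity e. Continuity is part of the notion: it extends
    identities from polynomials to the completion. The last field says that E
    changes the parity by e. *)
Record sder (e : bool) (E : A -> A) : Prop := Sder {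
  sder_lin : forall r f g, E (r *: f + g) = r *: E f + E g;
  sder_leib : forall f g, E (f * g) = E f * g + sg e f * E g;
  sder_cont : forall k, exists K, forall f, eqto K f 0 -> eqto k (E f) 0;
  sder_sg : forall b f, E (sg b f) = (-1) ^+ (b * e) *: sg b (E f) }.

Section SderTheory.
Variables (e : bool) (E : A -> A).
Hypothesis Elin : forall r f g, E (r *: f + g) = r *: E f + E g.

Lemma lin0 : E 0 = 0.
Proof.
by apply: (addrI (E 0)); rewrite addr0 -[X in X + _]scale1r -Elin scale1r addr0.
Qed.

Lemma linD f g : E (f + g) = E f + E g.
Proof. by rewrite -[f in LHS]scale1r Elin scale1r. Qed.

Lemma linZ r f : E (r *: f) = r *: E f.
Proof. by rewrite -[X in E X]addr0 Elin lin0 addr0. Qed.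

Lemma linN f : E (- f) = - E f.
Proof. by rewrite -scaleN1r linZ scaleN1r. Qed.

Lemma linB f g : E (f - g) = E f - E g.
Proof. by rewrite linD linN. Qed.

Lemma lin_sum I (l : seq I) (F : I -> A) :
  E (\sum_(i <- l) F i) = \sum_(i <- l) E (F i).
Proof. by apply: (big_morph E); [exact: linD|exact: lin0]. Qed.

Hypothesis Econt : forall k, exists K, forall f, eqto K f 0 -> eqto k (E f) 0.

Lemma cont_eqto k : exists2 K, (k <= K)%N &
  forall f g, eqto K f g -> eqto k (E f) (E g).
Proof.
have [K EK] := Econt k; exists (maxn k K); first exact: leq_maxl.
move=> f g fg m mk; apply/eqP; rewrite -subr_eq0 -ahatBE -linB; apply/eqP.
apply: (EK (f - g)) => // z zK; rewrite ahatBE fg ?subrr //.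
by rewrite (leq_trans zK) // leq_maxr.
Qed.

Lemma amonom_eq0 : (forall a x, E (amonom a x) = 0) -> forall f, E f = 0.
Proof.
move=> E0 f; apply/funext => m; have [K _ EK] := cont_eqto (stddeg m).
have [s fs] := eqto_trunc f K; rewrite (EK _ _ fs) // lin_sum.
by rewrite big1.
Qed.

(** Leibniz' rule propagates from products with one generator to monomials,
    and then by continuity to all products. *)
Lemma leibniz_generators :
  (forall a g, E (cf a * g) = E (cf a) * g + cf a * E g) ->
  (forall s g, E (uv R s.+1 * g) = E (uv R s.+1) * g + uv R s.+1 * E g) ->
  (forall s g, E (tv R s * g) = E (tv R s) * g + sg e (tv R s) * E g) ->
  forall f g, E (f * g) = E f * g + sg e f * E g.
Proof.
move=> Ec Eu Et; pose P f := forall g, E (f * g) = E f * g + sg e f * E g.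
have sc a : sg e (cf a) = cf a.
  by rewrite (sg_par _ (@par_cf a)) muln0 scale1r.
have su s : sg e (uv R s.+1) = uv R s.+1.
  by rewrite (sg_par _ (@par_uvar s.+1)) muln0 scale1r.
have Pm a x : P (amonom a x).
  apply: (@amonom_ind P) => [{}a g|s f Pf g|s f Pf g].
  - by rewrite Ec sc.
  - by rewrite -mulrA !Eu Pf sgMr su !mulrDl !mulrDr !mulrA addrA.
  - by rewrite -mulrA !Et Pf sgMr !mulrDl !mulrDr !mulrA addrA.
move=> f g; apply/funext => m.
have [K mK EK] := cont_eqto (stddeg m); have [s fs] := eqto_trunc f K.
have fs' := fun z zm => fs z (leq_trans zm mK).
rewrite (EK _ _ (mul_eqto fs (fun _ _ => erefl))) //.
rewrite ahatDE (mul_eqto (EK _ _ fs) (fun _ _ => erefl)) //.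
rewrite [X in _ + X](mul_eqto (sg_eqto e fs') (fun _ _ => erefl)) //.
rewrite -ahatDE; congr (_ m); rewrite lin_sum sg_sum !mulr_suml lin_sum.
by rewrite -big_split; apply: eq_bigr => x _; rewrite Pm.
Qed.

End SderTheory.

Section SderClosure.
Implicit Types E F : A -> A.

Lemma sder_mk e E :
  (forall r f g, E (r *: f + g) = r *: E f + E g) ->
  (forall k, exists K, forall f, eqto K f 0 -> eqto k (E f) 0) ->
  (forall b f, E (sg b f) = (-1) ^+ (b * e) *: sg b (E f)) ->
  (forall a g, E (cf a * g) = E (cf a) * g + cf a * E g) ->
  (forall s g, E (uv R s.+1 * g) = E (uv R s.+1) * g + uv R s.+1 * E g) ->
  (forall s g, E (tv R s * g) = E (tv R s) * g + sg e (tv R s) * E g) ->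
  sder e E.
Proof. by move=> *; split=> //; exact: leibniz_generators. Qed.

(** Polynomials are dense. Every operator identity below is an identity of
    superderivations, reduced in this way to the generators. *)
Lemma sder_ext e E F : sder e E -> sder e F ->
  (forall a, E (cf a) = F (cf a)) ->
  (forall s, E (uv R s.+1) = F (uv R s.+1)) ->
  (forall s, E (tv R s) = F (tv R s)) -> E =1 F.
Proof.
move=> dE dF Ec Eu Et f; apply/eqP; rewrite -subr_eq0; apply/eqP; move: f.
apply: (amonom_eq0 (E := fun f => E f - F f)) => [r f g|k|].
- by rewrite (sder_lin dE) (sder_lin dF) scalerBr addrACA -opprD.
- have [K EK] := sder_cont dE k; have [K' FK] := sder_cont dF k.
  exists (maxn K K') => f f0 m mk; rewrite ahatBE EK ?FK ?subrr // => z zK;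
    by apply: f0; rewrite leq_max zK ?orbT.
apply: (@amonom_ind (fun f => E f - F f = 0)) => [a|s f /eqP|s f /eqP].
- by rewrite Ec subrr.
- rewrite subr_eq0 => /eqP EF; rewrite (sder_leib dE) (sder_leib dF) Eu EF.
  by rewrite subrr.
- rewrite subr_eq0 => /eqP EF; rewrite (sder_leib dE) (sder_leib dF) Et EF.
  by rewrite subrr.
Qed.

Lemma sgN b f : sg b (- f) = - sg b f.
Proof. by rewrite -scaleN1r sgZ scaleN1r. Qed.

Lemma sgB b f g : sg b (f - g) = sg b f - sg b g.
Proof. by rewrite sgD sgN. Qed.

Lemma congrB (V : zmodType) (p q v w : V) : p = q -> v = w -> p - v = q - w.
Proof. by move=> -> ->. Qed.

Lemma sder_add e E F : sder e E -> sder e F -> sder e (fun f => E f + F f).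
Proof.
move=> dE dF; split=> [r f g|f g|k|b f].
- by rewrite (sder_lin dE) (sder_lin dF) scalerDr addrACA.
- by rewrite (sder_leib dE) (sder_leib dF) mulrDl mulrDr addrACA.
- have [K EK] := sder_cont dE k; have [K' FK] := sder_cont dF k.
  exists (maxn K K') => f f0 m mk; rewrite ahatDE EK ?FK ?addr0 // => z zK;
    by apply: f0; rewrite leq_max zK ?orbT.
- by rewrite (sder_sg dE) (sder_sg dF) sgD scalerDr.
Qed.

Lemma sder_scale e E r : sder e E -> sder e (fun f => r *: E f).
Proof.
move=> dE; split=> [q f g|f g|k|b f].
- by rewrite (sder_lin dE) scalerDr !scalerA mulrC.
- by rewrite (sder_leib dE) scalerDr scalerAl scalerAr.
- have [K EK] := sder_cont dE k; exists K => f f0 m mk.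
  by rewrite ahatZE EK ?scaler0.
- by rewrite (sder_sg dE) sgZ !scalerA mulrC.
Qed.

Lemma sder_zero e : sder e (fun=> 0).
Proof.
split=> [r f g|f g|k|b f]; rewrite ?scaler0 ?addr0 ?mul0r ?mulr0 ?addr0 //.
  by exists 0%N.
by rewrite sg0 scaler0.
Qed.

Lemma sder_sub e E F : sder e E -> sder e F -> sder e (fun f => E f - F f).
Proof.
move=> dE dF; have := sder_add dE (sder_scale (-1) dF).
by under eq_fun do rewrite scaleN1r.
Qed.

Lemma sder_sum e n (E : nat -> A -> A) : (forall s, sder e (E s)) ->
  sder e (fun f => \sum_(s < n) E s f).
Proof.
move=> dE; elim: n => [|n IH].
  by under eq_fun do rewrite big_ord0; exact: sder_zero.
by under eq_fun do rewrite big_ord_recr; exact: sder_add.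
Qed.

(** The partial sums that define a derivation stabilise in each degree,
    uniformly in the argument; this is what the conclusion needs. *)
Lemma sder_lim e E (F : nat -> A -> A) : (forall n, sder e (F n)) ->
  (forall k, exists n, forall f, eqto k (E f) (F n f)) -> sder e E.
Proof.
move=> dF EF; split=> [r f g|f g|k|b f].
- apply/funext => m; have [n En] := EF (stddeg m).
  by rewrite En // (sder_lin (dF n)) !ahatDE !ahatZE !En.
- apply/funext => m; have [n En] := EF (stddeg m).
  rewrite En // (sder_leib (dF n)) !ahatDE; congr (_ + _).
    by rewrite (mul_eqto (En f) (fun _ _ => erefl)).
  by rewrite (mul_eqto (fun _ _ => erefl) (En g)).
- have [n En] := EF k; have [K FK] := sder_cont (dF n) k; exists K => f f0 m mk.
  by rewrite En // FK.
- apply/funext => m; have [n En] := EF (stddeg m).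
  by rewrite En // (sder_sg (dF n)) !ahatZE !sgE En.
Qed.

Lemma par0 b : par b (0 : A).
Proof. by []. Qed.

Lemma parD b f g : par b f -> par b g -> par b (f + g).
Proof. by move=> bf bg m mb; rewrite ahatDE bf // bg // addr0. Qed.

Lemma parZ b r f : par b f -> par b (r *: f).
Proof. by move=> bf m mb; rewrite ahatZE bf // scaler0. Qed.

Lemma parM b e f g : par b f -> par e g -> par (b (+) e) (f * g).
Proof.
move=> bf eg m mb; rewrite -amulE amul_sum big_seq big1 // => x.
rewrite mem_mdivisors => xm; have [xb|/bf->] := eqVneq (odd (superdeg x)) b; last first.
  by rewrite mul0r mulr0.
rewrite eg ?mulr0 //; apply: contra_neq mb => <-.
by rewrite -xb !superdegE (wt_div _ _ xm) oddD.
Qed.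

Lemma eqtoM0 k f g : eqto k g 0 -> eqto k (f * g) 0.
Proof.
by move=> g0 m mk; rewrite (mul_eqto (fun _ _ => erefl) g0) // mulr0.
Qed.

Lemma sder_mull b e E f : par b f -> sder e E -> sder (b (+) e) (fun g => f * E g).
Proof.
move=> bf dE; split=> [r g h|g h|k|d g].
- by rewrite (sder_lin dE) mulrDr scalerAr.
- rewrite (sder_leib dE) mulrDr !mulrA -[f * sg e g]amulE (amulC _ bf) sgg.
  by rewrite amulE.
- have [K EK] := sder_cont dE k; exists K => g g0; exact/eqtoM0/EK.
- rewrite (sder_sg dE) sgMr (sg_par _ bf) -scalerAl -!scalerAr !scalerA.
  congr (_ *: _); rewrite -exprD; apply: signr_parity.
  by rewrite oddD !oddM !oddb; case: d b e {bf dE} => [] [] [].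
Qed.

Lemma sder_comm b e E F : sder b E -> sder e F ->
  sder (b (+) e) (fun f => E (F f) - (-1) ^+ (b * e) *: F (E f)).
Proof.
move=> dE dF; have EZ := linZ (sder_lin dE); have FZ := linZ (sder_lin dF).
split=> [r f g|f g|k|d f].
- rewrite (sder_lin dF) (sder_lin dE) (sder_lin dE) (sder_lin dF).
  by rewrite scalerBr !scalerDr opprD addrACA !scalerA mulrC.
- rewrite (sder_leib dF) (sder_leib dE) (linD (sder_lin dE)) (linD (sder_lin dF)).
  rewrite !(sder_leib dE) !(sder_leib dF) !sgg (sder_sg dE) (sder_sg dF).
  rewrite mulrBl mulrBr !scalerDr -!scalerAl -!scalerAr.
  rewrite [e (+) b]addbC [(e * b)%N]mulnC signZK; zmodule.
- have [K EK] := sder_cont dE k; have [K' FK] := sder_cont dF k.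
  have [L EL] := sder_cont dE K'; have [L' FL] := sder_cont dF K.
  exists (maxn L L') => f f0 m mk; rewrite ahatBE ahatZE.
  rewrite EK ?FK ?scaler0 ?subrr //; [apply: EL|apply: FL] => z zK;
    by apply: f0; rewrite leq_max zK ?orbT.
- rewrite (sder_sg dF) EZ (sder_sg dE) (sder_sg dE) FZ (sder_sg dF) sgB sgZ.
  rewrite scalerBr !scalerA -!exprD; apply: congrB; congr (_ *: _);
    by apply: signr_parity; case: d b e {dE dF} => [] [] [].
Qed.

End SderClosure.

End Derivations.

Section Der.
Variable R : realType.
Local Notation A := (Ahat R).
Implicit Types (f g h : A) (a c : Cinf R) (x y z m : monomial) (r : R).
Implicit Types (b e : bool) (s t k n : nat) (X Y : nat -> A).

Lemma eqto_trans k f g h : eqto k f g -> eqto k g h -> eqto k f h.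
Proof. by move=> fg gh m mk; rewrite fg ?gh. Qed.

Lemma eqtoD k f f' g g' : eqto k f f' -> eqto k g g' -> eqto k (f + g) (f' + g').
Proof. by move=> ff gg m mk; rewrite !ahatDE ff ?gg. Qed.

Lemma eqtoB k f f' g g' : eqto k f f' -> eqto k g g' -> eqto k (f - g) (f' - g').
Proof. by move=> ff gg m mk; rewrite !ahatBE ff ?gg. Qed.

Lemma eqtoP f g : (forall k, eqto k f g) -> f = g.
Proof. by move=> fg; apply/funext => m; apply: (fg (stddeg m)). Qed.

Lemma std_geP k f : std_ge k.+1 f <-> eqto k f 0.
Proof. by split => f0 m mk; apply: f0. Qed.

Lemma std_ge0 f : std_ge 0 f.
Proof. by []. Qed.

Lemma std_geW k n f : (n <= k)%N -> std_ge k f -> std_ge n f.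
Proof. by move=> nk fk m mn; apply: fk; apply: leq_trans nk. Qed.

Lemma std_geD k f g : std_ge k f -> std_ge k g -> std_ge k (f + g).
Proof. by move=> fk gk m mk; rewrite ahatDE fk ?gk ?addr0. Qed.

Lemma std_geZ k r f : std_ge k f -> std_ge k (r *: f).
Proof. by move=> fk m mk; rewrite ahatZE fk ?scaler0. Qed.

Lemma std_ge_0 k : std_ge k (0 : A).
Proof. by []. Qed.

Lemma std_geM k n f g : std_ge k f -> std_ge n g -> std_ge (k + n) (f * g).
Proof.
move=> fk gn m mkn; rewrite -amulE amul_sum big_seq big1 // => x.
rewrite mem_mdivisors => xm; have := wt_div succn id xm; rewrite -!stddegE => mE.
have [xk|kx] := ltnP (stddeg x) k; first by rewrite fk // mul0r mulr0.
rewrite gn ?mulr0 //; move: mkn; rewrite mE => mkn.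
by rewrite -(ltn_add2l k) (leq_ltn_trans _ mkn) // leq_add2r.
Qed.

Lemma std_ge_uvar s : std_ge s (uv R s).
Proof.
rewrite -uvE; case: s => [//|s] m ms; rewrite /uvar amonomE; case: eqVneq ms => // ->.
by rewrite stddegE /wt /= big_msetn big_seq_fset0 /= addn0 ltnn.
Qed.

Lemma std_ge_thvar s : std_ge s (tv R s).
Proof.
rewrite -tvE => m ms; rewrite /thvar amonomE; case: eqVneq ms => // ->.
by rewrite stddegE /wt /= big_mset0 big_seq_fset1 add0n ltnn.
Qed.

(** * Locally finite sums *)

Implicit Types (F G : nat -> A).

(** Under this condition [asum] is the limit of the partial sums. *)
Definition summable (F : nat -> A) := forall s, std_ge s (F s).

Lemma asumE F k n : summable F -> (k < n)%N -> eqto k (asum F) (\sum_(s < n) F s).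
Proof.
move=> sF kn m mk; rewrite ahat_sumE /asum.
have mn : ((stddeg m).+1 <= n)%N by rewrite (leq_ltn_trans mk).
rewrite (big_ord_widen _ (fun s => F s m) mn) big_mkcond /=.
apply: eq_bigr => s _; case: ltnP => // ms; rewrite sF //.
Qed.

Lemma asum1 F t : summable F -> (forall s, s != t -> F s = 0) -> asum F = F t.
Proof.
move=> sF F0; apply: eqtoP => k.
apply: (eqto_trans (@asumE F k (maxn k t).+1 sF _)); first by rewrite ltnS leq_maxl.
have tn : (t < (maxn k t).+1)%N by rewrite ltnS leq_maxr.
rewrite (bigD1 (Ordinal tn)) //= big1 ?addr0 // => s st; apply: F0.
by apply: contra st => /eqP st; apply/eqP/val_inj.
Qed.

Lemma asum_fin F n : summable F -> (forall s, (n <= s)%N -> F s = 0) ->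
  asum F = \sum_(s < n) F s.
Proof.
move=> sF F0; apply: eqtoP => k.
move=> m mk; rewrite (@asumE F k (maxn k.+1 n) sF) ?leq_maxl // !ahat_sumE.
rewrite [RHS](big_ord_widen (maxn k.+1 n) (fun s => F s m)) ?leq_maxr //.
by rewrite [RHS]big_mkcond; apply: eq_bigr => s _; case: ltnP => // /F0 ->.
Qed.

Lemma eq_asum F G : F =1 G -> asum F = asum G.
Proof. by move=> FG; congr asum; apply/funext. Qed.

Lemma asumD F G : asum (fun s => F s + G s) = asum F + asum G.
Proof. by apply/funext => m; rewrite ahatDE -big_split. Qed.

Lemma asumZ r F : asum (fun s => r *: F s) = r *: asum F.
Proof. by apply/funext => m; rewrite ahatZE scaler_sumr. Qed.

(** * Derivations along variables *)

Lemma d_u_lin s r f g : du s (r *: f + g) = r *: du s f + du s g.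
Proof.
apply/funext => m; rewrite ahatDE ahatZE; case: s => [|s].
  by rewrite !d_u0E ahatDE CderivD ahatZE CderivZ.
by rewrite !d_uE ahatDE ahatZE mulrnDl scalerMnr.
Qed.

Lemma d_th_lin s r f g : dt s (r *: f + g) = r *: dt s f + dt s g.
Proof.
apply/funext => m; rewrite ahatDE ahatZE !d_thE.
by case: ifP => _; rewrite ?scaler0 ?addr0 // ahatDE ahatZE mulrDr -!signZ !scalerA mulrC.
Qed.

Lemma stddeg_u s m : stddeg ((s +` m.1)%mset, m.2) = (s.+1 + stddeg m)%N.
Proof.
rewrite !stddegE /wt /= (perm_big _ (perm_msetD _ _)) big_cat /= enum_msetn.
by rewrite big_seq1 addnA.
Qed.

Lemma stddeg_th s m : s \notin m.2 ->
  stddeg (m.1, (s |` m.2)%fset) = (s + stddeg m)%N.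
Proof. by move=> sm; rewrite !stddegE /wt /= big_fsetU1 //= addnCA. Qed.

Lemma superdeg_th s m : s \notin m.2 ->
  superdeg (m.1, (s |` m.2)%fset) = (superdeg m).+1.
Proof. by move=> sm; rewrite !superdegE /wt /= big_fsetU1 //= addnCA add1n. Qed.

Lemma superdeg_u s m : superdeg ((s +` m.1)%mset, m.2) = superdeg m.
Proof. by []. Qed.

Lemma d_u_eqto s k f g : eqto (k + s) f g -> eqto k (du s f) (du s g).
Proof.
move=> fg m mk; case: s fg => [|s] fg; first by rewrite !d_u0E fg ?addn0.
by rewrite !d_uE fg // stddeg_u addnC leq_add2r.
Qed.

Lemma d_th_eqto s k f g : eqto (k + s) f g -> eqto k (dt s f) (dt s g).
Proof.
move=> fg m mk; rewrite !d_thE; case: ifPn => // sm.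
by rewrite fg // stddeg_th // addnC leq_add2r.
Qed.

Lemma d_u1 s : du s 1 = 0 :> A.
Proof.
apply/funext => m; rewrite -coef1 -cfE /coef_fun; case: s => [|s].
  by rewrite d_u0E amonomE; case: ifP; rewrite ?Cderiv1 ?Cderiv0.
rewrite d_uE amonomE; case: eqP => [|_]; last by rewrite mul0rn.
by move=> /(congr1 stddeg); rewrite stddeg_u [RHS]stddegE wt_mon1.
Qed.

Lemma d_th1 s : dt s 1 = 0 :> A.
Proof.
apply/funext => m; rewrite -coef1 d_thE; case: ifPn => // sm.
rewrite -cfE /coef_fun amonomE; case: eqP => [|_]; last by rewrite mulr0.
by move=> /(congr1 superdeg); rewrite superdeg_th // superdegE wt_mon1.
Qed.

Lemma d_u0_coef a : du 0 (cf a) = cf (Cderiv a).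
Proof. by rewrite -[cf a]mulr1 d_u0_coefM d_u1 mulr1 mulr0 addr0. Qed.

Lemma d_uS_coef s a : du s.+1 (cf a) = 0.
Proof. by rewrite -[cf a]mulr1 d_uS_coefM d_u1 mulr0. Qed.

Lemma uv0 : uv R 0 = cf (Cid R).
Proof. by rewrite -uvE -cfE. Qed.

Lemma d_u_uvar s t : du s (uv R t) = (s == t)%:R.
Proof.
case: t s => [|t] [|s].
- by rewrite uv0 d_u0_coef Cderiv_id coef1 eqxx mulr1n.
- by rewrite uv0 d_uS_coef.
- by rewrite -[uv R _]mulr1 d_u0_uvarM d_u1 mulr0.
- by rewrite -[uv R _]mulr1 d_uS_uvarM d_u1 mulr0 addr0 eqSS scaler_nat.
Qed.

Lemma d_u_thvar s t : du s (tv R t) = 0.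
Proof. by rewrite -[tv R _]mulr1 d_u_thvarM d_u1 mulr0. Qed.

Lemma d_th_coef s a : dt s (cf a) = 0.
Proof. by rewrite -[cf a]mulr1 d_th_coefM d_th1 mulr0. Qed.

Lemma d_th_uvar s t : dt s (uv R t) = 0.
Proof.
case: t => [|t]; first by rewrite uv0 d_th_coef.
by rewrite -[uv R _]mulr1 d_th_uvarM d_th1 mulr0.
Qed.

Lemma d_th_thvar s t : dt s (tv R t) = (s == t)%:R.
Proof.
by rewrite -[tv R _]mulr1 d_th_thvarM d_th1 mulr0 subr0 scaler_nat.
Qed.

Lemma sg_uvar e s : sg e (uv R s) = uv R s.
Proof. by rewrite (sg_par _ (@par_uvar R s)) muln0 scale1r. Qed.

Lemma sg_coef e a : sg e (cf a) = cf a.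
Proof. by rewrite (sg_par _ (@par_cf R a)) muln0 scale1r. Qed.

Lemma sg_thvar e s : sg e (tv R s) = (-1) ^+ e *: tv R s.
Proof. by rewrite (sg_par _ (@par_thvar R s)) muln1. Qed.

Lemma sder_d_u s : sder false (@du R s).
Proof.
apply: sder_mk => [r f g|k|b f|a g|t g|t g].
- exact: d_u_lin.
- exists (k + s)%N => f f0; have := d_u_eqto f0.
  by rewrite (lin0 (d_u_lin s)).
- rewrite muln0 scale1r; apply/funext => m; rewrite sgE; case: s => [|s].
    by rewrite !d_u0E sgE CderivZ.
  by rewrite !d_uE sgE superdeg_u scalerMnr.
- case: s => [|s]; first by rewrite d_u0_coefM d_u0_coef.
  by rewrite d_uS_coefM d_uS_coef mul0r add0r.
- case: s => [|s]; rewrite d_u_uvar; first by rewrite d_u0_uvarM mul0r add0r.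
  by rewrite d_uS_uvarM eqSS scaler_nat mulr_natl.
- by rewrite d_u_thvarM d_u_thvar mul0r add0r sgF.
Qed.

Lemma sder_d_th s : sder true (@dt R s).
Proof.
apply: sder_mk => [r f g|k|b f|a g|t g|t g].
- exact: d_th_lin.
- exists (k + s)%N => f f0; have := d_th_eqto f0.
  by rewrite (lin0 (d_th_lin s)).
- apply/funext => m; rewrite ahatZE sgE !d_thE; case: ifPn => [|sm].
    by rewrite !scaler0.
  rewrite sgE superdeg_th // -!signZ !scalerA -!exprD; congr (_ *: _).
  by congr (_ ^+ _); case: b; rewrite /= ?mul1n ?mul0n addnC ?add1n.
- by rewrite d_th_coefM d_th_coef mul0r add0r.
- by rewrite d_th_uvarM d_th_uvar mul0r add0r.
- by rewrite d_th_thvarM d_th_thvar sg_thvar scaler_nat mulr_natl scaleN1r mulNr.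
Qed.

(** * Derivations given by their values on the variables *)

Definition der X Y f : A := asum (fun s => X s * du s f + Y s * dt s f).

Section DerTheory.
Variables (X Y : nat -> A).
Hypotheses (sX : summable X) (sY : summable Y).

Lemma summableMl F G : summable F -> summable (fun s => F s * G s).
Proof. by move=> sF s; have := std_geM (sF s) (@std_ge0 (G s)); rewrite addn0. Qed.

Lemma der_summable f : summable (fun s => X s * du s f + Y s * dt s f).
Proof.
by move=> s; apply: std_geD; [exact: (summableMl (fun s => du s f) sX)|
  exact: (summableMl (fun s => dt s f) sY)].
Qed.

Lemma derE f k n : (k < n)%N ->
  eqto k (der X Y f) (\sum_(s < n) (X s * du s f + Y s * dt s f)).
Proof. exact/asumE/der_summable. Qed.

Lemma sder_der e : (forall s, par e (X s)) -> (forall s, par (~~ e) (Y s)) ->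
  sder e (der X Y).
Proof.
move=> pX pY; pose F n f : A := \sum_(s < n) (X s * du s f + Y s * dt s f).
apply: (@sder_lim _ e _ F) => [n|k]; last by exists k.+1 => f; exact: derE.
apply: (@sder_sum _ e n (fun s f => X s * du s f + Y s * dt s f)) => s.
apply: sder_add; first by rewrite -[e]addbF; exact/sder_mull/sder_d_u.
by rewrite -[e]negbK -addbT; exact/sder_mull/sder_d_th.
Qed.

Lemma der_coef a : der X Y (cf a) = X 0%N * cf (Cderiv a).
Proof.
rewrite /der (asum1 (t := 0%N)) ?d_u0_coef ?d_th_coef ?mulr0 ?addr0 //.
  exact: der_summable.
by case=> // s _; rewrite d_uS_coef d_th_coef !mulr0 addr0.
Qed.

Lemma der_uvar t : der X Y (uv R t) = X t.
Proof.
rewrite /der (asum1 (t := t)) ?d_u_uvar ?d_th_uvar ?eqxx ?mulr0 ?addr0 ?mulr1 //.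
  exact: der_summable.
by move=> s /negPf st; rewrite d_u_uvar d_th_uvar st !mulr0 addr0.
Qed.

Lemma der_thvar t : der X Y (tv R t) = Y t.
Proof.
rewrite /der (asum1 (t := t)) ?d_u_thvar ?d_th_thvar ?eqxx ?mulr0 ?add0r ?mulr1 //.
  exact: der_summable.
by move=> s /negPf st; rewrite d_u_thvar d_th_thvar st !mulr0 addr0.
Qed.

End DerTheory.

(** * The total derivative *)

Lemma DxderE : @Dx R = der (fun s => uv R s.+1) (fun s => tv R s.+1).
Proof.
by rewrite -DxE; apply/funext => f; apply: eq_asum => s; rewrite uvE tvE duE dtE !amulE.
Qed.

Lemma summable_uvarS : summable (fun s => uv R s.+1).
Proof. by move=> s; apply: (std_geW (leqnSn s)); exact: std_ge_uvar. Qed.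

Lemma summable_thvarS : summable (fun s => tv R s.+1).
Proof. by move=> s; apply: (std_geW (leqnSn s)); exact: std_ge_thvar. Qed.

Lemma sder_dx : sder false (@Dx R).
Proof.
rewrite DxderE; apply: sder_der; first exact: summable_uvarS.
- exact: summable_thvarS.
- by move=> s; exact: par_uvar.
- by move=> s; exact: par_thvar.
Qed.

Lemma dx_coef a : Dx (cf a) = uv R 1 * cf (Cderiv a).
Proof. by rewrite DxderE der_coef; [|exact: summable_uvarS|exact: summable_thvarS]. Qed.

Lemma dx_uvar s : Dx (uv R s) = uv R s.+1.
Proof. by rewrite DxderE der_uvar; [|exact: summable_uvarS|exact: summable_thvarS]. Qed.

Lemma dx_thvar s : Dx (tv R s) = tv R s.+1.
Proof. by rewrite DxderE der_thvar; [|exact: summable_uvarS|exact: summable_thvarS]. Qed.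

Definition dx_lin := sder_lin sder_dx.
Definition dx0 := lin0 dx_lin.
Definition dxD := linD dx_lin.
Definition dxZ := linZ dx_lin.
Definition dxN := linN dx_lin.
Definition dx_sum := lin_sum dx_lin.

Lemma dxM f g : Dx (f * g) = Dx f * g + f * Dx g.
Proof. by rewrite (sder_leib sder_dx) sgF. Qed.

End Der.

Section Gradations.
Variable R : realType.
Local Notation A := (Ahat R).
Implicit Types (f g h : A) (a : Cinf R) (x y z m : monomial) (r : R).
Implicit Types (d e : bool) (s t k n i : nat) (X Y F : nat -> A).
Implicit Types (w : monomial -> nat).

Lemma cf0 : cf 0 = 0 :> A.
Proof. by rewrite -[0 in LHS](scale0r 0) coef_funZ scale0r. Qed.

(** * Commutation with the total derivative *)

Lemma dx1 : Dx 1 = 0 :> A.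
Proof. by rewrite -coef1 dx_coef Cderiv1 cf0 mulr0. Qed.

Lemma dx_nat n : Dx n%:R = 0 :> A.
Proof. by rewrite -scaler_nat dxZ dx1 scaler0. Qed.

Lemma sder_comm_dx e (E : A -> A) : sder e E -> sder e (fun f => E (Dx f) - Dx (E f)).
Proof.
move=> dE; have := sder_comm dE (sder_dx R); rewrite addbF muln0.
by under eq_fun do rewrite scale1r.
Qed.

Lemma d_u0_dx f : du 0 (Dx f) = Dx (du 0 f).
Proof.
apply/eqP; rewrite -subr_eq0; apply/eqP; move: f.
apply: (sder_ext (sder_comm_dx (sder_d_u R 0)) (sder_zero R false)) => [a|s|s].
- rewrite dx_coef d_u0_coef dx_coef (sder_leib (sder_d_u R 0)) d_u_uvar mul0r.
  by rewrite add0r sg_uvar d_u0_coef subrr.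
- by rewrite dx_uvar !d_u_uvar dx0 subrr.
- by rewrite dx_thvar !d_u_thvar dx0 subrr.
Qed.

Lemma d_u_dx s f : du s.+1 (Dx f) = Dx (du s.+1 f) + du s f.
Proof.
apply/eqP; rewrite addrC -subr_eq; apply/eqP; move: f.
apply: (sder_ext (sder_comm_dx (sder_d_u R s.+1)) (sder_d_u R s)) => [a|t|t].
- rewrite dx_coef d_uS_coef dx0 subr0 (sder_leib (sder_d_u R s.+1)) d_u_uvar.
  rewrite d_uS_coef mulr0 addr0; case: s => [|s]; first by rewrite mul1r d_u0_coef.
  by rewrite mul0r d_uS_coef.
- by rewrite dx_uvar !d_u_uvar dx_nat subr0 eqSS.
- by rewrite dx_thvar !d_u_thvar dx0 subrr.
Qed.

Lemma d_th0_dx f : dt 0 (Dx f) = Dx (dt 0 f).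
Proof.
apply/eqP; rewrite -subr_eq0; apply/eqP; move: f.
apply: (sder_ext (sder_comm_dx (sder_d_th R 0)) (sder_zero R true)) => [a|s|s].
- rewrite dx_coef d_th_coef dx0 subr0 (sder_leib (sder_d_th R 0)) d_th_uvar mul0r.
  by rewrite add0r sg_uvar d_th_coef mulr0.
- by rewrite dx_uvar !d_th_uvar dx0 subrr.
- by rewrite dx_thvar !d_th_thvar dx_nat subrr.
Qed.

Lemma d_th_dx s f : dt s.+1 (Dx f) = Dx (dt s.+1 f) + dt s f.
Proof.
apply/eqP; rewrite addrC -subr_eq; apply/eqP; move: f.
apply: (sder_ext (sder_comm_dx (sder_d_th R s.+1)) (sder_d_th R s)) => [a|t|t].
- rewrite dx_coef !d_th_coef dx0 subr0 (sder_leib (sder_d_th R s.+1)) d_th_uvar.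
  by rewrite d_th_coef mulr0 mul0r addr0.
- by rewrite dx_uvar !d_th_uvar dx0 subrr.
- by rewrite dx_thvar !d_th_thvar dx_nat subr0 eqSS.
Qed.

(** * Homogeneous components *)

Definition homog w k f := forall m, w m <> k -> f m = 0.
Definition comp w k f : A := fun m => if w m == k then f m else 0.

Lemma homog0 w k : homog w k (0 : A).
Proof. by []. Qed.

Lemma homogD w k f g : homog w k f -> homog w k g -> homog w k (f + g).
Proof. by move=> fk gk m mk; rewrite ahatDE fk ?gk ?addr0. Qed.

Lemma homogZ w k r f : homog w k f -> homog w k (r *: f).
Proof. by move=> fk m mk; rewrite ahatZE fk ?scaler0. Qed.

Lemma homogN w k f : homog w k f -> homog w k (- f).
Proof. by rewrite -scaleN1r; exact: homogZ. Qed.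

Lemma homogB w k f g : homog w k f -> homog w k g -> homog w k (f - g).
Proof. by move=> fk gk; apply: homogD => //; exact: homogN. Qed.

Lemma homog_sum w k n F : (forall s, (s < n)%N -> homog w k (F s)) ->
  homog w k (\sum_(s < n) F s).
Proof. by move=> Fk m mk; rewrite ahat_sumE big1 // => s _; rewrite Fk. Qed.

Lemma homog_asum w k F : (forall s, homog w k (F s)) -> homog w k (asum F).
Proof. by move=> Fk m mk; apply: big1 => s _; exact: Fk. Qed.

Lemma homog_comp w k f : homog w k (comp w k f).
Proof. by move=> m /eqP /negPf mk; rewrite /comp mk. Qed.

Lemma comp_id w k f : homog w k f -> comp w k f = f.
Proof. by move=> fk; apply/funext => m; rewrite /comp; case: eqP => // /fk. Qed.

Lemma comp_lin w k r f g : comp w k (r *: f + g) = r *: comp w k f + comp w k g.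
Proof.
by apply/funext => m; rewrite ahatDE ahatZE /comp; case: ifP; rewrite ?scaler0 ?addr0.
Qed.

Lemma comp_homog_neq w k i f : homog w i f -> i <> k -> comp w k f = 0.
Proof.
by move=> fi ik; apply/funext => m; rewrite /comp; case: eqP => // mk; rewrite fi ?mk //; exact/nesym.
Qed.

Lemma comp_eqto w k i f g : eqto i f g -> eqto i (comp w k f) (comp w k g).
Proof. by move=> fg m mi; rewrite /comp fg. Qed.

Lemma comp_inj w f g : (forall k, comp w k f = comp w k g) -> f = g.
Proof.
move=> fg; apply/funext => m; have := congr1 (fun f : A => f m) (fg (w m)).
by rewrite /comp eqxx.
Qed.

Lemma homog_amonom w a x : homog w (w x) (amonom a x).
Proof. by move=> m mx; rewrite amonomE; case: eqP => // mE; rewrite mE in mx. Qed.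

Lemma comp_amonom w k a x :
  comp w k (amonom a x) = if w x == k then amonom a x else 0.
Proof.
case: eqP => [<-|xk]; first exact/comp_id/homog_amonom.
by apply: (comp_homog_neq _ xk); exact: homog_amonom.
Qed.

Section CompOp.
Variables (E : A -> A) (w : monomial -> nat).
Hypothesis Elin : forall r f g, E (r *: f + g) = r *: E f + E g.
Hypothesis Econt : forall k, exists K, forall f, eqto K f 0 -> eqto k (E f) 0.

(** An operator that is continuous acts on components as it does on
    homogeneous monomials, whose span is dense. *)
Lemma comp_op k i : (forall f, homog w k f -> homog w i (E f)) ->
  (forall j f, j <> k -> homog w j f -> comp w i (E f) = 0) ->
  forall f, comp w i (E f) = E (comp w k f).
Proof.
move=> Ek Ej f; apply/eqP; rewrite -subr_eq0; apply/eqP; move: f.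
have c0 j : comp w j (0 : A) = 0 by rewrite (lin0 (comp_lin w j)).
apply: (amonom_eq0 (E := fun f => comp w i (E f) - E (comp w k f))).
- by move=> r f g; rewrite Elin !comp_lin Elin scalerBr opprD addrACA.
- move=> n; have [K EK] := Econt n; exists K => f f0.
  have: eqto n (comp w i (E f) - E (comp w k f)) (0 - 0); last by rewrite subr0.
  apply: eqtoB; first by rewrite -(c0 i); apply/comp_eqto/EK.
  by apply: EK; rewrite -(c0 k); exact: comp_eqto.
- move=> a x; rewrite comp_amonom; case: eqP => [xk|xk].
    rewrite comp_id ?subrr //; apply: Ek; rewrite -xk; exact: homog_amonom.
  by rewrite (Ej _ _ xk) ?(lin0 Elin) ?subrr //; exact: homog_amonom.
Qed.

Lemma comp_shift c : (forall k f, homog w k f -> homog w (k + c) (E f)) ->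
  forall k f, comp w (k + c) (E f) = E (comp w k f).
Proof.
move=> Ec k; apply: comp_op; first exact: Ec.
move=> j f jk /Ec fj; apply: (comp_homog_neq fj).
by move/eqP; rewrite eqn_add2r => /eqP.
Qed.

Lemma comp_shift_lt c : (forall k f, homog w k f -> homog w (k + c) (E f)) ->
  forall i f, (i < c)%N -> comp w i (E f) = 0.
Proof.
move=> Ec i f ic; have c0 j : comp w j (0 : A) = 0 by rewrite (lin0 (comp_lin w j)).
move: f; apply: (amonom_eq0 (E := fun f => comp w i (E f))).
- by move=> r f g; rewrite Elin comp_lin.
- move=> n; have [K EK] := Econt n; exists K => f f0.
  by rewrite -(c0 i); apply/comp_eqto/EK.
- move=> a x; apply: (comp_homog_neq (Ec (w x) _ _)); first exact: homog_amonom.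
  by move=> xi; move: ic; rewrite -xi ltnNge leq_addl.
Qed.

End CompOp.

Section Weight.
Variables p q : nat -> nat.
Let w := wt p q.
Let wu s := if s is s'.+1 then p s' else 0%N.

Lemma homogM k n f g : homog w k f -> homog w n g -> homog w (k + n) (f * g).
Proof.
move=> fk gn m mkn; rewrite -amulE amul_sum big_seq big1 // => x.
rewrite mem_mdivisors => xm; have := wt_div p q xm; rewrite -/w => mE.
have [xk|/eqP/fk->] := eqVneq (w x) k; last by rewrite mul0r mulr0.
by rewrite gn ?mulr0 // => yn; apply: mkn; rewrite mE xk yn.
Qed.

Lemma wt_u s m : w ((s +` m.1)%mset, m.2) = (p s + w m)%N.
Proof.
rewrite /w /wt /= (perm_big _ (perm_msetD _ _)) big_cat /= enum_msetn.
by rewrite big_seq1 addnA.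
Qed.

Lemma wt_th s m : s \notin m.2 -> w (m.1, (s |` m.2)%fset) = (q s + w m)%N.
Proof. by move=> sm; rewrite /w /wt /= big_fsetU1 //= addnCA. Qed.

Lemma homog_d_u s k f : homog w (wu s + k) f -> homog w k (du s f).
Proof.
case: s => [|s] fk m mk; first by rewrite d_u0E fk ?Cderiv0.
by rewrite d_uE fk ?mul0rn // wt_u => /eqP; rewrite eqn_add2l => /eqP.
Qed.

Lemma homog_d_u_lt s k f : (k < wu s)%N -> homog w k f -> du s f = 0.
Proof.
case: s => [//|s] ks fk; apply/funext => m; rewrite d_uE fk ?mul0rn // wt_u => mk.
by move: ks; rewrite -mk /= ltnNge leq_addr.
Qed.

Lemma homog_d_th s k f : homog w (q s + k) f -> homog w k (dt s f).
Proof.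
move=> fk m mk; rewrite d_thE; case: ifPn => // sm.
by rewrite fk ?mulr0 // wt_th // => /eqP; rewrite eqn_add2l => /eqP.
Qed.

Lemma homog_d_th_lt s k f : (k < q s)%N -> homog w k f -> dt s f = 0.
Proof.
move=> ks fk; apply/funext => m; rewrite d_thE; case: ifPn => // sm.
rewrite fk ?mulr0 // wt_th // => mk.
by move: ks; rewrite -mk /= ltnNge leq_addr.
Qed.

Lemma homog_der X Y c k f :
  (forall s, homog w (wu s + c) (X s)) -> (forall s, homog w (q s + c) (Y s)) ->
  homog w k f -> homog w (k + c) (der X Y f).
Proof.
move=> Xc Yc fk; apply: homog_asum => s; apply: homogD.
- have [ks|sk] := ltnP k (wu s).
    by rewrite (homog_d_u_lt ks fk) mulr0; exact: homog0.
  have -> : (k + c = wu s + c + (k - wu s))%N by rewrite addnAC subnKC.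
  by apply: homogM => //; apply: homog_d_u; rewrite subnKC.
- have [ks|sk] := ltnP k (q s).
    by rewrite (homog_d_th_lt ks fk) mulr0; exact: homog0.
  have -> : (k + c = q s + c + (k - q s))%N by rewrite addnAC subnKC.
  by apply: homogM => //; apply: homog_d_th; rewrite subnKC.
Qed.

Lemma homog_uvar s : homog w (wu s) (uv R s).
Proof.
rewrite -uvE; case: s => [|s] m mw; rewrite /uvar /coef_fun amonomE; case: eqP => // mE; case: mw;
  rewrite mE /=; first by rewrite /w wt_mon1.
by rewrite /w /wt /= big_msetn big_seq_fset0 /= addn0.
Qed.

Lemma homog_coef a : homog w 0 (cf a).
Proof.
by rewrite -cfE => m mw; rewrite /coef_fun amonomE; case: eqP => // mE; case: mw; rewrite mE /w wt_mon1.
Qed.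

Lemma homog_thvar s : homog w (q s) (tv R s).
Proof.
rewrite -tvE => m mw; rewrite /thvar amonomE; case: eqP => // mE; case: mw.
by rewrite mE /w /wt /= big_mset0 big_seq_fset1 add0n.
Qed.

End Weight.

End Gradations.

Section Integration.
Variable R : realType.
Local Notation A := (Ahat R).
Implicit Types (f g h : A) (a : Cinf R) (x y z m : monomial) (r : R).
Implicit Types (d e : bool) (s t k n i : nat) (X Y F : nat -> A).
Implicit Types (w : monomial -> nat).

(** * Degrees of the total derivative *)

Lemma superdegF : superdeg = wt (fun=> 0%N) (fun=> 1%N).
Proof. exact/funext/superdegE. Qed.

Lemma Dx_std k f : homog stddeg k f -> homog stddeg k.+1 (Dx f).
Proof.
rewrite DxderE -addn1; apply: (@homog_der R succn id) => s.
  have := @homog_uvar R succn id s.+1; by case: s => [|s]; rewrite addn1.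
by have := @homog_thvar R succn id s.+1; rewrite addn1.
Qed.

Lemma Dx_super k f : homog superdeg k f -> homog superdeg k (Dx f).
Proof.
rewrite DxderE -[X in homog _ X (der _ _ _)]addn0 superdegF.
apply: (@homog_der R (fun=> 0%N) (fun=> 1%N)) => s.
  by have := @homog_uvar R (fun=> 0%N) (fun=> 1%N) s.+1; case: s.
exact: (@homog_thvar R (fun=> 0%N) (fun=> 1%N) s.+1).
Qed.

Lemma comp_stdS_Dx k f : comp stddeg k.+1 (Dx f) = Dx (comp stddeg k f).
Proof.
rewrite -addn1; apply: (comp_shift (sder_lin (sder_dx R)) (sder_cont (sder_dx R))).
by move=> i g; rewrite addn1; exact: Dx_std.
Qed.

Lemma comp_std0_Dx f : comp stddeg 0 (Dx f) = 0.
Proof.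
apply: (comp_shift_lt (sder_lin (sder_dx R)) (sder_cont (sder_dx R)) (c := 1%N)) => //.
by move=> i g; rewrite addn1; exact: Dx_std.
Qed.

Lemma comp_super_Dx k f : comp superdeg k (Dx f) = Dx (comp superdeg k f).
Proof.
rewrite -[k in LHS]addn0.
apply: (comp_shift (sder_lin (sder_dx R)) (sder_cont (sder_dx R))).
by move=> i g; rewrite addn0; exact: Dx_super.
Qed.

Lemma std_geE k f : std_ge k f <-> forall i, (i < k)%N -> comp stddeg i f = 0.
Proof.
split=> [fk i ik|fk m mk].
  by apply/funext => m; rewrite /comp; case: eqP => // mi; rewrite fk // mi.
have := congr1 (fun f : A => f m) (fk _ mk); by rewrite /comp eqxx.
Qed.

Lemma std_ge_Dx k f : std_ge k f -> std_ge k.+1 (Dx f).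
Proof.
move/std_geE => fk; apply/std_geE => -[|i] ik; first exact: comp_std0_Dx.
by rewrite comp_stdS_Dx fk // dx0.
Qed.

Lemma std_ge_iter k s f : std_ge k f -> std_ge (k + s) (iter s (@Dx R) f).
Proof.
by move=> fk; elim: s => [|s IH]; rewrite ?addn0 // addnS; exact: std_ge_Dx.
Qed.

Lemma summable_iter f : summable (fun s => iter s (@Dx R) f).
Proof. by move=> s; have := std_ge_iter (s := s) (@std_ge0 R f); rewrite add0n. Qed.

Lemma iter_std k s f : homog stddeg k f -> homog stddeg (k + s) (iter s (@Dx R) f).
Proof.
by move=> fk; elim: s => [|s IH]; rewrite ?addn0 // addnS; exact: Dx_std.
Qed.

Lemma iter_super k s f : homog superdeg k f -> homog superdeg k (iter s (@Dx R) f).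
Proof. by move=> fk; elim: s => [|s IH] //; exact: Dx_super. Qed.

Lemma par_Dx d f : par d f -> par d (Dx f).
Proof.
move=> fd m md; have -> : Dx f m = comp superdeg (superdeg m) (Dx f) m.
  by rewrite /comp eqxx.
rewrite comp_super_Dx; have -> : comp superdeg (superdeg m) f = 0.
  apply/funext => x; rewrite /comp; case: eqP => // xm.
  by apply: fd; rewrite xm.
by rewrite dx0.
Qed.

Lemma par_iter d s f : par d f -> par d (iter s (@Dx R) f).
Proof. by move=> fd; elim: s => [|s IH] //; exact: par_Dx. Qed.

Lemma par_super p f : homog superdeg p f -> par (odd p) f.
Proof. by move=> fp m mp; apply: fp => mE; rewrite mE eqxx in mp. Qed.

Lemma iter_DxD s f g : iter s (@Dx R) (f + g) = iter s (@Dx R) f + iter s (@Dx R) g.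
Proof. by elim: s => //= s ->; rewrite dxD. Qed.

Lemma iter_DxZ s r f : iter s (@Dx R) (r *: f) = r *: iter s (@Dx R) f.
Proof. by elim: s => //= s ->; rewrite dxZ. Qed.

Lemma iter_Dx0 s : iter s (@Dx R) 0 = 0.
Proof. by elim: s => //= s ->; rewrite dx0. Qed.

(** * Equality up to total derivatives *)

Definition ieq f g : Prop := f - g \in @dx_image R.

Lemma dx_imageP f : (f \in @dx_image R) <-> exists h, f = Dx h.
Proof. by split=> [/asboolP|?]; [|apply/asboolP]; rewrite DxE. Qed.

Lemma Dx_image f : Dx f \in @dx_image R.
Proof. by apply/dx_imageP; exists f. Qed.

Lemma FintP f g : Fint f = Fint g <-> ieq f g.
Proof.
by rewrite /ieq /Fint Quotient.idealrBE; split => /eqP.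
Qed.

Lemma ieq_refl f : ieq f f.
Proof. by rewrite /ieq subrr rpred0. Qed.

Lemma ieq_eq f g : f = g -> ieq f g.
Proof. by move=> ->; exact: ieq_refl. Qed.

Lemma ieq_sym f g : ieq f g -> ieq g f.
Proof. by rewrite /ieq -opprB rpredN. Qed.

Lemma ieq_trans g f h : ieq f g -> ieq g h -> ieq f h.
Proof. by rewrite /ieq => fg gh; rewrite -(subrKA g) rpredD. Qed.

Lemma ieqD f f' g g' : ieq f f' -> ieq g g' -> ieq (f + g) (f' + g').
Proof. by rewrite /ieq => ff gg; rewrite opprD addrACA rpredD. Qed.

Lemma dx_imageZ r f : f \in @dx_image R -> r *: f \in @dx_image R.
Proof.
by move=> /dx_imageP[h ->]; apply/dx_imageP; exists (r *: h); rewrite dxZ.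
Qed.

Lemma ieqZ r f g : ieq f g -> ieq (r *: f) (r *: g).
Proof. by rewrite /ieq -scalerBr; exact: dx_imageZ. Qed.

Lemma ieqN f g : ieq f g -> ieq (- f) (- g).
Proof. by move/(ieqZ (-1)); rewrite !scaleN1r. Qed.

Lemma ieqB f f' g g' : ieq f f' -> ieq g g' -> ieq (f - g) (f' - g').
Proof. by move=> ff /ieqN; exact: ieqD. Qed.

Lemma ieq_sum n F X : (forall s, (s < n)%N -> ieq (F s) (X s)) ->
  ieq (\sum_(s < n) F s) (\sum_(s < n) X s).
Proof. by move=> FX; rewrite /ieq -sumrB; apply: rpred_sum => s _; exact: FX. Qed.

Lemma ieq_Dx f : ieq (Dx f) 0.
Proof. by rewrite /ieq subr0 Dx_image. Qed.

(** The total derivative raises the standard degree by exactly one, so that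
    primitives found one degree at a time can be glued. *)
Lemma dx_image_lim f : (forall k, exists g, eqto k f (Dx g)) -> f \in @dx_image R.
Proof.
move=> /choice[g fg]; apply/dx_imageP; exists (fun m => g (stddeg m).+1 m).
set h := fun m => _; have hE k : comp stddeg k h = comp stddeg k (g k.+1).
  by apply/funext => m; rewrite /comp /h; case: eqP => // ->.
apply: (@comp_inj R stddeg) => -[|k].
  rewrite comp_std0_Dx -(comp_std0_Dx (g 0%N)); apply/funext => m.
  by rewrite /comp; case: eqP => // m0; rewrite (fg 0%N) ?m0.
rewrite comp_stdS_Dx hE -comp_stdS_Dx; apply/funext => m.
by rewrite /comp; case: eqP => // mk; rewrite (fg k.+1) ?mk.
Qed.

Lemma ieq_lim f g :
  (forall k, exists f' g', [/\ eqto k f f', eqto k g g' & ieq f' g']) -> ieq f g.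
Proof.
move=> fg; apply: dx_image_lim => k; have [f' [g' [ff gg]]] := fg k.
by move=> /dx_imageP[h E]; exists h; rewrite -E; exact: eqtoB.
Qed.

Lemma ieq_comp k f g : ieq f g -> ieq (comp stddeg k f) (comp stddeg k g).
Proof.
move=> /dx_imageP[h E]; rewrite /ieq.
have -> : comp stddeg k f - comp stddeg k g = comp stddeg k (f - g).
  by rewrite (linB (comp_lin stddeg k)).
rewrite E; case: k => [|k]; first by rewrite comp_std0_Dx rpred0.
by rewrite comp_stdS_Dx Dx_image.
Qed.

Lemma ieq_comp_super k f g : ieq f g -> ieq (comp superdeg k f) (comp superdeg k g).
Proof.
move=> /dx_imageP[h E]; rewrite /ieq.
have -> : comp superdeg k f - comp superdeg k g = comp superdeg k (f - g).
  by rewrite (linB (comp_lin superdeg k)).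
by rewrite E comp_super_Dx Dx_image.
Qed.

Lemma parts1 f g : ieq (Dx f * g) (- (f * Dx g)).
Proof. by rewrite /ieq opprK -dxM Dx_image. Qed.

(** Integration by parts. *)
Lemma parts s f g : ieq (iter s (@Dx R) f * g) ((-1) ^+ s *: (f * iter s (@Dx R) g)).
Proof.
elim: s g => [|s IH] g; first by rewrite /= scale1r; exact: ieq_refl.
apply: (ieq_trans (parts1 _ _)); rewrite exprS -scalerA scaleN1r iterSr.
exact/ieqN/IH.
Qed.

(** * Variational derivatives *)

Definition vu : A -> A := locked_with seal (@var_u R).
Definition vt : A -> A := locked_with seal (@var_th R).

Lemma dx_opp_iterE s f : dx_opp_iter s f = (-1) ^+ s *: iter s (@Dx R) f.
Proof. by rewrite /dx_opp_iter DxE. Qed.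

Lemma vuE f : vu f = asum (fun s => (-1) ^+ s *: iter s (@Dx R) (du s f)).
Proof. by rewrite /vu unlock; apply: eq_asum => s; rewrite dx_opp_iterE duE. Qed.

Lemma vtE f : vt f = asum (fun s => (-1) ^+ s *: iter s (@Dx R) (dt s f)).
Proof. by rewrite /vt unlock; apply: eq_asum => s; rewrite dx_opp_iterE dtE. Qed.

Lemma summable_var X : summable (fun s => (-1) ^+ s *: iter s (@Dx R) (X s)).
Proof. by move=> s; apply: std_geZ; exact: summable_iter. Qed.

Lemma vu_lin r f g : vu (r *: f + g) = r *: vu f + vu g.
Proof.
rewrite !vuE -asumZ -asumD; apply: eq_asum => s.
by rewrite d_u_lin iter_DxD iter_DxZ scalerDr !scalerA mulrC.
Qed.

Lemma vt_lin r f g : vt (r *: f + g) = r *: vt f + vt g.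
Proof.
rewrite !vtE -asumZ -asumD; apply: eq_asum => s.
by rewrite d_th_lin iter_DxD iter_DxZ scalerDr !scalerA mulrC.
Qed.

Lemma sum_ordS n F : \sum_(s < n.+1) F s = \sum_(s < n) F s + F n.
Proof. by rewrite big_ord_recr. Qed.

(** The sum telescopes, because the commutator of the derivation along u^(s+1)
    with the total derivative is the derivation along u^s. *)
Lemma vu_Dx f : vu (Dx f) = 0.
Proof.
apply: eqtoP => k; rewrite vuE; apply: (eqto_trans (asumE (summable_var _) (ltnSn k))).
have -> n : \sum_(s < n.+1) (-1) ^+ s *: iter s (@Dx R) (du s (Dx f)) =
            (-1) ^+ n *: iter n.+1 (@Dx R) (du n f).
  elim: n => [|n IH]; first by rewrite big_ord_recl big_ord0 addr0 /= d_u0_dx.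
  rewrite (sum_ordS n.+1 (fun s => (-1) ^+ s *: iter s (@Dx R) (du s (Dx f)))).
  rewrite IH d_u_dx iter_DxD -iterSr scalerDr exprS mulN1r.
  by rewrite !scaleNr addrCA subrr addr0.
by apply: (std_geP _ _).1; apply: std_geZ; exact: summable_iter.
Qed.

Lemma vt_Dx f : vt (Dx f) = 0.
Proof.
apply: eqtoP => k; rewrite vtE; apply: (eqto_trans (asumE (summable_var _) (ltnSn k))).
have -> n : \sum_(s < n.+1) (-1) ^+ s *: iter s (@Dx R) (dt s (Dx f)) =
            (-1) ^+ n *: iter n.+1 (@Dx R) (dt n f).
  elim: n => [|n IH]; first by rewrite big_ord_recl big_ord0 addr0 /= d_th0_dx.
  rewrite (sum_ordS n.+1 (fun s => (-1) ^+ s *: iter s (@Dx R) (dt s (Dx f)))).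
  rewrite IH d_th_dx iter_DxD -iterSr scalerDr exprS mulN1r.
  by rewrite !scaleNr addrCA subrr addr0.
by apply: (std_geP _ _).1; apply: std_geZ; exact: summable_iter.
Qed.

Lemma vu_ieq f g : ieq f g -> vu f = vu g.
Proof.
move=> /dx_imageP[h E]; apply/eqP; rewrite -subr_eq0 -(linB vu_lin) E.
by rewrite vu_Dx.
Qed.

Lemma vt_ieq f g : ieq f g -> vt f = vt g.
Proof.
move=> /dx_imageP[h E]; apply/eqP; rewrite -subr_eq0 -(linB vt_lin) E.
by rewrite vt_Dx.
Qed.

Lemma vu_std k f : homog stddeg k f -> homog stddeg k (vu f).
Proof.
move=> fk; rewrite vuE; apply: homog_asum => s; apply: homogZ.
have wuE : (if s is s'.+1 then s'.+1 else 0%N) = s by case: s.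
have [ks|sk] := ltnP k s.
  rewrite (@homog_d_u_lt R succn id s k) ?iter_Dx0 ?wuE //; exact: homog0.
have -> : k = (k - s + s)%N by rewrite subnK.
by apply: iter_std; apply: (@homog_d_u R succn id); rewrite wuE subnKC.
Qed.

Lemma vt_std k f : homog stddeg k f -> homog stddeg k (vt f).
Proof.
move=> fk; rewrite vtE; apply: homog_asum => s; apply: homogZ.
have [ks|sk] := ltnP k s.
  rewrite (@homog_d_th_lt R succn id s k) ?iter_Dx0 //; exact: homog0.
have -> : k = (k - s + s)%N by rewrite subnK.
by apply: iter_std; apply: (@homog_d_th R succn id); rewrite subnKC.
Qed.

Lemma vu_super k f : homog superdeg k f -> homog superdeg k (vu f).
Proof.
move=> fk; rewrite vuE; apply: homog_asum => s; apply: homogZ; apply: iter_super.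
rewrite superdegF; apply: (@homog_d_u R (fun=> 0%N) (fun=> 1%N)).
by rewrite -superdegF; case: s.
Qed.

Lemma vt_super k f : homog superdeg k.+1 f -> homog superdeg k (vt f).
Proof.
move=> fk; rewrite vtE; apply: homog_asum => s; apply: homogZ; apply: iter_super.
rewrite superdegF; apply: (@homog_d_th R (fun=> 0%N) (fun=> 1%N)).
by rewrite -superdegF.
Qed.

(** * Evolutionary derivations *)

(** The prolongation of the vector field that sends u to f and theta to g. *)
Definition Ev f g : A -> A :=
  der (fun s => iter s (@Dx R) f) (fun s => iter s (@Dx R) g).

Lemma sder_Ev e f g : par e f -> par (~~ e) g -> sder e (Ev f g).
Proof.
move=> fe ge; apply: sder_der; try exact: summable_iter.
  by move=> s; exact: par_iter.
by move=> s; exact: par_iter.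
Qed.

Lemma Ev_cf f g a : Ev f g (cf a) = f * cf (Cderiv a).
Proof. by rewrite /Ev der_coef; try exact: summable_iter. Qed.

Lemma Ev_uv f g s : Ev f g (uv R s) = iter s (@Dx R) f.
Proof. by rewrite /Ev der_uvar; try exact: summable_iter. Qed.

Lemma Ev_tv f g s : Ev f g (tv R s) = iter s (@Dx R) g.
Proof. by rewrite /Ev der_thvar; try exact: summable_iter. Qed.

Lemma Ev_parts f g h : ieq (Ev f g h) (f * vu h + g * vt h).
Proof.
apply: ieq_lim => k.
exists (\sum_(s < k.+1) (iter s (@Dx R) f * du s h + iter s (@Dx R) g * dt s h)).
exists (f * (\sum_(s < k.+1) (-1) ^+ s *: iter s (@Dx R) (du s h)) +
        g * (\sum_(s < k.+1) (-1) ^+ s *: iter s (@Dx R) (dt s h))); split.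
- by apply: derE => //; exact: summable_iter.
- apply: eqtoD; apply: mul_eqto; rewrite ?vuE ?vtE //;
    exact: (asumE (summable_var _) (ltnSn k)).
- rewrite !mulr_sumr -big_split.
  apply: (@ieq_sum k.+1
    (fun s => iter s (@Dx R) f * du s h + iter s (@Dx R) g * dt s h)
    (fun s => f * ((-1) ^+ s *: iter s (@Dx R) (du s h)) +
              g * ((-1) ^+ s *: iter s (@Dx R) (dt s h)))) => s _.
  by rewrite -!scalerAr; apply: ieqD; exact: parts.
Qed.

Lemma Ev_Dx e f g : par e f -> par (~~ e) g -> forall h, Ev f g (Dx h) = Dx (Ev f g h).
Proof.
move=> fe ge h; apply/eqP; rewrite -subr_eq0; apply/eqP; move: h.
have dE := sder_Ev fe ge.
apply: (sder_ext (sder_comm_dx dE) (sder_zero R e)) => [a|s|s].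
- rewrite dx_coef (sder_leib dE) !Ev_cf Ev_uv sg_uvar dxM dx_coef opprD.
  have := amulC (uv R 1) fe; rewrite !amulE sg_uvar => fu.
  by rewrite !mulrA fu addrACA !subrr addr0.
- by rewrite dx_uvar !Ev_uv subrr.
- by rewrite dx_thvar !Ev_tv subrr.
Qed.

Lemma Ev_ieq e f g h h' : par e f -> par (~~ e) g -> ieq h h' ->
  ieq (Ev f g h) (Ev f g h').
Proof.
move=> fe ge /dx_imageP[k E]; rewrite /ieq -(linB (sder_lin (sder_Ev fe ge))) E.
by rewrite (Ev_Dx fe ge) Dx_image.
Qed.

End Integration.

Section Schouten.
Variable R : realType.
Local Notation A := (Ahat R).
Implicit Types (a b c f g h x : A) (r : R) (d e : bool) (s t k n p q : nat).

Lemma mulC_par e f g : par e f -> f * g = sg e g * f.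
Proof. by move=> fe; have := amulC g fe; rewrite !amulE. Qed.

Lemma mulC_even f g : par false f -> f * g = g * f.
Proof. by move/mulC_par => ->; rewrite sgF. Qed.

Lemma mulC_odd f g : par true f -> par true g -> f * g = - (g * f).
Proof.
by move/mulC_par => -> og; rewrite (sg_par _ og) -scalerAl scaleN1r.
Qed.

Lemma sg_even e f : par false f -> sg e f = f.
Proof. by move=> fe; rewrite (sg_par _ fe) muln0 scale1r. Qed.

Lemma sg_odd f : par true f -> sg true f = - f.
Proof. by move=> fe; rewrite (sg_par _ fe) scaleN1r. Qed.

Lemma parN e f : par e f -> par e (- f).
Proof. by rewrite -scaleN1r; exact: parZ. Qed.

(** The relation between E and sg forces the component of the wrong parity to
    equal its opposite. *)
Lemma par_sder e d (E : A -> A) f : sder e E -> par d f -> par (e (+) d) (E f).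
Proof.
move=> dE fd m md; apply/eqP; have := sder_sg dE true f.
rewrite (sg_par _ fd) mul1n mul1n (linZ (sder_lin dE)).
move=> /(congr1 (fun f : A => f m)); rewrite !ahatZE sgE mul1n => H.
have oE : odd (e + superdeg m) = ~~ d.
  by move: md; rewrite oddD oddb; case: e d (odd _) {dE fd H} => [] [] [].
move: H; rewrite scalerA -exprD -[X in _ = X *: _]signr_odd oE.
have -> : (-1) ^+ nat_of_bool (~~ d) = - (-1) ^+ d :> R.
  by case: d {fd md oE} => /=; rewrite ?opprK.
rewrite scaleNr => /eqP; rewrite -addr_eq0 -scalerDl -mulr2n scaler_eq0.
by rewrite -mulr_natr mulf_eq0 pnatr_eq0 orbF signr_eq0.
Qed.

(** * The Schouten bracket and its Hamiltonian derivations *)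

Definition Sch p f g : A := vt f * vu g + (-1) ^+ p *: (vu f * vt g).

Lemma SchE p f g : schouten_rep p f g = Sch p f g.
Proof. by rewrite /schouten_rep /Sch /vt /vu !unlock !amulE. Qed.

(** The Hamiltonian vector field of f. It agrees with the bracket modulo total
    derivatives, and has the advantage of being a derivation. *)
Definition Ham p f : A -> A := Ev (vt f) ((-1) ^+ p *: vu f).

Lemma par_vt p f : homog superdeg p.+1 f -> par (odd p) (vt f).
Proof. by move/(@vt_super R)/(@par_super R). Qed.

Lemma par_vu p f : homog superdeg p f -> par (odd p) (vu f).
Proof. by move/(@vu_super R)/(@par_super R). Qed.

Lemma sder_Ham p f : homog superdeg p.+1 f -> sder (odd p) (Ham p.+1 f).
Proof.
by move=> fp; apply: sder_Ev; [exact: par_vt|apply: parZ; exact: (par_vu fp)].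
Qed.

Lemma Sch_Ham p f g : ieq (Sch p f g) (Ham p f g).
Proof.
by apply: ieq_sym; apply: (ieq_trans (Ev_parts _ _ _)); rewrite -scalerAl; exact: ieq_refl.
Qed.

Lemma Sch_linr p f r g h : Sch p f (r *: g + h) = r *: Sch p f g + Sch p f h.
Proof.
rewrite /Sch vu_lin vt_lin !mulrDr !scalerDr -!scalerAr !scalerA mulrC.
by rewrite addrACA.
Qed.

Lemma Sch_linl p g r f h : Sch p (r *: f + h) g = r *: Sch p f g + Sch p h g.
Proof.
rewrite /Sch vu_lin vt_lin !mulrDl !scalerDr -!scalerAl !scalerA mulrC.
by rewrite addrACA.
Qed.

Lemma Sch_ieq p f f' g g' : ieq f f' -> ieq g g' -> Sch p f g = Sch p f' g'.
Proof. by move=> ff gg; rewrite /Sch (vu_ieq ff) (vt_ieq ff) (vu_ieq gg) (vt_ieq gg). Qed.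

Lemma Sch_super p q f g : homog superdeg p.+1 f -> homog superdeg q.+1 g ->
  homog superdeg (p + q).+1 (Sch p.+1 f g).
Proof.
move=> fp gq; rewrite superdegF; apply: homogD.
  rewrite -addnS; apply: homogM; rewrite -superdegF; first exact: vt_super.
  exact: vu_super.
apply: homogZ; rewrite -addSn; apply: homogM; rewrite -superdegF.
  exact: vu_super.
exact: vt_super.
Qed.

Lemma SchC f g : homog superdeg 2 f -> homog superdeg 2 g -> Sch 2 f g = Sch 2 g f.
Proof.
move=> f2 g2; rewrite /Sch expr2 mulrNN mulr1 !scale1r addrC.
by rewrite (mulC_even _ (par_vu f2)) (mulC_even _ (par_vu g2)) addrC addrC.
Qed.

(** * Symmetry of the second variation *)

Section Hessian.
Variables (e d : bool) (f g f' g' : A).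
Hypotheses (fe : par e f) (ge : par (~~ e) g) (fd : par d f') (gd : par (~~ d) g').
Let E := Ev f g.
Let F := Ev f' g'.
Let dE : sder e E := sder_Ev fe ge.
Let dF : sder d F := sder_Ev fd gd.
Let sig : R := (-1) ^+ (e * d).

(** Both sides are superderivations that commute with the total derivative, so
    that only their values at u and theta matter. *)
Lemma Ev_comm h : E (F h) - sig *: F (E h) =
  Ev (E f' - sig *: F f) (E g' - sig *: F g) h.
Proof.
have it (K : A -> A) (n : bool) : sder n K -> (forall h, K (Dx h) = Dx (K h)) ->
    forall s h, K (iter s (@Dx R) h) = iter s (@Dx R) (K h).
  by move=> _ KD s h'; elim: s => //= s <-.
have EE := it _ _ dE (Ev_Dx fe ge); have FF := it _ _ dF (Ev_Dx fd gd).
have p1 : par (e (+) d) (E f' - sig *: F f).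
  apply: parD; first exact: par_sder dE fd.
  apply/parN/parZ; rewrite addbC; exact: par_sder dF fe.
have p2 : par (~~ (e (+) d)) (E g' - sig *: F g).
  apply: parD; first by rewrite -addbN; exact: par_sder dE gd.
  apply/parN/parZ; rewrite addbC -addbN; exact: par_sder dF ge.
move: h; apply: (sder_ext (sder_comm dE dF) (sder_Ev p1 p2)) => [a|s|s].
- rewrite /E /F !Ev_cf -/E -/F (sder_leib dE) (sder_leib dF) /E /F !Ev_cf -/E -/F.
  rewrite (sg_par _ fd) (sg_par _ fe) mulrBl !scalerDr -!scalerAl !scalerA.
  have -> y : f' * (f * y) = (-1) ^+ (d * e) *: (f * (f' * y)).
    by rewrite mulrA (mulC_par f fd) (sg_par _ fe) -scalerAl -scalerAl mulrA.
  by rewrite scalerA -/sig; zmodule.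
- rewrite !Ev_uv /E /F !Ev_uv -/E -/F EE FF.
  by rewrite -iter_DxZ -scaleN1r -iter_DxZ -iter_DxD scaleN1r.
- rewrite !Ev_tv /E /F !Ev_tv -/E -/F EE FF.
  by rewrite -iter_DxZ -scaleN1r -iter_DxZ -iter_DxD scaleN1r.
Qed.

(** The symmetry of the second variation of h: integrating E (F h), F (E h)
    and their supercommutator by parts, and comparing the results, leaves
    exactly these terms. *)
Lemma hessian h : ieq (sg e f' * E (vu h) + sg e g' * E (vt h))
  (sig *: (sg d f * F (vu h) + sg d g * F (vt h))).
Proof.
have H1 := Ev_ieq fe ge (Ev_parts f' g' h).
have H2 := ieqZ sig (Ev_ieq fd gd (Ev_parts f g h)).
have H3 := ieq_trans (ieqB (ieq_sym H1) (ieq_sym H2))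
  (ieq_trans (ieq_eq (Ev_comm h)) (Ev_parts _ _ _)).
move: H3; rewrite /ieq -/E -/F (linD (sder_lin dE)) (linD (sder_lin dF)).
rewrite !(sder_leib dE) !(sder_leib dF) !mulrBl !scalerDr -!scalerAl.
set v := (X in X \in _ -> _); set w := (X in _ -> X \in _).
by suff -> : w = v by []; rewrite /v /w; zmodule.
Qed.

End Hessian.

(** * The graded Jacobi identity *)

(** The second variation of c along the Hamiltonian vector fields of a and b. *)
Definition hess2 c a b : A :=
  sg true (vt b) * Ham 2 a (vu c) + sg true (vu b) * Ham 2 a (vt c).

Lemma Ham2E a : Ham 2 a = Ev (vt a) (vu a).
Proof. by rewrite /Ham expr2 mulrNN mulr1 scale1r. Qed.

Lemma Ham1E a : Ham 1 a = Ev (vt a) (- vu a).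
Proof. by rewrite /Ham expr1 scaleN1r. Qed.

Lemma Sch2E f g : Sch 2 f g = vt f * vu g + vu f * vt g.
Proof. by rewrite /Sch expr2 mulrNN mulr1 scale1r. Qed.

Lemma Sch1E f g : Sch 1 f g = vt f * vu g - vu f * vt g.
Proof. by rewrite /Sch expr1 scaleN1r. Qed.

Lemma hess2C a b c : homog superdeg 2 a -> homog superdeg 2 b ->
  ieq (hess2 c a b) (- hess2 c b a).
Proof.
move=> a2 b2; rewrite /hess2 !Ham2E.
have := hessian (par_vt a2) (par_vu a2) (par_vt b2) (par_vu b2) c.
by rewrite mul1n expr1 scaleN1r.
Qed.

(** By Leibniz' rule for the Hamiltonian vector field of a. *)
Lemma nested22 a b c : homog superdeg 2 a -> homog superdeg 2 b ->
  homog superdeg 2 c -> ieq (Sch 2 a (Sch 2 b c)) (hess2 c a b + hess2 b a c).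
Proof.
move=> a2 b2 c2; apply: (ieq_trans (Sch_Ham _ _ _)); apply: ieq_eq.
have dH := sder_Ham a2; rewrite Sch2E (linD (sder_lin dH)) !(sder_leib dH) /hess2.
have [tb ub] := (par_vt b2, par_vu b2); have [tc uc] := (par_vt c2, par_vu c2).
rewrite (mulC_even (f := Ham 2 a (vt b))); last exact: (par_sder dH tb).
rewrite (mulC_odd (f := Ham 2 a (vu b))) //; last exact: (par_sder dH ub).
rewrite (sg_even _ uc) (sg_even _ ub) !(sg_odd tb) !(sg_odd tc) !mulNr; zmodule.
Qed.

(** The nested brackets are sums of second variations, which cancel in pairs
    by symmetry. *)
Lemma jacobi222 a b c : homog superdeg 2 a -> homog superdeg 2 b ->
  homog superdeg 2 c ->
  ieq (Sch 2 a (Sch 2 b c) + Sch 2 b (Sch 2 c a) + Sch 2 c (Sch 2 a b)) 0.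
Proof.
move=> a2 b2 c2; apply: (ieq_trans (ieqD (ieqD (nested22 a2 b2 c2)
  (nested22 b2 c2 a2)) (nested22 c2 a2 b2))).
have := ieqD (ieqD (hess2C c a2 b2) (hess2C a b2 c2)) (hess2C b c2 a2).
rewrite /ieq subr0; set v := (X in X \in _ -> _); set w := (X in _ -> X \in _).
by suff -> : w = v by []; rewrite /v /w; zmodule.
Qed.

(** The action of a vector field on brackets. The same cancellation of second
    variations occurs, with the signs of an even operator. *)
Lemma jacobi122 x a b : homog superdeg 1 x -> homog superdeg 2 a ->
  homog superdeg 2 b ->
  ieq (Sch 1 x (Sch 2 a b)) (Sch 2 (Sch 1 x a) b + Sch 2 a (Sch 1 x b)).
Proof.
move=> x1 a2 b2; have dx := sder_Ham x1.
have [tx ux] := (par_vt x1, par_vu x1).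
(* the two sides of the symmetry of the second variation for [x] and [f] *)
pose Q c f := vt f * Ham 1 x (vu c) + vu f * Ham 1 x (vt c).
pose T c f := vt x * Ham 2 f (vu c) + vu x * Ham 2 f (vt c).
have QT c f : homog superdeg 2 f -> ieq (Q c f) (T c f).
  move=> f2; rewrite /Q /T Ham1E Ham2E.
  have := hessian tx (parN ux) (par_vt f2) (par_vu f2) c.
  by rewrite !sgF mul0n scale1r (sg_even _ tx) (sg_odd (parN ux)) opprK.
have lhs : ieq (Sch 1 x (Sch 2 a b)) (Q b a + Q a b).
  apply: (ieq_trans (Sch_Ham _ _ _)); apply: ieq_eq.
  rewrite Sch2E (linD (sder_lin dx)) !(sder_leib dx) !sgF /Q.
  rewrite -(mulC_even (f := vu b)); last exact: (par_vu b2).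
  rewrite (mulC_even (f := Ham 1 x (vu a))); last exact: (par_sder dx (par_vu a2)).
  by zmodule.
have rhs f g : homog superdeg 2 f -> homog superdeg 2 g ->
    ieq (Sch 2 f (Sch 1 x g)) (T g f + hess2 x f g).
  move=> f2 g2; apply: (ieq_trans (Sch_Ham _ _ _)); apply: ieq_eq.
  have df := sder_Ham f2; have [tg ug] := (par_vt g2, par_vu g2).
  rewrite Sch1E (linB (sder_lin df)) !(sder_leib df) /T /hess2.
  rewrite (sg_even _ tx) (sg_odd ux) (sg_odd tg) (sg_even _ ug).
  rewrite -(mulC_even (f := vu g)) //.
  rewrite (mulC_even (f := Ham 2 f (vu x))); last exact: (par_sder df ux).
  by rewrite !mulNr; zmodule.
rewrite (SchC (Sch_super x1 a2) b2).
apply: (ieq_trans lhs); apply: (ieq_trans (ieqD (QT _ _ a2) (QT _ _ b2))).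
apply: ieq_sym; apply: (ieq_trans (ieqD (rhs _ _ b2 a2) (rhs _ _ a2 b2))).
have := hess2C x b2 a2.
rewrite /ieq; set v := (X in X \in _ -> _); set w := (X in _ -> X \in _).
by suff -> : w = v by []; rewrite /v /w; zmodule.
Qed.

End Schouten.

Section Pencil.
Variable R : realType.
Local Notation A := (Ahat R).
Local Notation u := (uv R).
Local Notation th := (tv R).
Implicit Types (a b c f g h x : A) (r : R) (s t k n p d : nat).

(** * The pencil of differentials *)

Lemma tvC s t : th s * th t = - (th t * th s).
Proof. exact: mulC_odd (par_thvar R s) (par_thvar R t). Qed.

Lemma half_double f : 2^-1 *: (f + f) = f.
Proof.
by rewrite -mulr2n -[f *+ 2]scaler_nat scalerA mulVf ?scale1r // pnatr_eq0.
Qed.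

Lemma eq_opp0 f : f = - f -> f = 0.
Proof. by move=> fN; rewrite -[f]half_double {2}fN subrr scaler0. Qed.

Lemma tv2 s : th s * th s = 0.
Proof. exact/eq_opp0/tvC. Qed.

Lemma uvC s f : u s * f = f * u s.
Proof. exact: mulC_even (par_uvar R s). Qed.

(** The variational derivatives of the second undeformed bivector; those of
    the first one are theta^1 and 0. *)
Definition w2 : A := u 0 * th 1 + 2^-1 *: (u 1 * th 0).
Definition z2 : A := 2^-1 *: (th 0 * th 1).
(** The Hamiltonian vector fields of the two undeformed bivectors. *)
Definition D1 : A -> A := Ev (th 1) 0.
Definition D2 : A -> A := Ev w2 z2.

Lemma par_w2 : par true w2.
Proof.
apply: parD; last apply: parZ;
  by rewrite -[true]/(false (+) true); apply: parM; [exact: par_uvar|exact: par_thvar].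
Qed.

Lemma par_z2 : par false z2.
Proof.
apply: parZ; rewrite -[false]/(true (+) true); apply: parM; exact: par_thvar.
Qed.

Lemma sder_D1 : sder true D1.
Proof. by apply: sder_Ev; [exact: par_thvar|exact: par0]. Qed.

Lemma sder_D2 : sder true D2.
Proof. by apply: sder_Ev; [exact: par_w2|exact: par_z2]. Qed.

Lemma D1_u s : D1 (u s) = th s.+1.
Proof. by rewrite /D1 Ev_uv; elim: s => //= s ->; rewrite dx_thvar. Qed.

Lemma D1_th s : D1 (th s) = 0.
Proof. by rewrite /D1 Ev_tv iter_Dx0. Qed.

Lemma D1_Dx f : D1 (Dx f) = Dx (D1 f).
Proof. by apply: (@Ev_Dx R true); [exact: par_thvar|exact: par0]. Qed.

Lemma D2_Dx f : D2 (Dx f) = Dx (D2 f).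
Proof. by apply: (@Ev_Dx R true); [exact: par_w2|exact: par_z2]. Qed.

Lemma Dx_z2 : Dx z2 = 2^-1 *: (th 0 * th 2).
Proof. by rewrite /z2 dxZ dxM !dx_thvar tv2 add0r. Qed.

Lemma D1_cf (a : Cinf R) : D1 (cf a) = th 1 * cf (Cderiv a).
Proof. exact: Ev_cf. Qed.

Lemma D2_cf (a : Cinf R) : D2 (cf a) = w2 * cf (Cderiv a).
Proof. exact: Ev_cf. Qed.

Lemma D2_u s : D2 (u s) = iter s (@Dx R) w2.
Proof. exact: Ev_uv. Qed.

Lemma D2_th s : D2 (th s) = iter s (@Dx R) z2.
Proof. exact: Ev_tv. Qed.

Lemma Ev00 f : Ev 0 0 f = 0 :> A.
Proof.
apply: (sder_ext (sder_Ev (@par0 R true) (@par0 R false)) (sder_zero R true)) => [a|s|s].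
- by rewrite Ev_cf mul0r.
- by rewrite Ev_uv iter_Dx0.
- by rewrite Ev_tv iter_Dx0.
Qed.

(** A supercommutator of evolutionary derivations is evolutionary; here and
    below it vanishes at u and theta. *)
Lemma D1D1 f : D1 (D1 f) = 0.
Proof.
have p0 := @par0 R false; apply: eq_opp0.
have := Ev_comm (par_thvar R 1) p0 (par_thvar R 1) p0 f.
rewrite -/D1 mul1n expr1 !scaleN1r !opprK D1_th (lin0 (sder_lin sder_D1)) addr0 Ev00.
by move/eqP; rewrite addr_eq0 => /eqP.
Qed.

Lemma D1D2 f : D1 (D2 f) = - D2 (D1 f).
Proof.
have := Ev_comm (par_thvar R 1) (@par0 R false) par_w2 par_z2 f.
rewrite -/D1 -/D2 mul1n expr1 !scaleN1r !opprK.
have -> : D1 w2 + D2 (th 1) = 0.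
  rewrite D2_th /= Dx_z2 /w2 (linD (sder_lin sder_D1)) (linZ (sder_lin sder_D1)).
  rewrite !(sder_leib sder_D1) !D1_u !D1_th !mulr0 !addr0 tv2 add0r -scalerDr.
  by rewrite tvC addNr scaler0.
have -> : D1 z2 + D2 0 = 0.
  rewrite (lin0 (sder_lin sder_D2)) /z2 (linZ (sder_lin sder_D1)).
  by rewrite (sder_leib sder_D1) !D1_th mul0r mulr0 !addr0 scaler0.
by rewrite Ev00 => /eqP; rewrite addr_eq0 => /eqP.
Qed.

Lemma D2D2 f : D2 (D2 f) = 0.
Proof.
apply: eq_opp0; have := Ev_comm par_w2 par_z2 par_w2 par_z2 f.
rewrite -/D2 mul1n expr1 !scaleN1r !opprK.
have -> : D2 w2 = 0.
  rewrite /w2 (linD (sder_lin sder_D2)) (linZ (sder_lin sder_D2)).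
  rewrite !(sder_leib sder_D2) !sg_uvar !D2_u !D2_th /= Dx_z2.
  rewrite /w2 dxD dxZ !dxM !dx_uvar !dx_thvar /z2 !mulrDl -!scalerAl -!scalerAr.
  rewrite -!mulrA !tv2 !mulr0 (tvC 1 0) (tvC 2 0) !mulrN !add0r.
  rewrite mulrDl -!mulrA tv2 mulr0 add0r (tvC 1 0) !mulrN scalerN.
  set X := u 1 * _; set Y := u 0 * _.
  have -> : - X - Y - 2^-1 *: X + 2^-1 *: X = - (X + Y) by zmodule.
  by rewrite scalerN scalerDr; zmodule.
have -> : D2 z2 = 0.
  rewrite /z2 (linZ (sder_lin sder_D2)) (sder_leib sder_D2) !D2_th /= Dx_z2.
  rewrite (sg_odd (par_thvar R 0)) /z2 -scalerAl -(mulrA (th 0) (th 1)) tv2.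
  by rewrite mulr0 scaler0 add0r mulNr -scalerAr mulrA tv2 mul0r scaler0 oppr0 scaler0.
by rewrite !addr0 Ev00 => /eqP; rewrite addr_eq0 => /eqP.
Qed.

(** * Filtration by the number of jet variables *)

Definition fil k f := forall m, (ulen m < k)%N -> f m = 0.

Lemma filE k f : fil k f <-> forall i, (i < k)%N -> comp ulen i f = 0.
Proof.
split=> [fk i ik|fk m mk].
  by apply/funext => m; rewrite /comp; case: eqP => // mi; rewrite fk // mi.
have := congr1 (fun f : A => f m) (fk _ mk); by rewrite /comp eqxx.
Qed.

Lemma fil0 f : fil 0 f. Proof. by []. Qed.

Lemma filW k n f : (n <= k)%N -> fil k f -> fil n f.
Proof. by move=> nk fk m mn; apply: fk; apply: leq_trans nk. Qed.

Lemma filD k f g : fil k f -> fil k g -> fil k (f + g).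
Proof. by move=> fk gk m mk; rewrite ahatDE fk ?gk ?addr0. Qed.

Lemma filZ k r f : fil k f -> fil k (r *: f).
Proof. by move=> fk m mk; rewrite ahatZE fk ?scaler0. Qed.

Lemma fil_asum k (F : nat -> A) : (forall s, fil k (F s)) -> fil k (asum F).
Proof. by move=> Fk m mk; apply: big1 => s _; exact: Fk. Qed.

Lemma filM k n f g : fil k f -> fil n g -> fil (k + n) (f * g).
Proof.
move=> fk gn m mkn; rewrite -amulE amul_sum big_seq big1 // => x.
rewrite mem_mdivisors => xm.
have := wt_div (fun=> 1%N) (fun=> 0%N) xm; rewrite -!/(ulen _) => mE.
have [xk|kx] := ltnP (ulen x) k; first by rewrite fk // mul0r mulr0.
rewrite gn ?mulr0 //; move: mkn; rewrite mE => mkn.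
by rewrite -(ltn_add2l k) (leq_ltn_trans _ mkn) // leq_add2r.
Qed.

Lemma filMl k f g : fil k f -> fil k (f * g).
Proof. by move=> fk; rewrite -[k]addn0; exact: filM. Qed.

Lemma filMr k f g : fil k g -> fil k (f * g).
Proof. by move=> gk; rewrite -[k]add0n; exact: filM. Qed.

Lemma fil_du0 k f : fil k f -> fil k (du 0 f).
Proof. by move=> fk m mk; rewrite d_u0E fk // Cderiv0. Qed.

Lemma fil_duS k s f : fil k.+1 f -> fil k (du s.+1 f).
Proof.
move=> fk m mk; rewrite d_uE fk ?mul0rn //.
by rewrite /ulen wt_u -/(ulen m) add1n ltnS.
Qed.

Lemma fil_dt k s f : fil k f -> fil k (dt s f).
Proof.
move=> fk m mk; rewrite d_thE; case: ifPn => // sm.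
by rewrite fk ?mulr0 // /ulen wt_th // add0n -/(ulen m).
Qed.

Lemma fil_uS s : fil 1 (u s.+1).
Proof.
rewrite /uv unlock => m m1; rewrite /uvar amonomE; case: eqP => // mE.
by move: m1; rewrite mE ulenE /= enum_msetn.
Qed.

Lemma fil_der k (X Y : nat -> A) f : (forall s, fil 1 (X s.+1)) -> fil k f ->
  fil k (der X Y f).
Proof.
move=> X1 fk; apply: fil_asum => s; apply: filD; last exact/filMr/fil_dt.
case: s => [|s]; first exact/filMr/fil_du0.
case: k fk => [|k] fk; first exact: fil0.
by rewrite -add1n; apply: filM => //; exact: fil_duS.
Qed.

Lemma fil_Dx k f : fil k f -> fil k (Dx f).
Proof. by rewrite DxderE; apply: fil_der => s; exact: fil_uS. Qed.

Lemma fil_comp k f : fil k f -> fil k.+1 (f - comp ulen k f).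
Proof.
move=> fk m; rewrite ltnS leq_eqVlt ahatBE /comp => /orP[/eqP ->|mk].
  by rewrite eqxx subrr.
by rewrite fk // if_same subr0.
Qed.

Lemma ulen_stddeg m : (ulen m <= stddeg m)%N.
Proof.
by rewrite /ulen stddegE /wt; apply: leq_add; apply: leq_sum.
Qed.

Lemma fil_std k f : fil k.+1 f -> homog stddeg k f -> f = 0.
Proof.
move=> fk fs; apply/funext => m; have [mk|mk] := eqVneq (stddeg m) k.
  by apply: fk; rewrite ltnS -mk ulen_stddeg.
by apply: fs; exact/eqP.
Qed.

(** * The Koszul part of the first differential *)

(** The Koszul differential that replaces u^s by theta^(s+1): the part of the
    first differential that removes a jet variable. *)
Definition delta : A -> A := der (fun s => if s is s'.+1 then th s.+1 else 0) (fun=> 0).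

Lemma delta_summable : summable (fun s => if s is s'.+1 then th s.+1 else 0).
Proof. by case=> [|s] //; apply: (std_geW (leqnSn _)); exact: std_ge_thvar. Qed.

Lemma zero_summable : summable (fun=> 0 : A).
Proof. by []. Qed.

Lemma sder_delta : sder true delta.
Proof.
apply: sder_der => [||s|s]; [exact: delta_summable|exact: zero_summable| |exact: par0].
by case: s => [|s]; [exact: par0|exact: par_thvar].
Qed.

Lemma delta_cf (a : Cinf R) : delta (cf a) = 0.
Proof. by rewrite /delta der_coef ?mul0r //; exact: delta_summable. Qed.

Lemma delta_u s : delta (u s.+1) = th s.+2.
Proof. by rewrite /delta der_uvar //; exact: delta_summable. Qed.

Lemma delta_th s : delta (th s) = 0.
Proof. by rewrite /delta der_thvar //; exact: delta_summable. Qed.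

Lemma D1E f : D1 f = delta f + th 1 * du 0 f.
Proof.
have d2 : sder true (fun f => th 1 * du 0 f).
  exact: (sder_mull (par_thvar R 1) (sder_d_u R 0)).
apply: (sder_ext sder_D1 (sder_add sder_delta d2)) => [a|s|s].
- by rewrite /D1 Ev_cf delta_cf add0r d_u0_coef.
- by rewrite D1_u delta_u d_u_uvar mulr0 addr0.
- by rewrite D1_th delta_th d_u_thvar mulr0 addr0.
Qed.

Lemma delta_ulen k f : homog ulen k.+1 f -> homog ulen k (delta f).
Proof.
move=> fk; apply: homog_asum => -[|s]; rewrite !mul0r addr0; first exact: homog0.
rewrite -[k]add0n; apply: homogM; first exact: homog_thvar.
by apply: (@homog_d_u R (fun=> 1%N) (fun=> 0%N)).
Qed.

Lemma delta_ulen0 f : homog ulen 0 f -> delta f = 0.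
Proof.
move=> f0; rewrite /delta /der (asum1 (t := 0%N)) ?mul0r ?addr0 //.
  by apply: der_summable; [exact: delta_summable|exact: zero_summable].
case=> // s _; rewrite mul0r addr0 (@homog_d_u_lt R (fun=> 1%N) (fun=> 0%N) s.+1 0) ?mulr0 //.
Qed.

Lemma comp_delta k f : comp ulen k (delta f) = delta (comp ulen k.+1 f).
Proof.
apply: (comp_op (sder_lin sder_delta) (sder_cont sder_delta)).
  exact: delta_ulen.
move=> [|j] g jk gj; first by rewrite delta_ulen0 // (lin0 (comp_lin _ _)).
by apply: (comp_homog_neq (delta_ulen gj)) => jE; apply: jk; rewrite jE.
Qed.

(** Counts the variables u^s and theta^(s+1), s >= 1, which the Koszul
    differential exchanges. *)
Definition kwt := wt (fun=> 1%N) (fun j => (1 < j)%N).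

Lemma delta_kwt k f : homog kwt k f -> homog kwt k (delta f).
Proof.
move=> fk; rewrite -[k]addn0.
apply: (@homog_der R (fun=> 1%N) (fun j => (1 < j)%N : nat)) => [s|s|//].
  by case: s => [|s]; [exact: homog0|exact: (@homog_thvar R _ _ s.+2)].
exact: homog0.
Qed.

Lemma comp_kwt_delta k f : comp kwt k (delta f) = delta (comp kwt k f).
Proof.
rewrite -[k in LHS]addn0.
apply: (comp_shift (sder_lin sder_delta) (sder_cont sder_delta)) => i g.
by rewrite addn0; exact: delta_kwt.
Qed.

(** * Counting operators *)

Definition cnt (w : monomial -> nat) f : A := fun m => (w m)%:R *: f m.

Lemma cnt_homog w k f : homog w k f -> cnt w f = k%:R *: f.
Proof.
move=> fk; apply/funext => m; rewrite ahatZE /cnt.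
by have [->//|/eqP/fk->] := eqVneq (w m) k; rewrite !scaler0.
Qed.

Lemma sder_cnt (p q : nat -> nat) : sder false (cnt (wt p q)).
Proof.
split=> [r f g|f g|k|b f].
- apply/funext => m; rewrite !(ahatDE, ahatZE) /cnt !(ahatDE, ahatZE) scalerDr.
  by rewrite !scalerA mulrC.
- rewrite sgF; apply/funext => m; rewrite ahatDE -!amulE /cnt !amul_sum.
  rewrite -big_split scaler_sumr big_seq [RHS]big_seq; apply: eq_bigr => x.
  rewrite mem_mdivisors => xm; rewrite (wt_div p q xm) natrD scalerDl /=.
  set e := (-1) ^+ _; rewrite !scaleCinfE; set v := Ccst _; set w := Ccst _.
  by rewrite (mulrCA (f x) w) -(mulrA v) (mulrCA e v) (mulrCA e w).
- by exists k => f f0 m mk; rewrite /cnt f0 // scaler0.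
- by apply/funext => m; rewrite muln0 scale1r sgE /cnt sgE !scalerA mulrC.
Qed.

(** * Homotopy for the Koszul part *)

(** The Koszul homotopy, which restores u^s from theta^(s+1). *)
Definition kappa f : A := asum (fun s => u s.+1 * dt s.+2 f).

Lemma kappa_summable f : summable (fun s => u s.+1 * dt s.+2 f).
Proof.
apply: (@summableMl R (fun s => u s.+1) (fun s => dt s.+2 f)) => s.
by apply: (std_geW (leqnSn _)); exact: std_ge_uvar.
Qed.

Lemma sder_kappa : sder true kappa.
Proof.
pose F n f : A := \sum_(s < n) u s.+1 * dt s.+2 f.
apply: (@sder_lim _ true _ F) => [n|k]; last first.
  by exists k.+1 => f; apply: asumE => //; exact: kappa_summable.
apply: (@sder_sum _ true n (fun s f => u s.+1 * dt s.+2 f)) => s.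
exact: (sder_mull (par_uvar R s.+1) (sder_d_th R s.+2)).
Qed.

Lemma asum0 (F : nat -> A) : (forall s, F s = 0) -> asum F = 0.
Proof. by move=> F0; apply/funext => m; apply: big1 => s _; rewrite F0. Qed.

Lemma kappa_cf (a : Cinf R) : kappa (cf a) = 0.
Proof. by apply: asum0 => s; rewrite d_th_coef mulr0. Qed.

Lemma kappa_u t : kappa (u t) = 0.
Proof. by apply: asum0 => s; rewrite d_th_uvar mulr0. Qed.

Lemma kappa_th t : kappa (th t.+2) = u t.+1.
Proof.
rewrite /kappa (asum1 (t := t)) ?d_th_thvar ?eqxx ?mulr1 //.
  exact: kappa_summable.
by move=> s /negPf st; rewrite d_th_thvar !eqSS st mulr0.
Qed.

Lemma kappa_th01 t : (t < 2)%N -> kappa (th t) = 0.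
Proof.
move=> t2; apply: asum0 => s; rewrite d_th_thvar; case: eqP => [E|_]; rewrite ?mulr0 //.
by move: t2; rewrite -E.
Qed.

(** Both sides are even derivations, and each exchanged variable comes back to
    itself. *)
Lemma cnt_kwtE f : delta (kappa f) + kappa (delta f) = cnt kwt f.
Proof.
have := sder_comm sder_delta sder_kappa; rewrite muln1 expr1.
under eq_fun do rewrite scaleN1r opprK.
move=> dk; apply: (sder_ext dk (sder_cnt _ _)) => [a|s|s].
- rewrite kappa_cf delta_cf (lin0 (sder_lin sder_delta)) (lin0 (sder_lin sder_kappa)).
  by rewrite (@cnt_homog _ 0) ?scale0r ?addr0 //; exact: homog_coef.
- rewrite kappa_u delta_u kappa_th (lin0 (sder_lin sder_delta)) add0r.
  by rewrite (@cnt_homog _ 1) ?scale1r //; exact: (@homog_uvar R (fun=> 1%N) _ s.+1).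
- rewrite delta_th (lin0 (sder_lin sder_kappa)) addr0.
  have hs := @homog_thvar R (fun=> 1%N) (fun j => (1 < j)%N : nat) s.
  rewrite (cnt_homog hs); case: s {hs} => [|[|s]] /=.
  + by rewrite kappa_th01 // scale0r (lin0 (sder_lin sder_delta)).
  + by rewrite kappa_th01 // scale0r (lin0 (sder_lin sder_delta)).
  + by rewrite kappa_th delta_u scale1r.
Qed.

Lemma kappa_ulen k f : homog ulen k f -> homog ulen k.+1 (kappa f).
Proof.
move=> fk; apply: homog_asum => s; rewrite -[k.+1]add1n; apply: homogM.
  exact: (@homog_uvar R (fun=> 1%N) (fun=> 0%N) s.+1).
exact: (@homog_d_th R (fun=> 1%N) (fun=> 0%N)).
Qed.

Lemma kappa_super p f : homog superdeg p.+1 f -> homog superdeg p (kappa f).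
Proof.
rewrite superdegF => fk; apply: homog_asum => s; rewrite -[p]add0n; apply: homogM.
  exact: (@homog_uvar R (fun=> 0%N) (fun=> 1%N) s.+1).
exact: (@homog_d_th R (fun=> 0%N) (fun=> 1%N)).
Qed.

Lemma kappa_std d f : homog stddeg d.+1 f -> homog stddeg d (kappa f).
Proof.
move=> fk; apply: homog_asum => s.
have [ds|sd] := ltnP d.+1 s.+2.
  by rewrite (@homog_d_th_lt R succn id s.+2 d.+1) // mulr0; exact: homog0.
have -> : d = (s.+1 + (d - s.+1))%N by rewrite subnKC.
apply: (@homogM R succn id); first exact: (@homog_uvar R succn id s.+1).
by apply: (@homog_d_th R succn id); rewrite addSn subnKC.
Qed.

(** Inverse of the counting operator where it does not vanish. *)
Definition icnt f : A := fun m => (kwt m)%:R^-1 *: f m.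

Lemma delta_icnt f : delta (icnt f) = icnt (delta f).
Proof.
have ci k g : comp kwt k (icnt g) = k%:R^-1 *: comp kwt k g.
  apply/funext => m; rewrite ahatZE /comp /icnt.
  by case: eqP => [->|]; rewrite ?scaler0.
apply: (@comp_inj R kwt) => k; rewrite ci !comp_kwt_delta ci.
exact: (linZ (sder_lin sder_delta)).
Qed.

Lemma icnt_homog w k f : homog w k f -> homog w k (icnt f).
Proof. by move=> fk m mk; rewrite /icnt fk // scaler0. Qed.

(** A monomial that is not counted only contains theta and theta^1. *)
Lemma kwt_gt0 m : (1 < stddeg m)%N -> (0 < kwt m)%N.
Proof.
case: m => M T; rewrite lt0n; apply: contraL; rewrite /kwt /wt addn_eq0 sum1_size /=.
move=> /andP[M0 T0]; rewrite stddegE /wt /=.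
have -> : M = mset0 by apply/eqP; rewrite -size_mset_eq0.
rewrite big_mset0 add0n -leqNgt.
have TE : forall j, j \in T -> (j : nat) = (j == 1%N).
  move=> j jT; move: T0; rewrite sum_nat_seq_eq0 => /allP/(_ _ jT) /=.
  by case: j {jT} => [|[|j]].
rewrite (eq_big_seq (fun j : nat => nat_of_bool (j == 1%N))) //.
rewrite -big_mkcond /= sum1_count (count_uniq_mem _ (fset_uniq _)).
by case: (_ \in _).
Qed.

Lemma delta_exact f : std_ge 2 f -> delta f = 0 -> f = delta (icnt (kappa f)).
Proof.
move=> f2 df; rewrite delta_icnt.
have := cnt_kwtE f; rewrite df (lin0 (sder_lin sder_kappa)) addr0 => ->.
apply/funext => m; rewrite /icnt /cnt scalerA.
have [m2|m2] := ltnP (stddeg m) 2; first by rewrite f2 // scaler0.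
by rewrite mulVf ?scale1r // pnatr_eq0 -lt0n kwt_gt0.
Qed.

End Pencil.

Section Cohomology.
Variable R : realType.
Local Notation A := (Ahat R).
Local Notation u := (uv R).
Local Notation th := (tv R).
Local Notation D1 := (@D1 R).
Local Notation D2 := (@D2 R).
Local Notation delta := (@delta R).
Implicit Types (a b c f g h x : A) (r : R) (s t k n p d m : nat).

(** * Homotopy for the second differential *)

(** The second differential minus u times the first. Unlike the differentials
    themselves it never removes a jet variable, and on the kernel of the first
    differential it agrees with the second one. *)
Definition DP f : A := D2 f - u 0 * D1 f.

Lemma sder_DP : sder true DP.
Proof.
apply: sder_sub; first exact: sder_D2.
exact: (sder_mull (par_uvar R 0) (sder_D1 R)).
Qed.

Definition dpX s : A := iter s (@Dx R) (w2 R) - u 0 * th s.+1.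

Lemma DP_u s : DP (u s) = dpX s.
Proof. by rewrite /DP D2_u D1_u. Qed.

Lemma DP_th s : DP (th s) = iter s (@Dx R) (z2 R).
Proof. by rewrite /DP D2_th D1_th mulr0 subr0. Qed.

Lemma DP_cf (a : Cinf R) : DP (cf a) = dpX 0 * cf (Cderiv a).
Proof. by rewrite /DP D2_cf D1_cf mulrA -mulrBl. Qed.

Lemma dpX0 : dpX 0 = 2^-1 *: (u 1 * th 0).
Proof. by rewrite /dpX /= /w2 addrAC subrr add0r. Qed.

Lemma fil_dpX s : fil 1 (dpX s).
Proof.
elim: s => [|s IH]; first by rewrite dpX0; apply/filZ/filMl/fil_uS.
have -> : dpX s.+1 = Dx (dpX s) + u 1 * th s.+1.
  rewrite /dpX dxD dxN dxM dx_uvar dx_thvar /=; zmodule.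
by apply: filD; [exact: fil_Dx|exact/filMl/fil_uS].
Qed.

Lemma dpX_summable : summable dpX.
Proof.
move=> s; apply: std_geD; first exact: summable_iter.
rewrite -scaleN1r; apply: std_geZ; rewrite -[s]add0n; apply: std_geM => //.
by apply: (std_geW (leqnSn _)); exact: std_ge_thvar.
Qed.

Lemma par_dpX s : par true (dpX s).
Proof.
apply: parD; first exact/par_iter/par_w2.
by apply: parN; apply: (parM (par_uvar R 0) (par_thvar R s.+1)).
Qed.

Lemma DPE f : DP f = der dpX (fun s => iter s (@Dx R) (z2 R)) f.
Proof.
have sZ : summable (fun s => iter s (@Dx R) (z2 R)) by exact: summable_iter.
apply: (sder_ext sder_DP (sder_der dpX_summable sZ par_dpX _)) => [s|a|s|s].
- by apply: par_iter; exact: par_z2.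
- by rewrite DP_cf der_coef //; exact: dpX_summable.
- by rewrite DP_u der_uvar //; exact: dpX_summable.
- by rewrite DP_th der_thvar //; exact: dpX_summable.
Qed.

Lemma fil_DP k f : fil k f -> fil k (DP f).
Proof. by move=> fk; rewrite DPE; apply: fil_der => // s; exact: fil_dpX. Qed.

Lemma comp_DP k f : fil k f -> comp ulen k (DP f) = comp ulen k (DP (comp ulen k f)).
Proof.
move=> fk; apply/eqP; rewrite -subr_eq0 -(linB (comp_lin ulen k)).
rewrite -(linB (sder_lin sder_DP)); apply/eqP.
exact: ((filE _ _).1 (fil_DP (fil_comp fk)) k (ltnSn k)).
Qed.

Definition iota1 f : A := dt 1 f.

Lemma iota1_iter n f : iota1 (iter n (@Dx R) f) =
  iter n (@Dx R) (iota1 f) + n%:R *: iter n.-1 (@Dx R) (dt 0 f).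
Proof.
have d0 k : dt 0 (iter k (@Dx R) f) = iter k (@Dx R) (dt 0 f).
  by elim: k => //= k <-; rewrite d_th0_dx.
elim: n => [|n IH]; first by rewrite scale0r addr0.
rewrite iterS /iota1 d_th_dx -/(iota1 _) IH d0 dxD dxZ -addrA; congr (_ + _).
case: n {IH} => [|n]; first by rewrite !scale0r add0r scale1r.
by rewrite -iterS -{2}[iter _ _ _]scale1r -scalerDl natr1.
Qed.

(** The anticommutator of the reduced second differential with the derivative
    along theta^1. It is a multiple of the identity on each component
    homogeneous for the three gradations. *)
Definition wop f : A := cnt ulen f + 2^-1 *: (cnt stddeg f - cnt superdeg f).

Lemma sder_wop : sder false wop.
Proof.
apply: sder_add; first exact: sder_cnt.
apply: sder_scale; apply: sder_sub; first exact: (sder_cnt R succn id).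
rewrite superdegF; exact: sder_cnt.
Qed.

Lemma wop_homog k n p f : homog ulen k f -> homog stddeg n f -> homog superdeg p f ->
  wop f = (k%:R + 2^-1 * (n%:R - p%:R)) *: f.
Proof.
move=> fk fn fp; rewrite /wop (cnt_homog fk) (cnt_homog fn) (cnt_homog fp).
by rewrite -scalerBl scalerA -scalerDl.
Qed.

(** Both sides are even derivations. On u^s, the total derivative turns
    theta^1 into theta^(n+1) and produces the factor depending on the degree. *)
Lemma DP_iota1 f : DP (iota1 f) + iota1 (DP f) = wop f.
Proof.
have := sder_comm sder_DP (sder_d_th R 1); rewrite muln1 expr1.
under eq_fun do rewrite scaleN1r opprK.
have DP0 := lin0 (sder_lin sder_DP); have i0 := lin0 (@d_th_lin R 1).
move=> dk; apply: (sder_ext dk sder_wop) => [a|s|s].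
- rewrite d_th_coef DP0 add0r DP_cf dpX0.
  rewrite (wop_homog (@homog_coef R (fun=> 1%N) (fun=> 0%N) a)
    (@homog_coef R succn id a) (p := 0)); last first.
    by rewrite superdegF; exact: homog_coef.
  rewrite subrr mulr0 addr0 scale0r -scalerAl -mulrA (linZ (@d_th_lin R 1)).
  rewrite !(sder_leib (sder_d_th R 1)) !d_th_uvar d_th_thvar d_th_coef.
  have -> : (1%N == 0%N)%:R = 0 :> A by [].
  by rewrite !mul0r add0r mulr0 add0r mulr0 scaler0.
- have := @homog_uvar R (fun=> 0%N) (fun=> 1%N) s.+1; rewrite -superdegF => u0.
  have := wop_homog (@homog_uvar R (fun=> 1%N) (fun=> 0%N) s.+1)
    (@homog_uvar R succn id s.+1) u0; rewrite /= subr0 => ->.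
  rewrite d_th_uvar DP0 add0r DP_u /dpX (linB (@d_th_lin R 1)) -/(iota1 _) iota1_iter.
  rewrite (sder_leib (sder_d_th R 1)) d_th_uvar d_th_thvar eqSS mul0r mulr0 addr0 subr0.
  have -> : iota1 (w2 R) = u 0.
    rewrite /iota1 /w2 (linD (@d_th_lin R 1)) (linZ (@d_th_lin R 1)).
    rewrite !(sder_leib (sder_d_th R 1)) !d_th_uvar !d_th_thvar !mul0r !add0r.
    by rewrite !sg_uvar mulr1 mulr0 scaler0 addr0.
  have -> : dt 0 (w2 R) = 2^-1 *: u 1.
    rewrite /w2 (linD (@d_th_lin R 0)) (linZ (@d_th_lin R 0)).
    rewrite !(sder_leib (sder_d_th R 0)) !d_th_uvar !d_th_thvar !mul0r !add0r.
    by rewrite !sg_uvar mulr1 mulr0 add0r.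
  have it t n : iter n (@Dx R) (u t) = u (n + t).
    by elim: n => //= n ->; rewrite dx_uvar.
  rewrite iter_DxZ !it addn0 addn1 scalerA -{1}[u _]scale1r -scalerDl.
  by rewrite [_ * 2^-1]mulrC.
- have := wop_homog (@homog_thvar R (fun=> 1%N) (fun=> 0%N) s)
    (@homog_thvar R succn id s) (p := 1); rewrite add0r => ->; last first.
    by rewrite superdegF; exact: (@homog_thvar R (fun=> 0%N) (fun=> 1%N) s).
  have -> : DP (dt 1 (th s)) = 0.
    by rewrite d_th_thvar -scaler_nat (linZ (sder_lin sder_DP)) -coef1 DP_cf Cderiv1 cf0 mulr0 scaler0.
  rewrite add0r DP_th -/(iota1 _) iota1_iter.
  have -> : iota1 (z2 R) = - (2^-1 *: th 0).
    rewrite /iota1 /z2 (linZ (@d_th_lin R 1)) (sder_leib (sder_d_th R 1)).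
    by rewrite !d_th_thvar mul0r add0r mulr1 sg_thvar scaleN1r scalerN.
  have -> : dt 0 (z2 R) = 2^-1 *: th 1.
    rewrite /z2 (linZ (@d_th_lin R 0)) (sder_leib (sder_d_th R 0)).
    by rewrite !d_th_thvar mul1r mulr0 addr0.
  have it t n : iter n (@Dx R) (th t) = th (n + t).
    by elim: n => //= n ->; rewrite dx_thvar.
  rewrite -scaleNr !iter_DxZ !it addn0; case: s => [|s].
    by rewrite scale0r addr0 add0r mulrN1.
  rewrite addn1 scalerA -scalerDl; congr (_ *: _).
  by rewrite mulrBr mulr1 addrC mulrC.
Qed.

Lemma delta_iota1 f : delta (iota1 f) = - iota1 (delta f).
Proof.
have := sder_comm (sder_delta R) (sder_d_th R 1); rewrite muln1 expr1.
under eq_fun do rewrite scaleN1r opprK.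
move=> dk; apply/eqP; rewrite -addr_eq0; apply/eqP; move: f.
have d0 := lin0 (sder_lin (sder_delta R)); have i0 := lin0 (@d_th_lin R 1).
apply: (sder_ext dk (sder_zero R false)) => [a|s|s].
- by rewrite d_th_coef delta_cf d0 i0 addr0.
- by rewrite d_th_uvar delta_u d_th_thvar d0 addr0.
- rewrite delta_th i0 d_th_thvar -scaler_nat (linZ (sder_lin (sder_delta R))) -coef1.
  by rewrite delta_cf scaler0 addr0.
Qed.

(** * Degrees of the differentials *)

Lemma w2_std : homog stddeg 1 (w2 R).
Proof.
apply: homogD; [apply: (@homogM R succn id 0 1)|
  apply: homogZ; apply: (@homogM R succn id 1 0)].
- exact: (@homog_uvar R succn id 0).
- exact: (@homog_thvar R succn id 1).
- exact: (@homog_uvar R succn id 1).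
- exact: (@homog_thvar R succn id 0).
Qed.

Lemma z2_std : homog stddeg 1 (z2 R).
Proof.
apply: homogZ; apply: (@homogM R succn id 0 1).
- exact: (@homog_thvar R succn id 0).
- exact: (@homog_thvar R succn id 1).
Qed.

Lemma u_super s : homog superdeg 0 (u s).
Proof.
by rewrite superdegF; have := @homog_uvar R (fun=> 0%N) (fun=> 1%N) s; case: s.
Qed.

Lemma th_super s : homog superdeg 1 (th s).
Proof. by rewrite superdegF; exact: (@homog_thvar R (fun=> 0%N) (fun=> 1%N) s). Qed.

Lemma superM p n f g : homog superdeg p f -> homog superdeg n g ->
  homog superdeg (p + n) (f * g).
Proof. rewrite superdegF; exact: homogM. Qed.

Lemma stdM p n f g : homog stddeg p f -> homog stddeg n g ->
  homog stddeg (p + n) (f * g).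
Proof. exact: (@homogM R succn id). Qed.

Lemma u_std s : homog stddeg s (u s).
Proof. by have := @homog_uvar R succn id s; case: s. Qed.

Lemma th_std s : homog stddeg s (th s).
Proof. exact: (@homog_thvar R succn id s). Qed.

Lemma cf_std (a : Cinf R) : homog stddeg 0 (cf a).
Proof. exact: (@homog_coef R succn id). Qed.

Lemma cf_super (a : Cinf R) : homog superdeg 0 (cf a).
Proof. by rewrite superdegF; exact: homog_coef. Qed.

Lemma w2_super : homog superdeg 1 (w2 R).
Proof.
apply: homogD; last apply: homogZ; rewrite -[1%N]add0n;
  by apply: superM; [exact: u_super|exact: th_super].
Qed.

Lemma z2_super : homog superdeg 2 (z2 R).
Proof. by apply: homogZ; rewrite -[2%N]/(1 + 1)%N; apply: superM; exact: th_super. Qed.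

Lemma Ev_std f g k h : homog stddeg 1 f -> homog stddeg 1 g -> homog stddeg k h ->
  homog stddeg k.+1 (Ev f g h).
Proof.
move=> f1 g1; rewrite -addn1; apply: (@homog_der R succn id) => s.
  by have := iter_std (s := s) f1; rewrite addnC; case: s.
by rewrite addnC; exact: iter_std.
Qed.

Lemma Ev_super f g p h : homog superdeg 1 f -> homog superdeg 2 g ->
  homog superdeg p h -> homog superdeg p.+1 (Ev f g h).
Proof.
move=> f1 g2; rewrite -[p.+1]addn1 superdegF.
apply: (@homog_der R (fun=> 0%N) (fun=> 1%N)) => s; rewrite -superdegF.
  by case: s => [|s]; exact: iter_super.
exact: iter_super.
Qed.

Lemma D1_std k f : homog stddeg k f -> homog stddeg k.+1 (D1 f).
Proof. by apply: Ev_std; [exact: th_std|exact: homog0]. Qed.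

Lemma D2_std k f : homog stddeg k f -> homog stddeg k.+1 (D2 f).
Proof. by apply: Ev_std; [exact: w2_std|exact: z2_std]. Qed.

Lemma D1_super p f : homog superdeg p f -> homog superdeg p.+1 (D1 f).
Proof. by apply: Ev_super; [exact: th_super|exact: homog0]. Qed.

Lemma D2_super p f : homog superdeg p f -> homog superdeg p.+1 (D2 f).
Proof. by apply: Ev_super; [exact: w2_super|exact: z2_super]. Qed.

(** * Exactness *)

Lemma comp_D1 k f : comp ulen k (D1 f) =
  delta (comp ulen k.+1 f) + th 1 * du 0 (comp ulen k f).
Proof.
rewrite D1E (linD (comp_lin ulen k)) comp_delta; congr (_ + _).
pose E g := th 1 * du 0 g.
have dE : sder true E by exact: (sder_mull (par_thvar R 1) (sder_d_u R 0)).
rewrite -[k in LHS]addn0; apply: (comp_shift (sder_lin dE) (sder_cont dE)) => i g gi.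
rewrite addnC; apply: homogM; first exact: (@homog_thvar R (fun=> 1%N) (fun=> 0%N) 1).
exact: (@homog_d_u R (fun=> 1%N) (fun=> 0%N) 0).
Qed.

Lemma comp_homog w v k n f : homog w n f -> homog w n (comp v k f).
Proof. by move=> fn m mn; rewrite /comp fn // if_same. Qed.

Lemma std_homog_ge k f : homog stddeg k f -> std_ge k f.
Proof. by move=> fk m mk; apply: fk => mE; rewrite mE ltnn in mk. Qed.

(** The lowest component of a closed element is closed for the Koszul
    differential. *)
Lemma lowest_exact p d m a : homog superdeg p.+1 a -> homog stddeg d.+2 a ->
  fil m a -> D1 a = 0 ->
  exists c, [/\ homog superdeg p c, homog stddeg d.+1 c, homog ulen m.+1 c &
                comp ulen m a = delta c].
Proof.
move=> ap ad am a1; exists (icnt (kappa (comp ulen m a))); split.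
- exact/icnt_homog/kappa_super/comp_homog.
- exact/icnt_homog/kappa_std/comp_homog.
- exact/icnt_homog/kappa_ulen/homog_comp.
apply: delta_exact.
  by apply: (std_geW (k := d.+2)) => //; apply: std_homog_ge; exact: comp_homog.
case: m am => [|m] am; first by apply: delta_ulen0; exact: homog_comp.
have := comp_D1 m a; rewrite a1 (lin0 (comp_lin _ _)) ((filE _ _).1 am m (ltnSn m)).
by rewrite (lin0 (sder_lin (sder_d_u R 0))) mulr0 addr0 => <-.
Qed.

(** The lowest component is removed by a coboundary, repeatedly. The process
    stops because a monomial of standard degree k has at most k jet variables. *)
Lemma d1_exact p d a : homog superdeg p.+1 a -> homog stddeg d.+2 a -> D1 a = 0 ->
  exists c, [/\ homog superdeg p c, homog stddeg d.+1 c & a = D1 c].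
Proof.
have D1B := linB (sder_lin (sder_D1 R)); have D1D := linD (sder_lin (sder_D1 R)).
suff H n m : (m + n)%N = d.+3 -> forall a, homog superdeg p.+1 a ->
    homog stddeg d.+2 a -> fil m a -> D1 a = 0 ->
    exists c, [/\ homog superdeg p c, homog stddeg d.+1 c & a = D1 c].
  by move=> ap ad a1; apply: (H d.+3 0%N).
elim: n m => [|n IH] m mn {}a ap ad am a1.
  exists 0; split; [exact: homog0|exact: homog0|].
  by rewrite (lin0 (sder_lin (sder_D1 R))); apply: (fil_std _ ad); rewrite -mn addn0.
have [c [cp cd cm ac]] := lowest_exact ap ad am a1.
have [|||||e [ep ed eE]] := IH m.+1 _ (a - D1 c).
- by rewrite addSnnS.
- by apply: homogB => //; exact: D1_super.
- by apply: homogB => //; exact: D1_std.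
- have c0 i : (i < m.+1)%N -> comp ulen i c = 0.
    by move=> im; apply: (comp_homog_neq cm) => mi; rewrite mi ltnn in im.
  apply/filE => i; rewrite ltnS (linB (comp_lin ulen i)) comp_D1 => im.
  rewrite (c0 i) ?ltnS // (lin0 (sder_lin (sder_d_u R 0))) mulr0 addr0.
  move: im; rewrite leq_eqVlt => /orP[/eqP ->|im].
    by rewrite ac (comp_id cm) subrr.
  by rewrite ((filE _ _).1 am) // c0 // (lin0 (sder_lin (sder_delta R))) subrr.
- by rewrite D1B a1 D1D1 subrr.
exists (c + e); split; [exact: homogD|exact: homogD|].
by rewrite D1D -eE addrC subrK.
Qed.

(** The lowest component of a is the Koszul coboundary of some c. By the
    anticommutation relation, the derivative of c along theta^1 yields b with
    the correct lowest component of D2 (D1 b), up to the weight m + (d - p) /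
    2; the hypothesis makes this weight nonzero at each step. *)
Lemma bh_exact p d m a : homog superdeg p.+2 a -> homog stddeg d.+2 a -> fil m a ->
  (forall k, (m <= k)%N -> (k.*2 + d)%N != p) -> D1 a = 0 -> D2 a = 0 ->
  exists b, [/\ homog superdeg p b, homog stddeg d b & a = D2 (D1 b)].
Proof.
have [D1B D2B] := (linB (sder_lin (sder_D1 R)), linB (sder_lin (sder_D2 R))).
have [D1D D2D] := (linD (sder_lin (sder_D1 R)), linD (sder_lin (sder_D2 R))).
have [D10 D20] := (lin0 (sder_lin (sder_D1 R)), lin0 (sder_lin (sder_D2 R))).
have [dl0 i0] := (lin0 (sder_lin (sder_delta R)), lin0 (sder_lin (sder_d_th R 1))).
suff H n : forall m, (d.+3 <= m + n)%N -> forall a, homog superdeg p.+2 a ->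
    homog stddeg d.+2 a -> fil m a -> (forall k, (m <= k)%N -> (k.*2 + d)%N != p) ->
    D1 a = 0 -> D2 a = 0 ->
    exists b, [/\ homog superdeg p b, homog stddeg d b & a = D2 (D1 b)].
  by move=> ap ad am; apply: (H d.+3 m) => //; exact: leq_addl.
elim: n => [|n IH] {}m mn {}a ap ad am wm a1 a2.
  exists 0; split; [exact: homog0|exact: homog0|].
  rewrite D10 D20; apply: (fil_std _ ad).
  by apply: filW am; rewrite -[m]addn0.
have [c [cp cd cm ac]] := lowest_exact ap ad am a1.
set wt : R := m%:R + 2^-1 * (d.+2%:R - p.+2%:R).
(* twice the weight is the difference of the two numbers separated by wm *)
have wt0 : wt != 0.
  apply: contra (wm m (leqnn m)) => /eqP wt0.
  rewrite -(eqr_nat R) natrD -muln2 natrM -subr_eq0; apply/eqP.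
  have := congr1 ( *%R 2) wt0; rewrite mulr0 /wt mulrDr mulrA mulfV ?pnatr_eq0 //.
  rewrite mul1r -[d.+2]addn2 -[p.+2]addn2 !natrD => <-.
  by rewrite opprD addrACA subrr addr0 mulrC addrA.
set b := - (wt^-1 *: iota1 c).
have bp : homog superdeg p b.
  apply/homogN/homogZ; rewrite superdegF.
  by apply: (@homog_d_th R (fun=> 0%N) (fun=> 1%N)); rewrite -superdegF.
have bd : homog stddeg d b.
  by apply/homogN/homogZ; apply: (@homog_d_th R succn id).
have bm : homog ulen m.+1 b.
  by apply/homogN/homogZ; apply: (@homog_d_th R (fun=> 1%N) (fun=> 0%N)).
have db : delta b = wt^-1 *: iota1 (comp ulen m a).
  rewrite /b (linN (sder_lin (sder_delta R))) (linZ (sder_lin (sder_delta R))).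
  by rewrite delta_iota1 scalerN opprK ac.
have D2E f : D2 f = u 0 * D1 f + DP f by rewrite /DP; zmodule.
have fD1b : fil m (D1 b).
  apply/filE => i im; rewrite comp_D1 (comp_homog_neq bm) ?dl0 ?add0r.
    by rewrite (comp_homog_neq bm) ?(lin0 (sder_lin (sder_d_u R 0))) ?mulr0 //;
      move=> mi; rewrite -mi ltnNge leqnSn in im.
  by move=> [mi]; rewrite mi ltnn in im.
have DPm : comp ulen m (D2 (D1 b)) = comp ulen m a.
  rewrite D2E D1D1 mulr0 add0r comp_DP // comp_D1 (comp_id bm).
  rewrite (comp_homog_neq (k := m) bm); last by move/eqP; rewrite eqn_leq ltnn.
  rewrite (lin0 (sder_lin (sder_d_u R 0))) mulr0 addr0 db.
  rewrite (linZ (sder_lin sder_DP)) (linZ (comp_lin ulen m)).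
  have -> : DP (iota1 (comp ulen m a)) =
      wt *: comp ulen m a - iota1 (DP (comp ulen m a)).
    have := DP_iota1 (comp ulen m a).
    rewrite (wop_homog (@homog_comp R ulen m a)
      (comp_homog ulen m ad) (comp_homog ulen m ap)).
    by rewrite -/wt => <-; zmodule.
  rewrite (linB (comp_lin ulen m)) (linZ (comp_lin ulen m)).
  rewrite (comp_id (@homog_comp R ulen m a)).
  have -> : comp ulen m (iota1 (DP (comp ulen m a))) = 0.
    have E : forall f, comp ulen m (iota1 f) = iota1 (comp ulen m f).
      rewrite -{1}[m]addn0.
      apply: (comp_shift (sder_lin (sder_d_th R 1)) (sder_cont (sder_d_th R 1))).
      move=> k f fk; rewrite addn0; exact: (@homog_d_th R (fun=> 1%N) (fun=> 0%N)).
    rewrite E -comp_DP //; have : DP a = 0 by rewrite /DP a1 a2 mulr0 subrr.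
    by move=> ->; rewrite (lin0 (comp_lin _ _)) /iota1 i0.
  by rewrite subr0 scalerA mulVf // scale1r.
have [|||||||e [ep ed eE]] := IH m.+1 _ (a - D2 (D1 b)).
- by rewrite addSnnS.
- by apply: homogB => //; apply/D2_super/D1_super.
- by apply: homogB => //; apply/D2_std/D1_std.
- have f2 : fil m (D2 (D1 b)).
    by rewrite D2E D1D1 mulr0 add0r; exact: fil_DP.
  apply/filE => i; rewrite ltnS (linB (comp_lin ulen i)) leq_eqVlt => /orP[/eqP ->|im].
    by rewrite DPm subrr.
  by rewrite ((filE _ _).1 am) // ((filE _ _).1 f2) // subrr.
- by move=> k mk; apply: wm; exact: ltnW.
- by rewrite D1B a1 D1D2 D1D1 D20 oppr0 subrr.
- by rewrite D2B a2 D2D2 subrr.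
exists (b + e); split; [exact: homogD|exact: homogD|].
by rewrite D1D D2D -eE addrC subrK.
Qed.

(** * The total derivative is injective modulo constants *)

(** Descending induction on s: the commutators with the total derivative
    express the derivatives along u^s and theta^s through those along u^(s+1)
    and theta^(s+1), and these vanish for large s. *)
Lemma Dx_inj p k f : homog superdeg p f -> homog stddeg k f -> (0 < k)%N -> Dx f = 0 -> f = 0.
Proof.
move=> fp fk k0 f0.
have dth s : dt s f = 0.
  have dt_big t : (k < t)%N -> dt t f = 0.
    by move=> kt; exact: (@homog_d_th_lt R succn id t k).
  have [n sn] : exists n, (k < s + n)%N by exists k.+1; rewrite addnS ltnS leq_addl.
  elim: n s sn => [|n IH] s sn; first by apply: dt_big; rewrite -[s]addn0.
  have := d_th_dx s f; rewrite f0 (lin0 (@d_th_lin R _)) IH ?dx0 ?add0r //.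
  by rewrite addSnnS.
have dus s : du s f = 0.
  have du_big t : (k < t)%N -> du t f = 0.
    by case: t => // t kt; exact: (@homog_d_u_lt R succn id t.+1 k).
  have [n sn] : exists n, (k < s + n)%N by exists k.+1; rewrite addnS ltnS leq_addl.
  elim: n s sn => [|n IH] s sn; first by apply: du_big; rewrite -[s]addn0.
  have := d_u_dx s f; rewrite f0 (lin0 (@d_u_lin R _)) IH ?dx0 ?add0r //.
  by rewrite addSnnS.
apply/funext => -[M T]; have [TE|[s sT]] := fset_0Vmem T; last first.
  have := congr1 (fun f : A => f (M, (T `\ s)%fset)) (dth s).
  rewrite d_thE /= !inE eqxx /= fsetD1K // -signZ => /eqP.
  by rewrite scaler_eq0 signr_eq0 /= => /eqP.
have [ME|[s sM]] := mset_0Vmem M; last first.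
  have := congr1 (fun f : A => f ((M `\ s)%mset, T)) (dus s.+1).
  rewrite d_uE /= msetB1K // -scaler_nat => /eqP.
  by rewrite scaler_eq0 pnatr_eq0 /= => /eqP.
apply: fk; rewrite ME TE stddegE wt_mon1 => /esym k0'.
by rewrite k0' in k0.
Qed.

End Cohomology.

Section Functionals.
Variable R : realType.
Local Notation A := (Ahat R).
Local Notation u := (uv R).
Local Notation th := (tv R).
Local Notation D1 := (@D1 R).
Local Notation D2 := (@D2 R).
Local Notation DP := (@DP R).
Implicit Types (a b c f g h x y z : A) (r : R) (s t k n p d : nat) (m : monomial).

(** * Low degrees *)

Lemma sum_mem_fset (T : {fset nat}%fset) i : (\sum_(j <- T) (j == i) = (i \in T))%N.
Proof.
rewrite -big_mkcond /= sum1_count (eq_count (a2 := pred1 i)) //.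
by rewrite (count_uniq_mem _ (fset_uniq _)).
Qed.

(** Odd variables occur at most once, so that many of them need a large
    standard degree. *)
Lemma super_std_bound m :
  (2 * superdeg m <= stddeg m + 2 * (0%N \in m.2) + (1%N \in m.2))%N.
Proof.
rewrite superdegE stddegE /wt big1 // add0n -!(sum_mem_fset m.2) !big_distrr /=.
rewrite -!addnA -!big_split /= (leq_trans _ (leq_addl _ _)) //.
by apply: leq_sum => -[|[|j]] _.
Qed.

Lemma super_std_bound3 m : (2 * superdeg m <= stddeg m + 3)%N.
Proof.
apply: (leq_trans (super_std_bound m)); rewrite -addnA leq_add2l.
by case: (_ \in _); case: (_ \in _).
Qed.

Lemma low_zero p k f : homog superdeg p f -> homog stddeg k f ->
  (k + 3 < 2 * p)%N -> f = 0.
Proof.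
move=> fp fk kp; apply/funext => m.
have [mp|/eqP/fp//] := eqVneq (superdeg m) p.
have [mk|/eqP/fk//] := eqVneq (stddeg m) k.
by move: kp; rewrite -mp -mk ltnNge super_std_bound3.
Qed.

Lemma ulen0 m : (ulen m < 1)%N -> m = (mset0, m.2).
Proof.
case: m => M T; rewrite ltnS leqn0 ulenE /= size_mset_eq0 => /eqP ->.
by [].
Qed.

Lemma fil1_super0 k f : homog superdeg 0 f -> homog stddeg k.+1 f -> fil 1 f.
Proof.
move=> f0 fk [M T] /ulen0 [->]; have [TE|TN] := eqVneq (superdeg (mset0, T)) 0%N.
  apply: fk; have -> : T = fset0 by apply/eqP; rewrite -cardfs_eq0 -/(superdeg (mset0, T)) TE.
  by rewrite stddegE wt_mon1.
by apply: f0; exact/eqP.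
Qed.

Lemma superdeg_fset1 (T : {fset nat}%fset) : superdeg (mset0, T) = 1%N ->
  exists j, T = [fset j]%fset.
Proof. by move=> /eqP; rewrite /superdeg /= => /cardfs1P[j TE]; exists j. Qed.

Lemma stddeg_fset (T : {fset nat}%fset) : stddeg (mset0, T) = (\sum_(j <- T) j)%N.
Proof. by rewrite stddegE /wt /= big_mset0 add0n. Qed.

(** Without jet variables, a bivector of standard degree 2 is a multiple of
    theta theta^2. *)
Lemma iota1_22 f : homog superdeg 2 f -> homog stddeg 2 f ->
  dt 1 (comp ulen 0 f) = 0.
Proof.
move=> f2 fk; apply/funext => -[M T]; rewrite d_thE /=; case: ifPn => // T1.
rewrite /comp; case: eqP => [mu|_]; last by rewrite mulr0.
have ME : M = mset0.
  by move/eqP: mu; rewrite ulenE /= size_mset_eq0 => /eqP.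
have [sE|/eqP sN] := eqVneq (superdeg (M, (1 |` T)%fset)) 2; last first.
  by rewrite f2 ?mulr0.
rewrite fk ?mulr0 // ME stddeg_fset big_fsetU1 //= => -[]; rewrite ?add0n => T2.
have : superdeg (mset0, T) = 1%N by move: sE; rewrite /superdeg /= cardfsU1 T1 => -[].
move=> /superdeg_fset1[j TE]; move: T2 T1; rewrite TE big_seq_fset1 => ->.
by rewrite inE eqxx.
Qed.

(** The only such product is theta theta^1 theta^2. *)
Lemma fset_33 (T : {fset nat}%fset) : superdeg (mset0, T) = 3%N ->
  stddeg (mset0, T) = 3%N -> (1%N \in T) && (2%N \in T).
Proof.
move=> T3 S3; have super_std := super_std_bound (mset0, T); rewrite T3 S3 /= in super_std.
have T0 : 0%N \in T.
  by move: super_std; case: (0%N \in T); case: (1%N \in T).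
have T1 : 1%N \in T by move: super_std; rewrite T0; case: (1%N \in T).
move: T3 S3; rewrite stddeg_fset /superdeg /= (cardfsD1 0%N) T0 (cardfsD1 1%N).
rewrite (big_fsetD1 _ T0) /= !inE T1 /= (big_fsetD1 1%N) /= ?inE ?T1 //.
rewrite !add1n !add0n => -[Tc] [Ts].
have [j TE] := superdeg_fset1 (T := ((T `\ 0) `\ 1)%fset) Tc.
move: Ts; rewrite TE big_seq_fset1 => jE.
have : 2%N \in ((T `\ 0) `\ 1)%fset by rewrite TE inE jE.
by rewrite !inE => /and3P[].
Qed.

Lemma fil1_33 s f : homog superdeg 3 f -> homog stddeg 3 f -> (s == 1%N) || (s == 2) ->
  fil 1 (dt s f) -> fil 1 f.
Proof.
move=> f3 fk s12 fs [M T] /ulen0 [->].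
have [T3|/eqP/f3//] := eqVneq (superdeg (mset0, T)) 3%N.
have [S3|/eqP/fk//] := eqVneq (stddeg (mset0, T)) 3%N.
have sT : s \in T by have /andP[] := fset_33 T3 S3; case/orP: s12 => /eqP ->.
have := fs (mset0, (T `\ s)%fset).
rewrite ulenE /= enum_mset0 /= => /(_ isT).
rewrite d_thE /= !inE eqxx /= fsetD1K // -signZ => /eqP.
by rewrite scaler_eq0 signr_eq0 /= => /eqP.
Qed.

(** * Euler's formula *)

(** Scaling theta counts the odd variables. *)
Lemma Ev_euler p f : homog superdeg p f -> Ev 0 (th 0) f = p%:R *: f.
Proof.
move=> fp; rewrite -(cnt_homog fp); move: f {fp}.
have sc : sder false (@cnt R superdeg) by rewrite superdegF; exact: sder_cnt.
have it s : iter s (@Dx R) (th 0) = th s by elim: s => //= s ->; rewrite dx_thvar.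
apply: (sder_ext (sder_Ev (@par0 R false) (par_thvar R 0)) sc) => [a|s|s].
- by rewrite Ev_cf mul0r (cnt_homog (@cf_super R a)) scale0r.
- by rewrite Ev_uv iter_Dx0 (cnt_homog (@u_super R _)) scale0r.
- by rewrite Ev_tv it (cnt_homog (@th_super R _)) scale1r.
Qed.

Lemma euler p f : homog superdeg p f -> ieq (p%:R *: f) (th 0 * vt f).
Proof.
move=> fp; rewrite -(Ev_euler fp); apply: (ieq_trans (Ev_parts _ _ _)).
by rewrite mul0r add0r; exact: ieq_refl.
Qed.

Lemma euler1 f : homog superdeg 1 f -> ieq f (th 0 * vt f).
Proof. by move/euler; rewrite scale1r. Qed.

Lemma euler2 f : homog superdeg 2 f -> ieq f (2^-1 *: (th 0 * vt f)).
Proof.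
by move=> /euler/(ieqZ 2^-1); rewrite scalerA mulVf ?scale1r.
Qed.

(** * Exactness for functionals *)

Lemma D1_ieq f g : ieq f g -> ieq (D1 f) (D1 g).
Proof. by apply: (@Ev_ieq R true); [exact: par_thvar|exact: par0]. Qed.

Lemma D2_ieq f g : ieq f g -> ieq (D2 f) (D2 g).
Proof. by apply: (@Ev_ieq R true); [exact: par_w2|exact: par_z2]. Qed.

Lemma ieq0_homog p k f : homog superdeg p f -> homog stddeg k.+1 f -> ieq f 0 ->
  exists h, [/\ homog superdeg p h, homog stddeg k h & f = Dx h].
Proof.
move=> fp fk; rewrite /ieq subr0 => /dx_imageP[h fh].
exists (comp superdeg p (comp stddeg k h)); split.
- exact: homog_comp.
- by apply: comp_homog; exact: homog_comp.
- by rewrite -comp_super_Dx -comp_stdS_Dx -fh (comp_id fk) (comp_id fp).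
Qed.

(** If D1 a = Dx b, then b is closed since the total derivative is injective,
    hence b = D1 c by exactness; then a - Dx c is closed. *)
Lemma closed_density p d a : homog superdeg p a -> homog stddeg d.+2 a ->
  ieq (D1 a) 0 -> exists c, [/\ homog superdeg p c, homog stddeg d.+1 c &
    D1 (a - Dx c) = 0].
Proof.
move=> ap ad /(ieq0_homog (D1_super ap) (D1_std ad))[b [bp bd ab]].
have b1 : D1 b = 0.
  by apply: (Dx_inj (D1_super bp) (D1_std bd)) => //; rewrite -D1_Dx -ab D1D1.
have [c [cp cd bc]] := d1_exact bp bd b1; exists c; split=> //.
by rewrite (linB (sder_lin (sder_D1 R))) ab bc D1_Dx subrr.
Qed.

Lemma ieq_subDx a c : ieq a (a - Dx c).
Proof. by rewrite /ieq subKr Dx_image. Qed.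

Lemma d1_exact_functional p d a : homog superdeg p.+1 a -> homog stddeg d.+2 a ->
  ieq (D1 a) 0 -> exists c, [/\ homog superdeg p c, homog stddeg d.+1 c & ieq a (D1 c)].
Proof.
move=> ap ad a1; have [c [cp cd ac]] := closed_density ap ad a1.
have [||e [ep ed eE]] := d1_exact (p := p) (d := d) _ _ ac.
- by apply: homogB ap _; exact: Dx_super.
- by apply: homogB ad _; exact: Dx_std.
- by exists e; split=> //; rewrite -eE; exact: ieq_subDx.
Qed.

(** If D2 a = Dx b, then b is a common cocycle, hence b = D2 (D1 e). Therefore
    a - Dx (D1 e) is a common cocycle as well, so of the form D2 (D1 f). *)
Lemma bh_functional p d i a b : homog superdeg p.+2 a -> homog stddeg d.+2 a ->
  homog superdeg p.+3 b -> homog stddeg d.+2 b ->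
  fil i b -> (forall k, (i <= k)%N -> (k.*2 + d)%N != p.+1) ->
  (forall k, (k.*2 + d)%N != p) ->
  D1 a = 0 -> D2 a = Dx b ->
  exists z, [/\ homog superdeg p.+1 z, homog stddeg d.+1 z, D1 z = 0 & ieq a (D2 z)].
Proof.
move=> ap ad bp bd bm mb mp a1 a2.
have b1 : D1 b = 0.
  apply: (Dx_inj (D1_super bp) (D1_std bd)) => //.
  by rewrite -D1_Dx -a2 D1D2 a1 (lin0 (sder_lin (sder_D2 R))) oppr0.
have b2 : D2 b = 0.
  by apply: (Dx_inj (D2_super bp) (D2_std bd)) => //; rewrite -D2_Dx -a2 D2D2.
have [e [ep ed be]] := bh_exact bp bd bm mb b1 b2.
have [|||||| f [fp fd af]] := bh_exact (p := p) (d := d) (m := 0) (a := a - Dx (D1 e)).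
- by apply: homogB ap _; apply/Dx_super/D1_super.
- by apply: homogB ad _; apply/Dx_std/D1_std.
- exact: fil0.
- by move=> k _; exact: mp.
- by rewrite (linB (sder_lin (sder_D1 R))) a1 D1_Dx D1D1 dx0 subrr.
- by rewrite (linB (sder_lin (sder_D2 R))) a2 D2_Dx be subrr.
exists (D1 f); split; [exact: D1_super|exact: D1_std|exact: D1D1|].
by rewrite -af; exact: ieq_subDx.
Qed.

End Functionals.

Section Bivectors.
Variable R : realType.
Local Notation A := (Ahat R).
Local Notation u := (uv R).
Local Notation th := (tv R).
Local Notation D1 := (@D1 R).
Local Notation D2 := (@D2 R).
Local Notation DP := (@DP R).
Implicit Types (a b c f g h x y z : A) (r : R) (s t k n p d : nat).

Lemma std_geB k f g : std_ge k f -> std_ge k g -> std_ge k (f - g).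
Proof. by move=> fk gk m mk; rewrite ahatBE fk ?gk ?subr0. Qed.

Lemma eqto_geP k f g : eqto k f g <-> std_ge k.+1 (f - g).
Proof.
split=> fg m mk; first by rewrite ahatBE fg ?subrr.
by apply/eqP; rewrite -subr_eq0 -ahatBE fg.
Qed.

Lemma std_ge_dt k s f : std_ge k f -> std_ge (k - s) (dt s f).
Proof.
move=> fk m mk; rewrite d_thE; case: ifPn => // sm.
by rewrite fk ?mulr0 // stddeg_th // -ltn_subRL.
Qed.

Lemma std_ge_du s k f : std_ge k f -> std_ge (k - s) (du s f).
Proof.
move=> fk m mk; case: s mk => [|s] mk.
  by rewrite d_u0E fk ?Cderiv0 //; rewrite subn0 in mk.
by rewrite d_uE fk ?mul0rn // stddeg_u -ltn_subRL.
Qed.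

Lemma std_ge_asum k (F : nat -> A) : (forall s, std_ge k (F s)) -> std_ge k (asum F).
Proof. by move=> Fk m mk; rewrite /asum big1 // => s _; exact: Fk. Qed.

Lemma vt_ge k f : std_ge k f -> std_ge k (vt f).
Proof.
move=> fk; rewrite vtE; apply: std_ge_asum => s; apply: std_geZ.
by apply: (@std_geW R (k - s + s) k); [rewrite addnC -leq_subLR|apply/std_ge_iter/std_ge_dt].
Qed.

Lemma vu_ge k f : std_ge k f -> std_ge k (vu f).
Proof.
move=> fk; rewrite vuE; apply: std_ge_asum => s; apply: std_geZ.
by apply: (@std_geW R (k - s + s) k); [rewrite addnC -leq_subLR|apply/std_ge_iter/std_ge_du].
Qed.

Lemma vt_comp k f : comp stddeg k (vt f) = vt (comp stddeg k f).
Proof.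
rewrite -[k in LHS]addn0; apply: (comp_shift (@vt_lin R)).
  by move=> n; exists n => g /std_geP g0; apply/std_geP; apply: (@vt_ge n.+1).
by move=> n g gn; rewrite addn0; exact: vt_std.
Qed.

Lemma vu_comp k f : comp stddeg k (vu f) = vu (comp stddeg k f).
Proof.
rewrite -[k in LHS]addn0; apply: (comp_shift (@vu_lin R)).
  by move=> n; exists n => g /std_geP g0; apply/std_geP; apply: (@vu_ge n.+1).
by move=> n g gn; rewrite addn0; exact: vu_std.
Qed.

(** * The coefficient of theta^3 *)

(** For a bivector of standard degree 3, the coefficient of the third
    derivative in the corresponding Hamiltonian operator. *)
Definition alpha f : Cinf R := vt f (mset0, [fset 3]%fset).

Lemma alpha_lin r f g : alpha (r *: f + g) = r *: alpha f + alpha g.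
Proof. by rewrite /alpha vt_lin ahatDE ahatZE. Qed.

Lemma alphaB f g : alpha (f - g) = alpha f - alpha g.
Proof. by rewrite /alpha (linB (@vt_lin R)) ahatBE. Qed.

Lemma alphaD f g : alpha (f + g) = alpha f + alpha g.
Proof. by rewrite /alpha (linD (@vt_lin R)) ahatDE. Qed.

Lemma alpha_ieq f g : ieq f g -> alpha f = alpha g.
Proof. by rewrite /alpha => /vt_ieq ->. Qed.

Lemma theta3_std : stddeg (mset0, [fset 3]%fset) = 3%N.
Proof. by rewrite stddeg_fset big_seq_fset1. Qed.

Lemma alpha_comp f : alpha f = alpha (comp stddeg 3 f).
Proof. by rewrite /alpha -vt_comp /comp theta3_std. Qed.

Lemma alpha_ge f : std_ge 4 f -> alpha f = 0.
Proof. by move=> /vt_ge; apply; rewrite theta3_std. Qed.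

Lemma fil_vt k f : fil k f -> fil k (vt f).
Proof.
move=> fk; rewrite vtE; apply: fil_asum => s; apply: filZ.
by elim: s {-2}s (fil_dt s fk) => [//|s IH] t ft /=; apply/fil_Dx/IH.
Qed.

Lemma alpha_fil f : fil 1 f -> alpha f = 0.
Proof.
by move=> /fil_vt; apply; rewrite ulenE /= enum_mset0.
Qed.

(** Differentiating the factor u creates a jet variable. *)
Lemma iter_Dx_u0 s f : fil 1 (iter s (@Dx R) (u 0 * f) - u 0 * iter s (@Dx R) f).
Proof.
elim: s => [|s IH] /=; first by rewrite subrr.
set X := iter s _ (_ * _) in IH *; set Y := iter s _ f in IH *.
have -> : Dx X - u 0 * Dx Y = Dx (X - u 0 * Y) + u 1 * Y.
  by rewrite dxD dxN dxM dx_uvar; zmodule.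
by apply: filD; [exact: fil_Dx|apply: filMl; exact: fil_uS].
Qed.

Lemma alpha_u0 f : alpha (u 0 * f) = Cid R * alpha f.
Proof.
rewrite /alpha; set m := (mset0, _); rewrite -coefM -uv0.
apply/eqP; rewrite -subr_eq0 -ahatBE; apply/eqP.
suff : fil 1 (vt (u 0 * f) - u 0 * vt f) by apply; rewrite ulenE /= enum_mset0.
rewrite !vtE => x xu; have [k xk] : exists k, (stddeg x < k)%N by exists (stddeg x).+1.
have H (X : nat -> A) := asumE (summable_var X) xk.
rewrite ahatBE (H (fun s => dt s (u 0 * f))) // {2}uv0 coefM.
rewrite (H (fun s => dt s f)) // -coefM -uv0 -ahatBE mulr_sumr -sumrB.
rewrite ahat_sumE big1 // => s _.
have -> : dt s (u 0 * f) = u 0 * dt s f.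
  by rewrite (sder_leib (sder_d_th R s)) d_th_uvar mul0r add0r sg_uvar.
rewrite -scalerAr -scalerBr; exact: (filZ _ (iter_Dx_u0 s _)).
Qed.

(** Up to a total derivative, z is theta times an element of which every term
    contains a jet variable. On such elements D2 is u D1 modulo terms with jet
    variables, to which [alpha] is blind. *)
Lemma alpha_D2 k z : homog superdeg 1 z -> homog stddeg k.+1 z ->
  alpha (D2 z) = Cid R * alpha (D1 z).
Proof.
move=> z1 zk; have zE := euler1 z1; set z' := th 0 * vt z in zE.
have z'f : fil 1 z' by apply/filMr/(@fil1_super0 _ k); [exact: vt_super|exact: vt_std].
rewrite (alpha_ieq (D1_ieq zE)) (alpha_ieq (D2_ieq zE)) -alpha_u0.
have -> : D2 z' = u 0 * D1 z' + DP z' by rewrite /DP; zmodule.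
by rewrite alphaD (alpha_fil (fil_DP z'f)) addr0.
Qed.

(** * Bivectors of standard degree 2 and 3 *)

Lemma degree1_function f : homog superdeg 0 f -> homog stddeg 1 f ->
  exists a : Cinf R, f = cf a * u 1.
Proof.
move=> f0 f1; exists (f ([mset 0]%mset, fset0)); apply/funext => -[M T].
rewrite coefM -uvE /uvar amonomE; case: eqP => [->|mN]; first by rewrite mulr1.
rewrite mulr0; have [/eqP TE|/eqP/f0//] := eqVneq (superdeg (M, T)) 0%N.
have {TE} TE : T = fset0 by apply/eqP; rewrite -cardfs_eq0.
apply: f1; rewrite TE stddegE /wt /= big_seq_fset0 addn0 => M1; apply: mN.
rewrite TE; congr pair; have [M0|[s sM]] := mset_0Vmem M.
  by move: M1; rewrite M0 big_mset0.
move: M1; rewrite -(msetB1K sM) (perm_big _ (perm_msetD _ _)) big_cat /=.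
rewrite enum_msetn; case: s sM => [|s] sM //; last by rewrite big_seq1.
have [E|[s sM']] := mset_0Vmem (M `\ 0%N)%mset.
  by move=> _; rewrite E msetD0.
rewrite -(msetB1K sM') (perm_big _ (perm_msetD _ _)) big_cat /=.
by rewrite enum_msetn !big_seq1.
Qed.

Lemma cfC (a : Cinf R) f : cf a * f = f * cf a.
Proof. by apply: mulC_even; exact: par_cf. Qed.

(** In this degree the weight in [bh_exact] vanishes, but the primitive for
    the first differential is a multiple of theta b(u) u^1, whose coboundary
    is visibly a total derivative. *)
Lemma bivector_degree2 a : homog superdeg 2 a -> homog stddeg 2 a -> ieq (D1 a) 0 ->
  ieq a 0.
Proof.
move=> a2 ak a1; have [c [c1 ck ac]] := d1_exact_functional a2 ak a1.
have [b vb] := degree1_function (vt_super c1) (vt_std ck).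
apply: (ieq_trans ac); apply: (ieq_trans (D1_ieq (euler1 c1))).
rewrite vb (_ : D1 _ = - Dx (cf b * (th 0 * th 1))).
  by rewrite -dxN; exact: ieq_Dx.
rewrite !(sder_leib (sder_D1 R)) D1_th mul0r add0r D1_u !dxM dx_coef !dx_thvar.
rewrite D1_cf sg_coef sg_thvar scaleN1r tv2 add0r mulNr mulrDr.
have -> : th 0 * (th 1 * cf (Cderiv b) * u 1) = u 1 * cf (Cderiv b) * (th 0 * th 1).
  by rewrite -[u 1 * _ * _]mulrA uvC cfC !mulrA.
by have -> : th 0 * (cf b * th 2) = cf b * (th 0 * th 2) by rewrite mulrA -cfC mulrA.
Qed.

(** The weight in [bh_exact] vanishes on the part of b without jet variables,
    so that this part has to be excluded. Since [alpha] vanishes at a, Euler's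
    formula writes a as the total derivative of some c modulo jet variables.
    As a is closed, Dx b agrees with the total derivative of DP c modulo jet
    variables. The relation between DP and the derivative along theta^1 shows
    that DP c has jet variables, because c has weight zero. So Dx b, and then
    b, has jet variables. *)
Lemma bivector_degree3 a b : homog superdeg 2 a -> homog stddeg 3 a -> D1 a = 0 ->
  alpha a = 0 -> homog superdeg 3 b -> homog stddeg 3 b -> D2 a = Dx b -> fil 1 b.
Proof.
move=> a2 ak a1 a0 bp bk ab.
set a' := 2^-1 *: (th 0 * vt a).
have va : fil 1 (vt a).
  move=> [M T] /ulen0[->].
  have [T1|/eqP/(vt_super a2)//] := eqVneq (superdeg (mset0, T)) 1%N.
  have [j TE] := superdeg_fset1 T1.
  have [S3|/eqP/(vt_std ak)//] := eqVneq (stddeg (mset0, T)) 3%N.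
  by move: S3 a0; rewrite stddeg_fset TE big_seq_fset1 => ->.
have fa' : fil 1 a' by apply/filZ/filMr.
have a'2 : homog superdeg 2 a' by apply/homogZ/(@superM _ 1 1); [exact: th_super|exact: vt_super].
have a'k : homog stddeg 3 a' by apply/homogZ/(@stdM _ 0 3); [exact: th_std|exact: vt_std].
have [c [c2 ck cE]] : exists c, [/\ homog superdeg 2 c, homog stddeg 2 c & a - a' = Dx c].
  apply: ieq0_homog; [exact: homogB|exact: homogB|].
  by have := ieqB (euler2 a2) (ieq_refl a'); rewrite subrr.
have DPc : fil 1 (DP c).
  apply: (@fil1_33 _ 1); [..|done|].
  - by rewrite /DP; apply: homogB; [exact: D2_super|
      apply: (@superM _ 0 3); [exact: u_super|exact: D1_super]].
  - by rewrite /DP; apply: homogB; [exact: D2_std|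
      apply: (@stdM _ 0 3); [exact: u_std|exact: D1_std]].
  have := DP_iota1 (comp ulen 0 c).
  rewrite (wop_homog (@homog_comp R ulen 0 c) (comp_homog ulen 0 ck) (comp_homog ulen 0 c2)).
  rewrite subrr mulr0 addr0 scale0r /iota1 (iota1_22 c2 ck) (lin0 (sder_lin (sder_DP R))) add0r => d0.
  rewrite -[c](subrK (comp ulen 0 c)) (linD (sder_lin (sder_DP R))) (linD (@d_th_lin R 1)) d0 addr0.
  by apply/fil_dt/fil_DP/fil_comp.
have Dxb : fil 1 (Dx b).
  have -> : Dx b = DP a' + (Dx (DP c) + u 1 * D1 c).
    rewrite -ab; have -> : D2 a = DP a by rewrite /DP a1 mulr0 subr0.
    rewrite -[a in LHS](subrK a') cE (linD (sder_lin (sder_DP R))) addrC; congr (_ + _).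
    by rewrite /DP D2_Dx D1_Dx dxD dxN dxM dx_uvar; zmodule.
  apply: filD; first exact: fil_DP.
  by apply: filD; [exact: fil_Dx|apply: filMl; exact: fil_uS].
apply: (@fil1_33 _ 2) => //.
have := d_th_dx 2 b; have -> : dt 3 b = 0.
  apply: (@low_zero _ 2 0) => //; first by rewrite superdegF in bp *; exact: (@homog_d_th R (fun=> 0%N) (fun=> 1%N)).
  exact: (@homog_d_th R succn id).
by rewrite dx0 add0r => <-; exact: fil_dt.
Qed.

(** * Bihamiltonian cohomology in the relevant degrees *)

(** The weights in [bh_exact] vanish only in standard degrees 2 and 3, which
    have been treated separately. *)
Lemma bivector_closed_D2 d f : homog superdeg 2 f -> homog stddeg d.+2 f ->
  (d = 1%N -> alpha f = 0) -> ieq (D1 f) 0 -> ieq (D2 f) 0 ->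
  exists z, [/\ homog superdeg 1 z, homog stddeg d.+1 z, D1 z = 0 & ieq f (D2 z)].
Proof.
move=> f2 fk fa f10 f20; case: d => [|d] in fk fa *.
  exists 0; split; [exact: homog0|exact: homog0| |].
    by rewrite (lin0 (sder_lin (sder_D1 R))).
  by rewrite (lin0 (sder_lin (sder_D2 R))); exact: bivector_degree2.
have [c [c2 ck c1]] := closed_density f2 fk f10.
set g := f - Dx c in c1; have fg : ieq f g := ieq_subDx f c.
have g2 : homog superdeg 2 g by apply/homogB/Dx_super.
have gk : homog stddeg d.+3 g by apply/homogB/Dx_std.
have [b [b3 bk bE]] := ieq0_homog (D2_super g2) (D2_std gk)
  (ieq_trans (D2_ieq (ieq_sym fg)) f20).
have [z [z1 zk zD zE]] : exists z, [/\ homog superdeg 1 z, homog stddeg d.+2 z,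
    D1 z = 0 & ieq g (D2 z)].
  apply: (@bh_functional _ 0 d.+1 (d == 0%N) g b g2 gk b3 bk _ _ _ c1 bE).
  - case: d => [|d] in fk fa ck gk bk *; last exact: fil0.
    apply: (bivector_degree3 g2 gk c1) bE => //.
    by rewrite -(alpha_ieq fg) fa.
  - by case: d {fk fa ck gk bk} => [|d] [|k] //; rewrite doubleS !addSn.
  - by move=> k; rewrite addnS.
by exists z; split=> //; exact: ieq_trans zE.
Qed.

(** Exactness of the first differential removes f; what remains of g is closed
    for both differentials. *)
Lemma bivector_pair_exact d f g : homog superdeg 2 f -> homog superdeg 2 g ->
  homog stddeg d.+2 f -> homog stddeg d.+2 g ->
  (d = 1%N -> alpha g = Cid R * alpha f) ->
  ieq (D1 f) 0 -> ieq (D1 g + D2 f) 0 -> ieq (D2 g) 0 ->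
  exists y, [/\ homog superdeg 1 y, homog stddeg d.+1 y, ieq f (D1 y) & ieq g (D2 y)].
Proof.
move=> f2 g2 fk gk fga f1 fg0 g20.
have [c [c1 ck fc]] := d1_exact_functional f2 fk f1.
have [D1B D2B] := (linB (sder_lin (sder_D1 R)), linB (sder_lin (sder_D2 R))).
have [|||||z [z1 zk zD zE]] := @bivector_closed_D2 d (g - D2 c).
- by apply/homogB/D2_super.
- by apply/homogB/D2_std.
- by move=> d1; rewrite alphaB (alpha_D2 c1 ck) fga // (alpha_ieq fc) subrr.
- rewrite D1B D1D2 opprK; apply: (ieq_trans _ fg0).
  by apply: ieqD; [exact: ieq_refl|apply/D2_ieq/ieq_sym].
- by rewrite D2B D2D2 subr0.
exists (c + z); split; [exact: homogD|exact: homogD| |].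
  by rewrite (linD (sder_lin (sder_D1 R))) zD addr0.
rewrite (linD (sder_lin (sder_D2 R))).
by have := ieqD (ieq_refl (D2 c)) zE; rewrite addrC subrK.
Qed.

(** In standard degree 4 the weight vanishes on the part of b without jet
    variables, but there are no products of four distinct odd variables in
    that degree. *)
Lemma trivector_exact d f : homog superdeg 3 f -> homog stddeg d.+4 f ->
  ieq (D1 f) 0 -> ieq (D2 f) 0 ->
  exists z, [/\ homog superdeg 2 z, homog stddeg d.+3 z, D1 z = 0 & ieq f (D2 z)].
Proof.
move=> f3 fk f10 f20.
have [c [c3 ck c1]] := closed_density f3 fk f10.
set g := f - Dx c in c1; have fg : ieq f g := ieq_subDx f c.
have g3 : homog superdeg 3 g by apply/homogB/Dx_super.
have gk : homog stddeg d.+4 g by apply/homogB/Dx_std.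
have [b [b4 bk bE]] := ieq0_homog (D2_super g3) (D2_std gk)
  (ieq_trans (D2_ieq (ieq_sym fg)) f20).
have [z [z2 zk zD zE]] : exists z, [/\ homog superdeg 2 z, homog stddeg d.+3 z,
    D1 z = 0 & ieq g (D2 z)].
  apply: (@bh_functional _ 1 d.+2 (d == 0%N) g b g3 gk b4 bk _ _ _ c1 bE).
  - case: d => [|d] in fk ck gk bk *; last exact: fil0.
    by rewrite (low_zero b4 bk).
  - by case: d {fk ck gk bk} => [|d] [|k] //; rewrite ?doubleS ?addSn ?addnS.
  - by move=> k; rewrite !addnS.
by exists z; split=> //; exact: ieq_trans zE.
Qed.

End Bivectors.

Section Deformations.
Variable R : realType.
Local Notation A := (Ahat R).
Local Notation u := (uv R).
Local Notation th := (tv R).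
Implicit Types (f g h x y z : A) (r : R) (s t k n p d i j : nat) (a b : bool).

(** * The undeformed pair *)

(** The undeformed bivectors, the second one for a = true. *)
Definition pp a : A :=
  if a then 2^-1 *: (u 0 * (th 0 * th 1)) else 2^-1 *: (th 0 * th 1).

Definition DD a : A -> A := if a then @D2 R else @D1 R.

Lemma dt_big k s f : homog stddeg k f -> (k < s)%N -> dt s f = 0.
Proof. by move=> fk ks; exact: (@homog_d_th_lt R succn id s k). Qed.

Lemma du_big k s f : homog stddeg k f -> (k < s)%N -> du s f = 0.
Proof. by case: s => // s fk ks; exact: (@homog_d_u_lt R succn id s.+1 k). Qed.

Lemma vt_homog1 f : homog stddeg 1 f -> vt f = dt 0 f - Dx (dt 1 f).
Proof.
move=> f1; rewrite vtE (@asum_fin R _ 2).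
- by rewrite !big_ord_recl big_ord0 /= addr0 expr0 scale1r expr1 scaleN1r.
- exact: summable_var.
- by move=> s s1; rewrite (dt_big f1) // iter_Dx0 scaler0.
Qed.

Lemma vu_homog1 f : homog stddeg 1 f -> vu f = du 0 f - Dx (du 1 f).
Proof.
move=> f1; rewrite vuE (@asum_fin R _ 2).
- by rewrite !big_ord_recl big_ord0 /= addr0 expr0 scale1r expr1 scaleN1r.
- exact: summable_var.
- by move=> s s1; rewrite (du_big f1) // iter_Dx0 scaler0.
Qed.

Lemma thth_std : homog stddeg 1 (th 0 * th 1).
Proof. by apply: (@stdM R 0 1); exact: th_std. Qed.

Lemma pp_std a : homog stddeg 1 (pp a).
Proof.
case: a; apply: homogZ; last exact: thth_std.
by apply: (@stdM R 0 1); [exact: u_std|exact: thth_std].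
Qed.

Lemma thth_super : homog superdeg 2 (th 0 * th 1).
Proof. by apply: (@superM R 1 1); exact: th_super. Qed.

Lemma pp_super a : homog superdeg 2 (pp a).
Proof.
case: a; apply: homogZ; last exact: thth_super.
by apply: (@superM R 0 2); [exact: u_super|exact: thth_super].
Qed.

Lemma dt_u0 s f : dt s (u 0 * f) = u 0 * dt s f.
Proof. by rewrite (sder_leib (sder_d_th R s)) d_th_uvar mul0r add0r sg_uvar. Qed.

Lemma vt_pp a : vt (pp a) = if a then w2 R else th 1.
Proof.
rewrite (vt_homog1 (pp_std a)) /pp.
have d0 : dt 0 (th 0 * th 1) = th 1 by rewrite d_th_thvarM d_th_thvar scale1r mulr0 subr0.
have d1 : dt 1 (th 0 * th 1) = - th 0.
  by rewrite d_th_thvarM d_th_thvar scale0r mulr1 sub0r.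
case: a; rewrite !(linZ (@d_th_lin R _)) ?dt_u0 d0 d1 dxZ.
  rewrite mulrN dxN dxM dx_uvar dx_thvar scalerN opprK scalerDr.
  rewrite addrCA -scalerDr half_double.
  by rewrite /w2 addrC.
by rewrite dxN dx_thvar scalerN opprK -scalerDr half_double.
Qed.

Lemma vu_pp a : vu (pp a) = if a then z2 R else 0.
Proof.
rewrite (vu_homog1 (pp_std a)) /pp; have d0 s : du s (th 0 * th 1) = 0.
  by rewrite !(sder_leib (sder_d_u R s)) !d_u_thvar mul0r mulr0 addr0.
case: a; rewrite !(linZ (@d_u_lin R _)); last first.
  by rewrite !d0 !scaler0 dx0 subrr.
rewrite (sder_leib (sder_d_u R 0)) (sder_leib (sder_d_u R 1)).
by rewrite !d0 !d_u_uvar !mulr0 !addr0 mul0r scaler0 dx0 subr0 mul1r.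
Qed.

Lemma Ham_pp a f : Ham 2 (pp a) f = DD a f.
Proof. by rewrite Ham2E vt_pp vu_pp; case: a. Qed.

Lemma Sch_pp a f : ieq (Sch 2 (pp a) f) (DD a f).
Proof. by rewrite -Ham_pp; exact: Sch_Ham. Qed.

Lemma DD_lin a r f g : DD a (r *: f + g) = r *: DD a f + DD a g.
Proof. by case: a; [exact: (sder_lin (sder_D2 R))|exact: (sder_lin (sder_D1 R))]. Qed.

Lemma DD_ieq a f g : ieq f g -> ieq (DD a f) (DD a g).
Proof. by case: a; [exact: D2_ieq|exact: D1_ieq]. Qed.

Lemma DD_comp a k f : comp stddeg k.+1 (DD a f) = DD a (comp stddeg k f).
Proof.
rewrite -addn1; apply: comp_shift => [r g h|n|n g]; first exact: DD_lin.
  by case: a; [exact: (sder_cont (sder_D2 R))|exact: (sder_cont (sder_D1 R))].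
by rewrite addn1; case: a; [exact: D2_std|exact: D1_std].
Qed.

Lemma Sch12 x f : homog superdeg 1 x -> homog superdeg 2 f -> Sch 1 x f = Sch 2 f x.
Proof.
move=> x1 f2; rewrite Sch1E Sch2E addrC.
rewrite (mulC_odd (par_vu x1) (par_vt f2)) opprK; congr (_ + _).
by rewrite (mulC_even _ (par_vt x1)).
Qed.

(** * The bracket and the filtration by standard degree *)

Lemma SchDl p f g h : Sch p (f + g) h = Sch p f h + Sch p g h.
Proof. exact: (linD (fun r f g => Sch_linl p h r f g)). Qed.

Lemma SchDr p f g h : Sch p f (g + h) = Sch p f g + Sch p f h.
Proof. exact: (linD (Sch_linr p f)). Qed.

Lemma SchBl p f g h : Sch p (f - g) h = Sch p f h - Sch p g h.
Proof. exact: (linB (fun r f g => Sch_linl p h r f g)). Qed.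

Lemma SchBr p f g h : Sch p f (g - h) = Sch p f g - Sch p f h.
Proof. exact: (linB (Sch_linr p f)). Qed.

Lemma SchZr p f r g : Sch p f (r *: g) = r *: Sch p f g.
Proof. exact: (linZ (Sch_linr p f)). Qed.

Lemma SchZl p f r g : Sch p (r *: f) g = r *: Sch p f g.
Proof. exact: (linZ (fun r f h => Sch_linl p g r f h)). Qed.

Lemma Sch0r p f : Sch p f 0 = 0.
Proof. exact: (lin0 (Sch_linr p f)). Qed.

Lemma Sch_suml p n (F : nat -> A) g :
  Sch p (\sum_(i < n) F i) g = \sum_(i < n) Sch p (F i) g.
Proof.
elim: n => [|n IH]; last by rewrite !big_ord_recr /= SchDl IH.
by rewrite !big_ord0 (lin0 (fun r f h => Sch_linl p g r f h)).
Qed.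

Lemma Sch_sumr p n (F : nat -> A) f :
  Sch p f (\sum_(i < n) F i) = \sum_(i < n) Sch p f (F i).
Proof.
elim: n => [|n IH]; last by rewrite !big_ord_recr /= SchDr IH.
by rewrite !big_ord0 Sch0r.
Qed.

Lemma Sch_ge p k n f g : std_ge k f -> std_ge n g -> std_ge (k + n) (Sch p f g).
Proof.
move=> fk gn; apply: std_geD; first by apply: std_geM; [exact: vt_ge|exact: vu_ge].
by apply/std_geZ/std_geM; [exact: vu_ge|exact: vt_ge].
Qed.

(** The filtration induced on functionals. Brackets only depend on classes, so
    that a low class gives a low bracket. *)
Definition low k f := exists2 h, std_ge k h & ieq f h.

Lemma low_ge k f : std_ge k f -> low k f.
Proof. by move=> fk; exists f => //; exact: ieq_refl. Qed.

Lemma low_ieq k f g : ieq f g -> low k g -> low k f.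
Proof. by move=> fg [h hk gh]; exists h => //; exact: ieq_trans gh. Qed.

Lemma lowD k f g : low k f -> low k g -> low k (f + g).
Proof.
by move=> [h hk fh] [h' hk' gh]; exists (h + h'); [exact: std_geD|exact: ieqD].
Qed.

Lemma lowZ k r f : low k f -> low k (r *: f).
Proof. by move=> [h hk fh]; exists (r *: h); [exact: std_geZ|exact: ieqZ]. Qed.

Lemma lowN k f : low k f -> low k (- f).
Proof. by rewrite -scaleN1r; exact: lowZ. Qed.

Lemma lowB k f g : low k f -> low k g -> low k (f - g).
Proof. by move=> fk /lowN; exact: lowD. Qed.

Lemma lowW k n f : (n <= k)%N -> low k f -> low n f.
Proof. by move=> nk [h hk fh]; exists h => //; exact: std_geW hk. Qed.

Lemma low_all f : (forall k, low k f) -> ieq f 0.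
Proof.
move=> fl; rewrite /ieq subr0; apply: dx_image_lim => k.
have [h hk /dx_imageP[g fh]] := fl k.+1; exists g => m mk.
by rewrite -fh ahatBE hk ?subr0.
Qed.

Lemma low_lt k i f : (i < k)%N -> low k f -> ieq (comp stddeg i f) 0.
Proof.
move=> ik [h hk /(ieq_comp i)]; suff -> : comp stddeg i h = 0 by [].
exact: (std_geE _ _).1 hk i ik.
Qed.

Lemma std_geS k f : std_ge k f -> std_ge k.+1 (f - comp stddeg k f).
Proof.
move=> fk; apply/std_geE => i; rewrite ltnS (linB (comp_lin stddeg i)) leq_eqVlt.
case/orP => [/eqP ->|ik]; first by rewrite (comp_id (@homog_comp R stddeg k f)) subrr.
rewrite ((std_geE k f).1 fk i ik) (comp_homog_neq (@homog_comp R stddeg k f)) ?subrr //.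
by move=> ki; rewrite ki ltnn in ik.
Qed.

Lemma lowS k f : low k f -> ieq (comp stddeg k f) 0 -> low k.+1 f.
Proof.
move=> [h hk fh] fk; exists (h - comp stddeg k h); first exact: std_geS.
apply: (ieq_trans fh); have hk0 := ieq_trans (ieq_sym (ieq_comp k fh)) fk.
by have := ieqB (ieq_refl h) hk0; rewrite subr0 => /ieq_sym.
Qed.

Lemma Sch_low p k n f g : std_ge k f -> low n g -> std_ge (k + n) (Sch p f g).
Proof.
by move=> fk [h hn gh]; rewrite (Sch_ieq p (ieq_refl f) gh); exact: Sch_ge.
Qed.

Lemma asum_tail (F : nat -> A) n : summable F -> std_ge n (asum F - \sum_(s < n) F s).
Proof.
by case: n => // k sF; have /eqto_geP := @asumE R F k k.+1 sF (ltnSn k).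
Qed.

(** * The exponential of an adjoint action *)

(** The n-th term of the exponential series of the adjoint action. *)
Definition edp x n f : A := (n`!%:R : R)^-1 *: iter n (Sch 1 x) f.

Definition expad x f : A := asum (fun n => edp x n f).

Lemma edp0 x f : edp x 0 f = f.
Proof. by rewrite /edp fact0 invr1 scale1r. Qed.

Lemma edpS x n f : n.+1%:R *: edp x n.+1 f = Sch 1 x (edp x n f).
Proof.
by rewrite /edp iterS SchZr scalerA factS natrM invfM mulrA mulfV ?mul1r.
Qed.

Lemma ad_ge k x f : std_ge 1 x -> std_ge k f -> std_ge k.+1 (Sch 1 x f).
Proof. by move=> x1 fk; rewrite -add1n; exact: Sch_ge. Qed.

Lemma iter_ad_ge k n x f : std_ge 1 x -> std_ge k f -> std_ge (k + n) (iter n (Sch 1 x) f).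
Proof.
move=> x1 fk; elim: n => [|n IH]; first by rewrite addn0.
by rewrite iterS addnS; exact: ad_ge.
Qed.

Lemma edp_ge k n x f : std_ge 1 x -> std_ge k f -> std_ge (k + n) (edp x n f).
Proof. by move=> x1 fk; apply/std_geZ/iter_ad_ge. Qed.

Lemma edp_summable x f : std_ge 1 x -> summable (fun n => edp x n f).
Proof. by move=> x1 n; rewrite -[n]add0n; apply: edp_ge => //; exact: std_ge0. Qed.

Lemma edp_super n x f : homog superdeg 1 x -> homog superdeg 2 f ->
  homog superdeg 2 (edp x n f).
Proof.
move=> x1 f2; apply: homogZ; elim: n => //= n IH.
exact: (@Sch_super R 0 1).
Qed.

Lemma expad_super x f : homog superdeg 1 x -> homog superdeg 2 f ->
  homog superdeg 2 (expad x f).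
Proof. by move=> x1 f2; apply: homog_asum => n; exact: edp_super. Qed.

Lemma expad_tail n x f : std_ge 1 x ->
  std_ge n (expad x f - \sum_(s < n) edp x s f).
Proof. by move=> x1; apply/asum_tail/edp_summable. Qed.

Lemma expad_ieq x f g : ieq f g -> ieq (expad x f) (expad x g).
Proof.
(* only the zeroth term of the exponential depends on the representative *)
move=> fg; have E n : edp x n.+1 f = edp x n.+1 g.
  by rewrite /edp !iterSr (Sch_ieq 1 (ieq_refl x) fg).
have -> : expad x f = expad x g + (f - g); last first.
  rewrite -[X in ieq _ X]addr0; apply: ieqD; first exact: ieq_refl.
  by rewrite /ieq subr0.
rewrite -[LHS](subrK (expad x g)) addrC; congr (_ + _).
rewrite -[expad x g]scale1r -scaleNr -asumZ -asumD.
apply/funext => m; rewrite /asum big_ord_recl /= !edp0 big1 ?addr0 => [|i _].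
  by rewrite scaleN1r.
by rewrite /= E scaleN1r subrr.
Qed.

(** The coefficient of t^n in the bracket of exp (t ad_x) f with exp (t ad_x)
    g. *)
Definition edp_bracket x f g n : A :=
  \sum_(i < n.+1) Sch 2 (edp x i f) (edp x (n - i) g).

(** The adjoint action is a derivation of the bracket. In the resulting sum
    each term with indices i and n + 1 - i occurs i times and n + 1 - i times. *)
Lemma edp_bracketS x f g n : homog superdeg 1 x -> homog superdeg 2 f ->
  homog superdeg 2 g ->
  ieq (n.+1%:R *: edp_bracket x f g n.+1) (Sch 1 x (edp_bracket x f g n)).
Proof.
move=> x1 f2 g2; pose a i j := Sch 2 (edp x i f) (edp x j g).
have -> : n.+1%:R *: edp_bracket x f g n.+1 =
    \sum_(i < n.+1) (i.+1%:R *: a i.+1 (n - i)%N + (n - i).+1%:R *: a i (n - i).+1).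
  rewrite /edp_bracket scaler_sumr big_split /=.
  have -> : \sum_(i < n.+1) i.+1%:R *: a i.+1 (n - i)%N =
      \sum_(i < n.+2) i%:R *: a i (n.+1 - i)%N.
    by rewrite [RHS]big_ord_recl scale0r add0r; apply: eq_bigr.
  have -> : \sum_(i < n.+1) (n - i).+1%:R *: a i (n - i).+1 =
      \sum_(i < n.+2) (n.+1 - i)%:R *: a i (n.+1 - i)%N.
    rewrite [RHS]big_ord_recr /= subnn scale0r addr0.
    by apply: eq_bigr => i _; rewrite -subSn // -ltnS.
  rewrite -big_split /=; apply: eq_bigr => i _.
  by rewrite -scalerDl -natrD subnKC // -ltnS.
have -> : Sch 1 x (edp_bracket x f g n) = \sum_(i < n.+1) Sch 1 x (a i (n - i)%N).
  exact: (Sch_sumr 1 n.+1 (fun i => a i (n - i)%N)).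
apply: (@ieq_sum R n.+1
  (fun i => i.+1%:R *: a i.+1 (n - i)%N + (n - i).+1%:R *: a i (n - i).+1)
  (fun i => Sch 1 x (a i (n - i)%N))) => i _; apply: ieq_sym.
rewrite /a -SchZl -SchZr !edpS; apply: jacobi122 => //; exact: edp_super.
Qed.

Lemma edp_bracket0 x f g n : homog superdeg 1 x -> homog superdeg 2 f ->
  homog superdeg 2 g -> ieq (Sch 2 f g) 0 -> ieq (edp_bracket x f g n) 0.
Proof.
move=> x1 f2 g2 fg; elim: n => [|n IH].
  by rewrite /edp_bracket big_ord1 !edp0.
have := ieqZ n.+1%:R^-1 (edp_bracketS n x1 f2 g2).
rewrite scalerA mulVf ?pnatr_eq0 // scale1r (Sch_ieq 1 (ieq_refl x) IH) Sch0r.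
by rewrite scaler0.
Qed.

Lemma triangle_sum (a : nat -> nat -> A) n :
  \sum_(k < n) \sum_(i < k.+1) a i (k - i)%N = \sum_(i < n) \sum_(j < n - i) a i j.
Proof.
elim: n => [|n IH]; first by rewrite !big_ord0.
rewrite big_ord_recr /= IH [RHS]big_ord_recr /= subSnn big_ord1.
rewrite [in LHS]big_ord_recr /= subnn addrA -big_split /=; congr (_ + _).
by apply: eq_bigr => i _; rewrite subSn 1?ltnW // big_ord_recr.
Qed.

(** Up to terms of high degree, the bracket of two exponentials is a double
    sum over a triangle, which is resummed along the diagonals. *)
Lemma expad_Sch x f g : homog superdeg 1 x -> std_ge 1 x -> homog superdeg 2 f ->
  homog superdeg 2 g -> ieq (Sch 2 f g) 0 -> ieq (Sch 2 (expad x f) (expad x g)) 0.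
Proof.
move=> xs x1 f2 g2 fg; apply: low_all => n.
set T := \sum_(k < n) edp_bracket x f g k.
have TE : ieq T 0.
  have := @ieq_sum R n (edp_bracket x f g) (fun=> 0).
  rewrite [X in ieq _ X]big1 // => H; apply: H => k _; exact: edp_bracket0.
rewrite -[Sch 2 _ _](subrK T); apply: lowD; last first.
  exact: (low_ieq TE (low_ge (@std_ge_0 R n))).
apply: low_ge; rewrite /T /edp_bracket.
rewrite (triangle_sum (fun i j => Sch 2 (edp x i f) (edp x j g))).
rewrite -[Sch 2 _ _](subrK (Sch 2 (\sum_(i < n) edp x i f) (expad x g))) -SchBl -addrA.
apply: std_geD.
  by have := Sch_ge 2 (@expad_tail n x f x1) (@std_ge0 R (expad x g)); rewrite addn0.
rewrite (Sch_suml 2 n (fun i => edp x i f)) -sumrB => m mn; rewrite ahat_sumE big1 // => i _.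
rewrite -(Sch_sumr 2 (n - i) (fun j => edp x j g)) -SchBr.
have := Sch_ge 2 (@edp_ge 0 i x f x1 (@std_ge0 R f)) (@expad_tail (n - i) x g x1).
by rewrite add0n subnKC 1?ltnW //; apply.
Qed.

(** Every other term contains y together with x, with y again, or with f - pp
    a, and so has a larger degree. *)
Lemma expad_correction k a x y f : std_ge 1 x -> std_ge k.+1 y -> std_ge 1 f ->
  std_ge 2 (f - pp a) ->
  std_ge k.+3 (expad (x + y) f - expad x f - Sch 1 y (pp a)).
Proof.
move=> x1 yk f1 fp; have y1 : std_ge 1 y by exact: std_geW yk.
have xy1 : std_ge 1 (x + y) by exact: std_geD.
have diff n : std_ge (k.+1 + n) (iter n (Sch 1 (x + y)) f - iter n (Sch 1 x) f).
  elim: n => [|n IH]; first by rewrite subrr.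
  set X := iter n _ f in IH *; set Y := iter n (Sch 1 x) f in IH *; rewrite !iterS.
  have -> : Sch 1 (x + y) X - Sch 1 x Y = Sch 1 (x + y) (X - Y) + Sch 1 y Y.
    by rewrite SchBr [Sch 1 (x + y) Y]SchDl; zmodule.
  apply: std_geD; first by rewrite addnS; exact: ad_ge.
  by apply: Sch_ge => //; have := iter_ad_ge (n := n) x1 f1; rewrite add1n.
pose v n : A := if n == 1%N then Sch 1 y (pp a) else 0.
have vE : asum v = Sch 1 y (pp a).
  rewrite (@asum1 R v 1) // => [|s /negPf sN]; last by rewrite /v sN.
  by move=> [|[|s]] //; apply: (@ad_ge 0 y) => //; exact: std_ge0.
rewrite -vE -scaleN1r -[- asum v]scaleN1r -!asumZ -!asumD.
apply: std_ge_asum => -[|[|n]].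
- by rewrite /v /= !edp0 scaler0 addr0 scaleN1r subrr.
- rewrite /v /= !scaleN1r /edp /= invr1 !scale1r SchDl.
  have -> : Sch 1 x f + Sch 1 y f - Sch 1 x f - Sch 1 y (pp a) = Sch 1 y (f - pp a).
    by rewrite SchBr; zmodule.
  by have := Sch_ge 1 yk fp; rewrite addSn addn2.
rewrite /v /= scaler0 addr0 scaleN1r -scalerBr; apply: std_geZ.
by apply: (std_geW _ (diff n.+2)); rewrite !addnS !addSn !ltnS leq_addr.
Qed.

End Deformations.

Section Classification.
Variable R : realType.
Local Notation A := (Ahat R).
Local Notation u := (uv R).
Local Notation th := (tv R).
Local Notation D1 := (@D1 R).
Local Notation D2 := (@D2 R).
Local Notation DD := (@DD R).
Local Notation pp := (@pp R).
Implicit Types (f g h x y z : A) (r : R) (s t k n p d i j : nat) (a b : bool)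
  (e q w : bool -> A).

(** The defining conditions of a deformation, for densities. *)
Definition deform e := [/\ forall a, homog superdeg 2 (e a),
  forall a, std_ge 2 (e a - pp a) & forall a b, ieq (Sch 2 (e a) (e b)) 0].

Lemma deform_ge e a : deform e -> std_ge 1 (e a).
Proof.
move=> [_ e2 _]; rewrite -[e a](subrK (pp a)); apply: std_geD.
  exact: std_geW (e2 a).
exact/std_homog_ge/pp_std.
Qed.

Lemma th101 : th 1 * (th 0 * th 1) = 0.
Proof. by rewrite mulrA tvC mulNr -mulrA tv2 mulr0 oppr0. Qed.

Lemma Sch_pp_pp a b : Sch 2 (pp a) (pp b) = 0.
Proof.
have wz : w2 R * z2 R = 0.
  rewrite /w2 /z2 -scalerAr mulrDl -!mulrA th101 mulr0 add0r -scalerAl -mulrA.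
  by rewrite [th 0 * (_ * _)]mulrA tv2 mul0r mulr0 !scaler0.
have zw : z2 R * w2 R = 0 by rewrite (mulC_even _ (par_z2 R)).
have tz : th 1 * z2 R = 0 by rewrite /z2 -scalerAr th101 scaler0.
have zt : z2 R * th 1 = 0 by rewrite (mulC_even _ (par_z2 R)).
by rewrite Sch2E !vt_pp !vu_pp; case: a; case: b; rewrite ?wz ?zw ?tz ?zt ?mulr0 ?mul0r addr0.
Qed.

Lemma pp_deform : deform pp.
Proof.
split=> [a|a|a b]; [exact: pp_super|by rewrite subrr|].
by rewrite Sch_pp_pp; exact: ieq_refl.
Qed.

Lemma double_ieq0 f : ieq (f + f) 0 -> ieq f 0.
Proof. by move=> /(ieqZ 2^-1); rewrite half_double scaler0. Qed.

(** These are the terms of degree k + 1 in the difference of the equations for q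
    and for e: the terms quadratic in w, and those that involve the deformed
    part of e, have a larger degree. *)
Lemma linearised k e q w : (1 < k)%N -> deform e ->
  (forall a b, ieq (Sch 2 (q a) (q b)) 0) ->
  (forall a, homog superdeg 2 (w a)) -> (forall a, std_ge k (w a)) ->
  (forall a, ieq (q a) (e a + w a)) ->
  forall a b, ieq (DD a (comp stddeg k (w b)) + DD b (comp stddeg k (w a))) 0.
Proof.
move=> k1 [e2 ep ee] qq w2 wk qe a b.
rewrite -!DD_comp -(linD (comp_lin stddeg k.+1)).
apply: (@low_lt R k.+2) => //.
apply: (low_ieq (ieq_sym (ieqD (Sch_pp a (w b)) (Sch_pp b (w a))))).
have E : Sch 2 (pp a) (w b) + Sch 2 (pp b) (w a) = (Sch 2 (q a) (q b) - Sch 2 (e a) (e b))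
    - (Sch 2 (e a - pp a) (w b) + Sch 2 (e b - pp b) (w a) + Sch 2 (w a) (w b)).
  rewrite (Sch_ieq 2 (qe a) (qe b)) !SchBl !SchDl !SchDr (SchC (w2 a) (e2 b)).
  zmodule.
rewrite E; apply: lowB.
  apply: (low_ieq _ (low_ge (@std_ge_0 R _))).
  by have := ieqB (qq a b) (ee a b); rewrite subrr.
have k2 : k.+2 = (2 + k)%N by rewrite add2n.
apply: low_ge; apply: std_geD; first apply: std_geD.
- by rewrite k2; exact: Sch_ge.
- by rewrite k2; exact: Sch_ge.
- by apply: (@std_geW R (k + k)); [rewrite k2 leq_add2r|exact: Sch_ge].
Qed.

(** The terms of standard degree 2 are closed, hence trivial. *)
Lemma deform_low3 e a : deform e -> low 3 (e a - pp a).
Proof.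
move=> de; have [e2 ep ee] := de; pose w a := e a - pp a.
have w2 b : homog superdeg 2 (w b) by apply/homogB/pp_super.
have lin := @linearised 2 pp e w isT pp_deform ee w2 ep.
have {}lin b c : ieq (DD b (comp stddeg 2 (w c)) + DD c (comp stddeg 2 (w b))) 0.
  by apply: lin => c'; apply: ieq_eq; rewrite /w addrC subrK.
have W0 b : ieq (D1 (comp stddeg 2 (w b))) 0 -> ieq (comp stddeg 2 (w b)) 0.
  by apply: bivector_degree2; [exact: comp_homog|exact: homog_comp].
have w1 := W0 false (double_ieq0 (lin false false)).
apply: lowS; first exact/low_ge/ep.
case: a => //; apply: W0; apply: (ieq_trans _ (lin false true)).
rewrite -[X in ieq X _]addr0; apply: ieqD; first exact: ieq_refl.
by apply: ieq_sym; have := D2_ieq w1; rewrite (lin0 (sder_lin (sder_D2 R))).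
Qed.

(** Up to a constant factor, the central invariant. On a standard form it is
    three times c. *)
Definition gam e : Cinf R := alpha (e true) - Cid R * alpha (e false).

Lemma expad_tail1 n x f : std_ge 1 x -> std_ge 1 f ->
  std_ge n.+1 (expad x f - \sum_(s < n) edp x s f).
Proof.
move=> x1 f1; have := @expad_tail R n.+1 x f x1; rewrite big_ord_recr /= => T.
have T2 : std_ge n.+1 (edp x n f) := @edp_ge R 1 n x f x1 f1.
have := std_geD T T2.
by have -> : expad x f - (\sum_(i < n) edp x i f + edp x n f) + edp x n f =
  expad x f - \sum_(s < n) edp x s f by zmodule.
Qed.

Lemma expad_deform x e : homog superdeg 1 x -> std_ge 1 x -> deform e ->
  deform (fun a => expad x (e a)).
Proof.
move=> xs x1 de; have [e2 ep ee] := de; split=> [a|a|a b].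
- exact: expad_super.
- have := @expad_tail1 1 x (e a) x1 (@deform_ge e a de).
  rewrite big_ord1 edp0 => /std_geD/(_ (ep a)).
  by have -> : expad x (e a) - e a + (e a - pp a) = expad x (e a) - pp a by zmodule.
- exact: expad_Sch.
Qed.

(** Both e and its image are undeformed up to degree 3, hence the bracket of x
    with e is trivial below degree 3, and the quadratic term of the
    exponential starts in degree 4. Thus [alpha] only changes by its value at
    the differential of x, and [alpha_D2] applies. *)
Lemma gam_expad x e : homog superdeg 1 x -> std_ge 1 x -> deform e ->
  gam (fun a => expad x (e a)) = gam e.
Proof.
move=> xs x1 de; have [e2 ep ee] := de; have dx := expad_deform xs x1 de.
pose z := comp stddeg 2 x.
have edp1 a : edp x 1 (e a) = Sch 1 x (e a) by rewrite /edp /= invr1 scale1r.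
have adl a : low 3 (Sch 1 x (e a)).
  have -> : Sch 1 x (e a) = (expad x (e a) - pp a) - (e a - pp a) -
      (expad x (e a) - \sum_(s < 2) edp x s (e a)).
    by rewrite !big_ord_recr big_ord0 /= edp0 edp1; zmodule.
  apply: lowB; first by apply: lowB; [exact: (deform_low3 a dx)|exact: deform_low3].
  by apply/low_ge/expad_tail1 => //; exact: deform_ge.
have aE a : alpha (expad x (e a)) = alpha (e a) + alpha (DD a z).
  have -> : expad x (e a) = e a + (Sch 1 x (pp a) + (Sch 1 x (e a - pp a) +
      (edp x 2 (e a) + (expad x (e a) - \sum_(s < 3) edp x s (e a))))).
    rewrite !big_ord_recr big_ord0 /= edp0 edp1 SchBr; zmodule.
  rewrite (alphaD (e a)) (alphaD (Sch 1 x (pp a))) (alphaD (Sch 1 x (e a - pp a))).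
  rewrite (alphaD (edp x 2 (e a))) (Sch12 xs (pp_super R a)) (alpha_ieq (Sch_pp a x)).
  rewrite [alpha (DD a x)]alpha_comp DD_comp -/z.
  rewrite (alpha_ge (Sch_low 1 x1 (deform_low3 a de))).
  rewrite [alpha (edp _ _ _)]alpha_ge; last first.
    rewrite -[edp x 2 _]scale1r -(mulVf (_ : 2%:R != 0 :> R)) ?pnatr_eq0 // -scalerA edpS edp1.
    exact/std_geZ/(Sch_low 1 x1 (adl a)).
  rewrite [alpha (_ - _)]alpha_ge ?addr0 //.
  by apply: expad_tail1 => //; exact: deform_ge.
rewrite /gam !aE (@alpha_D2 R 1 z) ?mulrDr; [zmodule| |exact: homog_comp].
exact: comp_homog.
Qed.

Lemma low_super k p f : homog superdeg p f -> low k f ->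
  exists h, [/\ homog superdeg p h, std_ge k h & ieq f h].
Proof.
move=> fp [h hk fh]; exists (comp superdeg p h); split; first exact: homog_comp.
  by move=> m mk; rewrite /comp hk // if_same.
by have := ieq_comp_super p fh; rewrite (comp_id fp).
Qed.

(** A correction of degree k + 1 does not affect the lower components, so that
    the successive approximations converge. *)
Lemma corrections_limit (P : nat -> A -> Prop) f : P 0%N f ->
  (forall k g, P k g -> exists y, std_ge k.+1 y /\ P k.+1 (g + y)) ->
  exists g, forall k, exists2 h, P k h & std_ge k.+1 (g - h).
Proof.
move=> P0 PS.
have /choice[Y YP] (z : nat * A) : exists y, P z.1 z.2 ->
    std_ge z.1.+1 y /\ P z.1.+1 (z.2 + y).
  case: z => [k g] /=; have [/PS[y yP]|nP] := pselect (P k g); first by exists y.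
  by exists 0 => /nP.
pose F := fix F k : A := if k is k'.+1 then F k' + Y (k', F k') else f.
have FP k : P k (F k) by elim: k => //= k /(YP (k, F k)) [].
(* the component of degree k is final from the k-th approximation on *)
exists (fun m => F (stddeg m) m) => k; exists (F k) => //.
move=> m; rewrite ltnS => mk; rewrite ahatBE; apply/eqP; rewrite subr_eq0; apply/eqP.
elim: k mk => [|k IH]; first by rewrite leqn0 => /eqP ->.
rewrite leq_eqVlt => /orP[/eqP -> //|]; rewrite ltnS => mk; rewrite (IH mk) /=.
by rewrite ahatDE ((YP (k, F k) (FP k)).1 m) ?addr0.
Qed.

Lemma std_ge_homog (w : monomial -> nat) p f :
  (forall k, exists2 h, homog w p h & std_ge k.+1 (f - h)) -> homog w p f.
Proof.
move=> fh m mp; have [h hp /(_ m (leqnn _))] := fh (stddeg m).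
by rewrite ahatBE hp // subr0.
Qed.

(** The generator is built degree by degree. In each degree the discrepancy
    solves the linearised equations, and the equality of the invariants
    removes the obstruction in degree 3. *)
Lemma classification e q : deform e -> deform q -> gam e = gam q ->
  exists x, [/\ homog superdeg 1 x, std_ge 1 x & forall a, ieq (q a) (expad x (e a))].
Proof.
move=> de dq geq; have [e2 ep ee] := de; have [q2 qp qq] := dq.
pose P k x := [/\ homog superdeg 1 x, std_ge 1 x &
  forall a, low k.+2 (q a - expad x (e a))].
have [||x xP] := @corrections_limit P 0.
- split; [exact: homog0|exact: std_ge_0|move=> a].
  have [_ e0 _] := expad_deform (@homog0 R superdeg 1) (@std_ge_0 R 1) de.
  have -> : q a - expad 0 (e a) = (q a - pp a) - (expad 0 (e a) - pp a) by zmodule.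
  exact/low_ge/std_geB.
- move=> k x [xs x1 xl]; have dx := expad_deform xs x1 de; have [x2 xp xx] := dx.
  have /choice[w wP] a := low_super (homogB (q2 a) (x2 a)) (xl a).
  have wE a : ieq (q a) (expad x (e a) + w a).
    have [_ _ wa] := wP a; have := ieqD (ieq_refl (expad x (e a))) wa.
    by rewrite addrC subrK.
  have ws a : homog superdeg 2 (w a) by case: (wP a).
  have wk a : std_ge k.+2 (w a) by case: (wP a).
  have lin := @linearised k.+2 _ q w isT dx qq ws wk wE.
  pose g a := comp stddeg k.+2 (w a).
  have [||||||||y [ys yk g0 g1]] := @bivector_pair_exact R k (g false) (g true).
  - exact: comp_homog.
  - exact: comp_homog.
  - exact: homog_comp.
  - exact: homog_comp.
  - move=> k1; rewrite /g k1 -!alpha_comp.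
    have wa a : alpha (w a) = alpha (q a) - alpha (expad x (e a)).
      by rewrite (alpha_ieq (wE a)) alphaD; zmodule.
    rewrite !wa mulrBr; have := gam_expad xs x1 de; rewrite geq /gam.
    move=> /eqP; rewrite subr_eq => /eqP ->; zmodule.
  - exact: double_ieq0 (lin false false).
  - exact: (lin false true).
  - exact: double_ieq0 (lin true true).
  exists y; have yk' := std_homog_ge yk; split=> //; split.
  - exact: homogD.
  - by apply: std_geD => //; exact: std_geW yk'.
  move=> a; pose r := expad (x + y) (e a) - expad x (e a) - Sch 1 y (pp a).
  have -> : q a - expad (x + y) (e a) = q a - expad x (e a) - Sch 1 y (pp a) - r.
    by rewrite /r; zmodule.
  apply: lowB; last first.
    by apply/low_ge/expad_correction => //; exact: deform_ge.
  exists (w a - g a); first exact: std_geS.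
  rewrite (Sch12 ys (pp_super R a)); apply: ieqB; first by case: (wP a).
  by apply: (ieq_trans (Sch_pp a y)); apply: ieq_sym; case: (a).
exists x; split.
- by apply: std_ge_homog => k; have [h [hs _ _] xh] := xP k; exists h.
- have [h [_ h1 _] xh] := xP 0%N; rewrite -[x](subrK h); exact: std_geD.
move=> a; rewrite /ieq -[_ - _]subr0; apply: low_all => k.
have [h [hs h1 hl] xh] := xP k.
have -> : q a - expad x (e a) = q a - expad h (e a) -
    ((expad (h + (x - h)) (e a) - expad h (e a) - Sch 1 (x - h) (pp a))
     + Sch 1 (x - h) (pp a)).
  have -> : h + (x - h) = x by rewrite addrC subrK.
  by move: (Sch 1 _ _) (expad x _) (expad h _) => a1 a2 a3; zmodule.
apply: lowB; first by apply: lowW (hl a); rewrite -addn2 leq_addr.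
apply: lowD; apply: low_ge; last first.
  by apply: (std_geW _ (Sch_ge 1 xh (std_homog_ge (@pp_std R a)))); rewrite addn1 -addn2 leq_addr.
have := @expad_correction R k a h (x - h) (e a) h1 xh (@deform_ge e a de) (ep a).
by apply: std_geW; rewrite -addn3 leq_addr.
Qed.

End Classification.

Section Existence.
Variable R : realType.
Local Notation A := (Ahat R).
Local Notation u := (uv R).
Local Notation th := (tv R).
Local Notation D1 := (@D1 R).
Local Notation D2 := (@D2 R).
Local Notation DD := (@DD R).
Local Notation pp := (@pp R).
Implicit Types (f g h x y z : A) (r : R) (s t k n p d i j : nat) (a b : bool)
  (c : Cinf R).

(** * Parity of the standard degree *)

Definition spar b f := forall m, odd (stddeg m) != b -> f m = 0.

Lemma spar_homog k f : homog stddeg k f -> spar (odd k) f.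
Proof. by move=> fk m mk; apply: fk => mE; rewrite mE eqxx in mk. Qed.

Lemma sparE b f : spar b f <-> forall i, odd i != b -> comp stddeg i f = 0.
Proof.
split=> fb i ib.
  by apply/funext => m; rewrite /comp; case: eqP => // mi; rewrite fb // mi.
by have := congr1 (fun f : A => f i) (fb _ ib); rewrite /comp eqxx.
Qed.

Lemma sparD b f g : spar b f -> spar b g -> spar b (f + g).
Proof. by move=> fb gb m mb; rewrite ahatDE fb ?gb ?addr0. Qed.

Lemma sparZ b r f : spar b f -> spar b (r *: f).
Proof. by move=> fb m mb; rewrite ahatZE fb ?scaler0. Qed.

Lemma sparM a b f g : spar a f -> spar b g -> spar (a (+) b) (f * g).
Proof.
move=> fa gb m mab; rewrite -amulE amul_sum big_seq big1 // => x.
rewrite mem_mdivisors => xm; have := wt_div succn id xm; rewrite -!stddegE => mE.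
have [xa|/fa->] := eqVneq (odd (stddeg x)) a; last by rewrite mul0r mulr0.
rewrite gb ?mulr0 //; apply: contra mab => /eqP yb.
by rewrite mE oddD xa yb.
Qed.

Lemma spar_vt b f : spar b f -> spar b (vt f).
Proof.
by move=> /sparE fb; apply/sparE => i ib; rewrite vt_comp fb // (lin0 (@vt_lin R)).
Qed.

Lemma spar_vu b f : spar b f -> spar b (vu f).
Proof.
by move=> /sparE fb; apply/sparE => i ib; rewrite vu_comp fb // (lin0 (@vu_lin R)).
Qed.

Lemma spar_Sch a b p f g : spar a f -> spar b g -> spar (a (+) b) (Sch p f g).
Proof.
move=> fa gb; apply: sparD; last apply: sparZ; apply: sparM;
  by [exact: spar_vt|exact: spar_vu].
Qed.

(** * The first correction *)

(** The density of the terms of order epsilon^2, up to a total derivative. *)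
Definition cbiv c : A := - ((3 / 2) *: (cf c * (th 1 * th 2))).

Lemma cbiv_std c : homog stddeg 3 (cbiv c).
Proof.
by apply/homogN/homogZ/(@stdM R 0 3); [exact: cf_std|apply: (@stdM R 1 2); exact: th_std].
Qed.

Lemma cbiv_super c : homog superdeg 2 (cbiv c).
Proof.
by apply/homogN/homogZ/(@superM R 0 2); [exact: cf_super|apply: (@superM R 1 1); exact: th_super].
Qed.

Lemma cbiv_D1 c : D1 (cbiv c) = 0.
Proof.
rewrite /cbiv (linN (sder_lin (sder_D1 R))) (linZ (sder_lin (sder_D1 R))).
rewrite (sder_leib (sder_D1 R)) (sder_leib (sder_D1 R) (th 1)) !D1_th mul0r mulr0 !addr0.
rewrite mulr0 addr0 D1_cf -mulrA [cf _ * _]cfC -mulrA mulrA mulrA tv2.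
by rewrite !mul0r scaler0 oppr0.
Qed.

Lemma cbiv_D2 c : ieq (D2 (cbiv c)) 0.
Proof.
rewrite /cbiv (linN (sder_lin (sder_D2 R))) (linZ (sder_lin (sder_D2 R))).
have -> : D2 (cf c * (th 1 * th 2)) = 2^-1 *: Dx (cf c * (th 0 * (th 1 * th 2))).
  rewrite (sder_leib (sder_D2 R)) (sder_leib (sder_D2 R) (th 1)) sg_coef sg_thvar.
  rewrite !D2_th D2_cf /= Dx_z2 dxZ !dxM !dx_thvar dx_coef.
  rewrite expr1 scaleN1r mulNr !mulrDr !tv2 !mulr0 !add0r.
  have -> : (2^-1 *: (th 0 * th 2)) * th 2 = 0.
    by rewrite -scalerAl -mulrA tv2 mulr0 scaler0.
  have -> : w2 R * cf (Cderiv c) * (th 1 * th 2) =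
      2^-1 *: (u 1 * cf (Cderiv c) * (th 0 * (th 1 * th 2))).
    rewrite /w2 mulrDl mulrDl.
    have -> : u 0 * th 1 * cf (Cderiv c) * (th 1 * th 2) = 0.
      rewrite -[_ * cf _ * _]mulrA [cf _ * _]cfC !mulrA -[u 0 * _ * _]mulrA tv2.
      by rewrite mulr0 !mul0r.
    rewrite add0r -!scalerAl; congr (_ *: _).
    by rewrite -!mulrA; congr (_ * _); rewrite [LHS]mulrA -cfC mulrA.
  rewrite mulr0 add0r [th 1 * (th 1 * th 2)]mulrA tv2 mul0r mulr0 add0r.
  suff -> : cf c * - (th 1 * (2^-1 *: (th 1 * th 2 + th 0 * th 3))) =
      2^-1 *: (cf c * (th 0 * (th 1 * th 3))) by rewrite scalerDr.
  rewrite -scalerAr mulrDr [th 1 * (th 1 * th 2)]mulrA tv2 mul0r add0r.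
  by rewrite [th 1 * (_ * _)]mulrA tvC mulNr scalerN opprK -scalerAr !mulrA.
rewrite -scaleNr scalerA; apply: (ieq_trans (ieqZ _ (ieq_Dx _))).
by rewrite scaler0; exact: ieq_refl.
Qed.

(** * Completing the first correction to a bihamiltonian structure *)

(** From the Jacobi identity for the first undeformed bivector, f and f. *)
Lemma bracket_square_D1 f : homog superdeg 2 f -> ieq (D1 f) 0 -> ieq (D1 (Sch 2 f f)) 0.
Proof.
move=> f2 f1; have p2 := pp_super R false.
apply: (ieq_trans (ieq_sym (Sch_pp false _))).
have := jacobi222 p2 f2 f2; rewrite (SchC f2 p2).
have pf : ieq (Sch 2 (pp false) f) 0 by exact: ieq_trans (Sch_pp false f) f1.
by rewrite (Sch_ieq 2 (ieq_refl f) pf) Sch0r !addr0.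
Qed.

(** From the Jacobi identity for f, f and f. *)
Lemma bracket_square_closed f : homog superdeg 2 f -> ieq (Sch 2 f (Sch 2 f f)) 0.
Proof.
move=> f2; have := jacobi222 f2 f2 f2; set W := Sch 2 f _.
have -> : W + W + W = 3%:R *: W by rewrite scaler_nat !mulrS mulr0n addr0 addrA.
by move=> /(ieqZ 3%:R^-1); rewrite scalerA mulVf ?pnatr_eq0 // scale1r scaler0.
Qed.

Lemma D1_ge k f : std_ge k f -> std_ge k.+1 (D1 f).
Proof.
move=> /std_geE fk; apply/std_geE => -[_|i].
  apply: (comp_shift_lt (sder_lin (sder_D1 R)) (sder_cont (sder_D1 R)) (c := 1)) => // n g gn.
  by rewrite addn1; exact: D1_std.
by rewrite ltnS => ik; rewrite (DD_comp false) fk // /DD (lin0 (sder_lin (sder_D1 R))).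
Qed.

(** The first nonzero component of the bracket of f with itself is closed for
    both differentials, hence of the form D2 y with D1 y = 0, and is cancelled
    by a correction of f. Parity makes the components of odd degree vanish, so
    that only odd degrees are corrected, as an expansion in even powers of
    epsilon requires. *)
Lemma standard_exists c : exists f, [/\ homog superdeg 2 f, spar true f,
  std_ge 5 (f - pp true - cbiv c), ieq (D1 f) 0 & ieq (Sch 2 f f) 0].
Proof.
pose P k f := [/\ homog superdeg 2 f, spar true f,
  std_ge 5 (f - pp true - cbiv c), ieq (D1 f) 0 & low k.+4.+1 (Sch 2 f f)].
have p2 := pp_super R true; have c2 := cbiv_super c.
have low2 f : std_ge 5 (f - pp true - cbiv c) -> std_ge 2 (f - pp true).
  move=> f5; rewrite -[_ - _](subrK (cbiv c)); apply: std_geD; first exact: std_geW f5.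
  by apply: (@std_geW R 3) => //; exact/std_homog_ge/cbiv_std.
have [||f fP] := @corrections_limit R P (pp true + cbiv c).
- split; [exact: homogD| | | |].
  + apply: sparD; [exact: (spar_homog (@pp_std R true))|exact: (spar_homog (cbiv_std c))].
  + by have -> : pp true + cbiv c - pp true - cbiv c = 0 by zmodule.
  + rewrite (linD (sder_lin (sder_D1 R))) cbiv_D1 addr0.
    by rewrite -/(DD false _) -Ham_pp; apply: (ieq_trans (ieq_sym (Sch_Ham _ _ _)));
      rewrite Sch_pp_pp; exact: ieq_refl.
  rewrite !SchDl !SchDr Sch_pp_pp add0r (SchC c2 p2) addrA; apply: lowD.
    apply: (low_ieq _ (low_ge (@std_ge_0 R _))).
    have := ieqD (Sch_pp true (cbiv c)) (Sch_pp true (cbiv c)).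
    move=> H; apply: (ieq_trans H).
    by have := ieqD (cbiv_D2 c) (cbiv_D2 c); rewrite addr0.
  apply/low_ge; apply: (@std_geW R (3 + 3)) => //.
  by apply: Sch_ge; exact/std_homog_ge/cbiv_std.
- move=> k f [f2 fo f5 f1 ff]; set X := Sch 2 f f in ff.
  have X3 : homog superdeg 3 X by exact: (@Sch_super R 1 1).
  have [X' [X'3 X'k XX']] := low_super X3 ff.
  pose T := comp stddeg k.+4.+1 X'.
  have TX : ieq (comp stddeg k.+4.+1 X) T by exact: ieq_comp.
  have [y [y2 yk yo y1 Ty]] : exists y, [/\ homog superdeg 2 y, homog stddeg k.+4 y,
      (if odd k then std_ge 5 y else y = 0), D1 y = 0 & ieq T (D2 y)].
    case: (boolP (odd k)) => ko; last first.
      exists 0; split; [exact: homog0|exact: homog0|by []| |].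
        by rewrite (lin0 (sder_lin (sder_D1 R))).
      rewrite (lin0 (sder_lin (sder_D2 R))); apply: (ieq_trans (ieq_sym TX)).
      apply: ieq_eq; apply: ((sparE false _).1 (spar_Sch 2 fo fo)).
      by rewrite /= !negbK ko.
    have [|||| y [y2 yk y1 Ty]] := @trivector_exact R k.+1 T.
    - exact: comp_homog.
    - exact: homog_comp.
    - rewrite -/(DD false _) -DD_comp; apply: (@low_lt R k.+4.+3) => //.
      apply: (low_ieq _ (low_ge (@std_ge_0 R _))).
      exact: ieq_trans (DD_ieq false (ieq_sym XX')) (bracket_square_D1 f2 f1).
    - rewrite -/(DD true _) -DD_comp; apply: (@low_lt R k.+4.+3) => //.
      apply: (low_ieq (ieq_sym (Sch_pp true X'))).
      have -> : Sch 2 (pp true) X' = Sch 2 f X' - Sch 2 (f - pp true) X'.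
        by rewrite SchBl; zmodule.
      apply: lowB; last first.
        by apply/low_ge/(Sch_ge 2 (low2 _ f5) X'k).
      apply: (low_ieq _ (low_ge (@std_ge_0 R _))).
      by rewrite -(Sch_ieq 2 (ieq_refl f) XX'); exact: bracket_square_closed.
    exists y; split=> //; case: k {ff X'k T TX Ty} ko yk => // k _ yk.
    by apply: std_geW (std_homog_ge yk).
  (* the correction contributes twice, as the bracket is symmetric *)
  pose z := - (2^-1 *: y).
  have z2 : homog superdeg 2 z by apply/homogN/homogZ.
  have zk : homog stddeg k.+4 z by apply/homogN/homogZ.
  have zz : z + z = - y by rewrite -opprD -scalerDr half_double.
  exists z; split; first by apply: (std_geW _ (std_homog_ge zk)); rewrite ltnS -addn3 leq_addr.
  have f5' : std_ge 5 (f + z - pp true - cbiv c).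
    have -> : f + z - pp true - cbiv c = (f - pp true - cbiv c) + z by zmodule.
    apply: std_geD => //; rewrite /z -scaleNr; apply: std_geZ.
    by case: (odd k) yo => // ->.
  split=> //; first exact: homogD.
  - apply: sparD => //; rewrite /z -scaleNr; apply: sparZ.
    by case: (boolP (odd k)) yo => ko yo; [have := spar_homog yk; rewrite /= !negbK ko|rewrite yo].
  - rewrite (linD (sder_lin (sder_D1 R))) /z -scaleNr (linZ (sder_lin (sder_D1 R))).
    by rewrite y1 scaler0 addr0.
  have -> : Sch 2 (f + z) (f + z) = (X - Sch 2 (pp true) y) +
      ((Sch 2 (f - pp true) z + Sch 2 (f - pp true) z) + Sch 2 z z).
    have -> : Sch 2 (pp true) y = - (Sch 2 (pp true) z + Sch 2 (pp true) z).
      by rewrite -SchDr zz (linN (Sch_linr 2 (pp true))) opprK.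
    rewrite SchDl !SchDr !SchBl -/X (SchC z2 f2).
    zmodule.
  have low3 : std_ge k.+4.+2 (Sch 2 (f - pp true) z).
    by have := Sch_ge 2 (low2 _ f5) (std_homog_ge zk).
  apply: lowD; last first.
    apply/low_ge/std_geD; first exact: std_geD.
    apply: (@std_geW R (k.+4 + k.+4)); last by apply: Sch_ge; exact: std_homog_ge.
    by rewrite !addSn !addnS !ltnS (leq_trans (leq_addr k k)) // -addn2 leq_addr.
  exists (X' - T); first exact: std_geS.
  by apply: (ieqB XX'); exact: ieq_trans (Sch_pp true y) (ieq_sym Ty).
exists f; split.
- by apply: std_ge_homog => k; have [h [hs _ _ _ _] fh] := fP k; exists h.
- move=> m mo; have [h [_ ho _ _ _] /(_ m (leqnn _))] := fP (stddeg m).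
  by rewrite ahatBE ho // subr0.
- have [h [_ _ h5 _ _] fh] := fP 4%N.
  have -> : f - pp true - cbiv c = (f - h) + (h - pp true - cbiv c) by zmodule.
  exact: std_geD.
- apply: low_all => k; have [h [_ _ _ h1 _] fh] := fP k.
  rewrite -[f](subrK h) (linD (sder_lin (sder_D1 R))); apply: lowD.
    by apply/low_ge/(std_geW _ (D1_ge fh)); rewrite -addn2 leq_addr.
  exact: (low_ieq h1 (low_ge (@std_ge_0 R _))).
apply: low_all => k; have [h [_ _ _ _ hh] fh] := fP k.
have -> : Sch 2 f f = Sch 2 (f - h) f + (Sch 2 h (f - h) + Sch 2 h h).
  by rewrite SchBl SchBr; zmodule.
apply: lowD; last apply: lowD; last first.
    by apply: lowW hh; rewrite -addn4 addSnnS leq_addr.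
  by apply/low_ge/(std_geW _ (Sch_ge 2 (@std_ge0 R h) fh)); rewrite add0n.
by apply/low_ge/(std_geW _ (Sch_ge 2 fh (@std_ge0 R f))); rewrite addn0.
Qed.

End Existence.

Section Standard.
Variable R : realType.
Local Notation A := (Ahat R).
Local Notation u := (uv R).
Local Notation th := (tv R).
Local Notation pp := (@pp R).
Implicit Types (f g h x y z v : A) (r : R) (s t k n p d i j : nat) (a b : bool)
  (c : Cinf R) (e q : bool -> A).

(** * Skew-adjointness *)

Definition diffop n (L : A -> A) := exists Q : nat -> A,
  (forall t, homog superdeg 0 (Q t)) /\
  (forall g, L g = \sum_(t < n) Q t * iter t (@Dx R) g).

Lemma diffop0 n : diffop n (fun=> 0).
Proof.
exists (fun=> 0); split=> [t|g]; first exact: homog0.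
by rewrite big1 // => t _; rewrite mul0r.
Qed.

Lemma diffopD n K L : diffop n K -> diffop n L -> diffop n (fun g => K g + L g).
Proof.
move=> [Q [Q0 QE]] [Q' [Q'0 Q'E]]; exists (fun t => Q t + Q' t); split=> [t|g].
  exact: homogD.
by rewrite QE Q'E -big_split /=; apply: eq_bigr => t _; rewrite mulrDl.
Qed.

Lemma diffopZ n r L : diffop n L -> diffop n (fun g => r *: L g).
Proof.
move=> [Q [Q0 QE]]; exists (fun t => r *: Q t); split=> [t|g]; first exact: homogZ.
by rewrite QE scaler_sumr; apply: eq_bigr => t _; rewrite scalerAl.
Qed.

Lemma diffopW n k L : (k <= n)%N -> diffop k L -> diffop n L.
Proof.
move=> kn [Q [Q0 QE]]; exists (fun t => if (t < k)%N then Q t else 0); split=> [t|g].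
  by case: ifP => _ //; exact: homog0.
rewrite QE -(subnKC kn) big_split_ord /= [X in _ = _ + X]big1 ?addr0 => [|t _].
  by apply: eq_bigr => t _; rewrite ltn_ord.
by rewrite ltnNge leq_addr mul0r.
Qed.

Lemma diffop_Dx n L : diffop n L -> diffop n.+1 (fun g => Dx (L g)).
Proof.
move=> [Q [Q0 QE]].
have Q1 : diffop n.+1 (fun g => \sum_(t < n) Dx (Q t) * iter t (@Dx R) g).
  by apply: (diffopW (leqnSn n)); exists (fun t => Dx (Q t)); split=> // t; exact: Dx_super.
have Q2 : diffop n.+1 (fun g => \sum_(t < n) Q t * iter t.+1 (@Dx R) g).
  exists (fun t => if t is t'.+1 then Q t' else 0); split=> [[|t]|g] //.
  by rewrite big_ord_recl /= mul0r add0r.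
have [Q' [Q'0 Q'E]] := diffopD Q1 Q2; exists Q'; split=> // g.
by rewrite -Q'E QE dx_sum -big_split /=; apply: eq_bigr => t _; rewrite dxM.
Qed.

Lemma diffop_mul h : homog superdeg 0 h -> diffop 1 (fun g => h * g).
Proof. by move=> h0; exists (fun=> h); split=> // g; rewrite big_ord1. Qed.

Lemma diffop_ext n K L : (forall g, K g = L g) -> diffop n K -> diffop n L.
Proof. by move=> KL [Q [Q0 QE]]; exists Q; split=> // g; rewrite -KL. Qed.

(** By Leibniz' rule for iterated total derivatives. *)
Lemma adjoint_diffop n (B : nat -> A) : (forall s, homog superdeg 0 (B s)) ->
  diffop n (fun g => \sum_(s < n) (-1) ^+ s *: iter s (@Dx R) (B s * g)).
Proof.
move=> B0; have it s : diffop s.+1 (fun g => iter s (@Dx R) (B s * g)).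
  by elim: {1 2}s => [|k IH] /=; [exact: diffop_mul|exact: diffop_Dx].
elim: n => [|n IH]; first by apply: (diffop_ext _ (diffop0 0)) => g; rewrite big_ord0.
apply: diffop_ext (diffopD (diffopW (leqnSn n) IH) (diffopZ ((-1) ^+ n) (it n))) => g.
by rewrite big_ord_recr.
Qed.

Lemma dt_super0 t f : homog superdeg 0 f -> dt t f = 0.
Proof. by rewrite superdegF => f0; exact: (@homog_d_th_lt R (fun=> 0%N) (fun=> 1%N) t 0). Qed.

Lemma iter_Dx_th s : iter s (@Dx R) (th 0) = th s.
Proof. by elim: s => //= s ->; rewrite dx_thvar. Qed.

Lemma dt_linear n (Q : nat -> A) t : (forall s, homog superdeg 0 (Q s)) -> (t < n)%N ->
  dt t (\sum_(s < n) Q s * th s) = Q t.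
Proof.
move=> Q0 tn; have -> : dt t (\sum_(s < n) Q s * th s) = \sum_(s < n) (t == s)%:R *: Q s.
  rewrite (lin_sum (@d_th_lin R t)); apply: eq_bigr => s _.
  rewrite (sder_leib (sder_d_th R t)) dt_super0 // mul0r add0r sg_even; last exact: (par_super (Q0 s)).
  by rewrite d_th_thvar -mulr_natl mulr1 -scaler_nat -scalerAr mulr1.
rewrite (bigD1 (Ordinal tn)) //= eqxx scale1r big1 ?addr0 // => s /negPf st.
by rewrite (_ : (t == s) = false) ?scale0r //; move: st; rewrite -val_eqE eq_sym /= => ->.
Qed.

(** The coefficients of the adjoint operator are independent of its argument,
    and can be read off from its value at theta because the theta^t are
    independent. *)
Lemma skew_adjoint_op n (B : nat -> A) : (forall s, homog superdeg 0 (B s)) ->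
  \sum_(s < n) (-1) ^+ s *: iter s (@Dx R) (B s * th 0) = - \sum_(s < n) B s * th s ->
  forall g, \sum_(s < n) (-1) ^+ s *: iter s (@Dx R) (B s * g) =
    - \sum_(s < n) B s * iter s (@Dx R) g.
Proof.
move=> B0 Bth g; have [Q [Q0 QE]] := adjoint_diffop n B0.
rewrite QE -sumrN; apply: eq_bigr => t _; rewrite -mulNr; congr (_ * _).
have := QE (th 0); rewrite Bth => /esym/(congr1 (dt t)).
under eq_bigr do rewrite iter_Dx_th.
by rewrite dt_linear // (linN (@d_th_lin R t)) dt_linear.
Qed.

(** * The bracket of a bivector *)

(** If the operator with coefficients P_s is skew-adjoint, the variational
    derivative along theta of its bivector is the sum of the P_s theta^s. *)
Definition bracket_of f n s : A := dt s (vt (comp stddeg n.+1 f)).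

Section BracketOf.
Variable f : A.
Hypothesis f2 : homog superdeg 2 f.

Let v n := vt (comp stddeg n.+1 f).

Let v1 n : homog superdeg 1 (v n).
Proof. exact/vt_super/comp_homog. Qed.

Let vk n : homog stddeg n.+1 (v n).
Proof. exact/vt_std/homog_comp. Qed.

Lemma bracket_of_super n s : homog superdeg 0 (bracket_of f n s).
Proof.
by have := v1 n; rewrite superdegF; exact: (@homog_d_th R (fun=> 0%N) (fun=> 1%N)).
Qed.

Lemma bracket_of_std n s : (s <= n.+1)%N -> homog stddeg (n.+1 - s) (bracket_of f n s).
Proof.
by move=> sn; apply: (@homog_d_th R succn id); rewrite /= subnKC //; exact: vk.
Qed.

Lemma bracket_of0 n s : (n.+1 < s)%N -> bracket_of f n s = 0.
Proof. by move=> ns; exact: dt_big (@vk n) ns. Qed.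

Lemma bracket_of_theta n : \sum_(s < n.+2) bracket_of f n s * th s = v n.
Proof.
have E : Ev 0 (th 0) (v n) = v n by rewrite (Ev_euler (@v1 n)) scale1r.
rewrite -[RHS]E /Ev /der (@asum_fin R _ n.+2); last first.
- by move=> s ns; rewrite iter_Dx0 mul0r add0r (dt_big (@vk n)) ?mulr0.
- apply: der_summable; [by move=> s; rewrite iter_Dx0; exact: std_ge_0|].
  by move=> s; rewrite iter_Dx_th; exact: std_ge_thvar.
apply: eq_bigr => s _; rewrite iter_Dx0 mul0r add0r iter_Dx_th.
by rewrite (mulC_even _ (par_super (bracket_of_super n s))).
Qed.

(** Let v be the sum of the B_s theta^s. The variational derivative of theta v
    is v minus the adjoint operator at theta, and Euler's formula makes it
    equal to 2 v. *)
Lemma bracket_of_skew n : skew_adjoint n.+1 (bracket_of f n).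
Proof.
move=> g; have B0 := bracket_of_super n.
have := @skew_adjoint_op n.+2 _ B0 _ g; rewrite bracket_of_theta => H.
under eq_bigr do rewrite dx_opp_iterE amulE.
under [in RHS]eq_bigr do rewrite amulE DxE.
apply: H.
have vE : v n + v n = vt (th 0 * v n).
  have := vt_ieq (euler (comp_homog stddeg n.+1 f2)).
  by rewrite (linZ (@vt_lin R)) -/(v n) scaler_nat mulr2n.
have : vt (th 0 * v n) = v n - \sum_(s < n.+2) (-1) ^+ s *: iter s (@Dx R) (bracket_of f n s * th 0).
  rewrite vtE (@asum_fin R _ n.+2); [|exact: summable_var|]; last first.
    move=> s ns; rewrite d_th_thvarM (dt_big (@vk n) ns) mulr0 subr0.
    by case: s ns => // s _; rewrite scale0r iter_Dx0 scaler0.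
  have vS : v n = \sum_(s < n.+2) (-1) ^+ s *: iter s (@Dx R) ((s == 0 :> nat)%:R *: v n).
    rewrite big_ord_recl /= big1 ?addr0 ?expr0 ?scale1r // => s _.
    by rewrite /= scale0r iter_Dx0 dx0 scaler0.
  rewrite [X in _ = X - _]vS -sumrB; apply: eq_bigr => s _; rewrite -scalerBr; congr (_ *: _).
  rewrite d_th_thvarM (mulC_even (th 0) (par_super (B0 s))) -[- (th 0 * _)]scaleN1r.
  by rewrite iter_DxD !iter_DxZ scaleN1r.
rewrite -vE => /eqP; rewrite -subr_eq0 => /eqP H1.
apply/eqP; rewrite -subr_eq0 opprK; apply/eqP; rewrite -[RHS]H1; zmodule.
Qed.

End BracketOf.

(** * Standard forms *)

Lemma asum_comp g : asum (fun n => comp stddeg n.+1 g) = g - comp stddeg 0 g.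
Proof.
apply/funext => m; rewrite ahatBE /comp; case: (posnP (stddeg m)) => [m0|m_gt0].
  rewrite subrr; apply: big1 => s _; case: eqP => // sE.
  by have := ltn0Sn s; rewrite -sE m0.
rewrite subr0 /asum.
have mm : ((stddeg m).-1 < (stddeg m).+1)%N by rewrite (leq_ltn_trans (leq_pred _)).
rewrite (bigD1 (Ordinal mm)) //= prednK // eqxx big1 ?addr0 // => s sN.
case: eqP => // sE; case/eqP: sN; apply: val_inj => /=.
exact: (congr1 predn (esym sE)).
Qed.

Definition density (B : bracket R) n : A :=
  \sum_(s < n.+2) B n s * (th 0 * th s).

Lemma bivectorE (B : bracket R) : bivector B = Fint (2^-1 *: asum (density B)).
Proof.
rewrite /bivector; congr (Fint (_ *: asum _)); apply/funext => n.
by apply: eq_bigr => s _; rewrite !amulE tvE.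
Qed.

Lemma density_std (B : bracket R) n : is_bracket B -> homog stddeg n.+1 (density B n).
Proof.
move=> /(_ n)[Bd _ _]; apply: (@homog_sum R stddeg n.+1 n.+2
  (fun s => B n s * (th 0 * th s))) => s sn.
have [_ Bs] := Bd s sn; rewrite -[n.+1](subnK (sn : (s <= n.+1)%N)); apply: stdM => //.
by rewrite -[X in homog _ X _]add0n; apply: stdM; exact: th_std.
Qed.

(** Only the terms of order epsilon^2 have standard degree 3. *)
Lemma alpha_bivector (B : bracket R) : is_bracket B ->
  alpha (2^-1 *: asum (density B)) = 2^-1 *: alpha (density B 2).
Proof.
move=> BB; have E : comp stddeg 3 (asum (density B)) = density B 2.
  apply/funext => m; rewrite /comp; case: eqP => [m3|/(density_std BB) //].
  rewrite /asum m3 !big_ord_recl big_ord0 /= addr0.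
  have D j : j != 2%N -> density B j m = 0.
    by move=> j2; apply: (density_std BB) => mj; move: j2; rewrite -eqSS -mj m3.
  by rewrite (D 0%N) // (D 1%N) // (D 3%N) // !add0r addr0.
by rewrite -[_ *: _]addr0 alpha_lin alpha_comp E /alpha (lin0 (@vt_lin R)) addr0.
Qed.

Lemma higher_terms2 (X : nat -> nat -> A) s : higher_terms X 2 s = 0.
Proof. by rewrite /higher_terms big_nat1 big1. Qed.

Lemma second_bracket2 c (X Y : nat -> nat -> A) s :
  second_bracket c X 2 s = second_bracket c Y 2 s.
Proof. by rewrite /second_bracket -![(_ + _) 2 s]/(_ 2 s + _ 2 s) /= !higher_terms2. Qed.

Lemma higher_termsE (X : nat -> nat -> A) n s : higher_terms X n s =
  if [&& ~~ odd n, (4 <= n)%N & (s <= n.+1)%N] then X n./2 (n.+1 - s)%N else 0.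
Proof.
rewrite /higher_terms; case: ifPn => [/and3P[ne n4 sn]|nN]; last first.
  rewrite big_nat big1 // => g /andP[g2 _]; rewrite big1 // => k _.
  rewrite /eps_delta; case: ifP => // /andP[/eqP n2 /eqP sk]; case/negP: nN.
  apply/and3P; split.
  - by rewrite n2 mul2n odd_double.
  - by rewrite n2 mul2n (leq_double 2).
  - by rewrite sk n2 leq_subr.
set g := n./2; have n2 : n = (2 * g)%N.
  by rewrite mul2n -[LHS]odd_double_half (negPf ne).
rewrite (bigD1_seq g) ?iota_uniq //=; last first.
  rewrite mem_index_iota ltnS n2 leq_pmull // andbT.
  by move: n4; rewrite n2 mul2n (leq_double 2).
rewrite [X in _ + X]big1 ?addr0; last first.
  move=> g' gN; rewrite big1 // => k _.
  by rewrite /eps_delta n2 eqn_mul2l /= eq_sym (negPf gN).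
have kk : (n.+1 - s < (2 * g).+2)%N by rewrite -n2 ltnS leq_subr.
rewrite (bigD1 (Ordinal kk)) //= [X in _ + X]big1 => [|k kN].
  by rewrite addr0 /eps_delta -n2 subKn // !eqxx.
rewrite /eps_delta; case: ifP => // /andP[_ /eqP sE]; case/eqP: kN.
apply: val_inj => /=; rewrite sE [n in RHS]n2 subKn // -ltnS; exact: ltn_ord.
Qed.

Lemma dt_mul_th h s t : homog superdeg 0 h -> dt s (h * th t) = (s == t)%:R *: h.
Proof.
move=> h0; rewrite (sder_leib (sder_d_th R s)) dt_super0 // mul0r add0r.
rewrite (sg_even true (par_super h0)) d_th_thvar.
by rewrite -[_%:R]scaler_nat -scalerAr mulr1.
Qed.

Lemma vt_cbiv c : vt (cbiv c) = 3 *: (cf c * th 3) +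
  (9 / 2) *: (cf (Cderiv c) * u 1 * th 2) +
  (3 / 2) *: (cf (Cderiv (Cderiv c)) * (u 1 * u 1) * th 1) +
  (3 / 2) *: (cf (Cderiv c) * u 2 * th 1).
Proof.
have std : homog stddeg 3 (cf c * (th 1 * th 2)).
  by apply: (@stdM R 0 3); [exact: cf_std|apply: (@stdM R 1 2); exact: th_std].
have dE s : dt s (cf c * (th 1 * th 2)) =
    cf c * ((s == 1%N)%:R *: th 2 - (s == 2%N)%:R *: th 1).
  by rewrite d_th_coefM d_th_thvarM d_th_thvar -[_%:R in X in _ - X]scaler_nat -scalerAr mulr1.
have vE : vt (cf c * (th 1 * th 2)) = - Dx (cf c * th 2) - Dx (Dx (cf c * th 1)).
  rewrite vtE (@asum_fin R _ 3); [|exact: summable_var|]; last first.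
    move=> s s3; rewrite dE !gtn_eqF ?(ltnW s3) // !scale0r subrr mulr0.
    by rewrite iter_Dx0 scaler0.
  have [d0 d1 d2] : [/\ dt 0 (cf c * (th 1 * th 2)) = 0,
      dt 1 (cf c * (th 1 * th 2)) = cf c * th 2 &
      dt 2 (cf c * (th 1 * th 2)) = - (cf c * th 1)].
    by split; rewrite dE /= ?scale0r ?scale1r ?subrr ?subr0 ?sub0r ?mulrN ?mulr0.
  rewrite !big_ord_recl big_ord0 /= d0 d1 d2 scaler0 !dxN expr1 scaleN1r.
  by rewrite sqrrN expr1n scale1r add0r addr0.
rewrite /cbiv (linN (@vt_lin R)) (linZ (@vt_lin R)) vE.
have ux (a : Cinf R) f : u 1 * cf a * f = cf a * u 1 * f by rewrite cfC.
set a := cf c * th 3; set b := cf (Cderiv c) * u 1 * th 2.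
set d := cf (Cderiv (Cderiv c)) * (u 1 * u 1) * th 1; set e := cf (Cderiv c) * u 2 * th 1.
have -> : Dx (cf c * th 2) = b + a by rewrite dxM dx_coef dx_thvar ux.
have -> : Dx (cf c * th 1) = cf (Cderiv c) * u 1 * th 1 + cf c * th 2.
  by rewrite dxM dx_coef dx_thvar ux.
have -> : Dx (cf (Cderiv c) * u 1 * th 1 + cf c * th 2) = (d + e + b) + (b + a).
  rewrite dxD !dxM !dx_coef dx_uvar !dx_thvar !ux mulrDl; do ?congr (_ + _).
  by rewrite /d !mulrA.
have s3 : 3 = 3 / 2 + 3 / 2 :> R by field.
have s9 : 9 / 2 = 3 / 2 + 3 / 2 + 3 / 2 :> R by field.
rewrite s9 [in RHS](_ : (3 : R) *: a = (3 / 2) *: (a + a)); last first.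
  by rewrite scalerDr -scalerDl -s3.
rewrite -scalerN !scalerDl -!scalerDr; congr (_ *: _); zmodule.
Qed.

Lemma second_bracketE c (X : nat -> nat -> A) n s : second_bracket c X n s =
  (if (n == 0%N) && (s == 1%N) then u 0 else 0) +
  (if (n == 0%N) && (s == 0%N) then 2^-1 *: u 1 else 0) +
  ((if (n == 2%N) && (s == 3%N) then 3 *: cf c else 0) +
   (if (n == 2%N) && (s == 2%N) then (9 / 2) *: (cf (Cderiv c) * u 1) else 0) +
   (if (n == 2%N) && (s == 1%N) then
      (3 / 2) *: (cf (Cderiv (Cderiv c)) * (u 1 * u 1)) else 0) +
   (if (n == 2%N) && (s == 1%N) then (3 / 2) *: (cf (Cderiv c) * u 2) else 0)) +
  higher_terms X n s :> A.
Proof.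
have E (B B' : bracket R) : (B + B') n s = B n s + B' n s by [].
rewrite /second_bracket uvE cfE (amulE (cf _) (u 1)) (amulE (u 1)) (amulE (cf _) (u 1 * _)).
rewrite (amulE (cf _) (u 2)).
rewrite !E.
rewrite /eps_delta.
by [].
Qed.

Lemma standard_bracket c f : homog superdeg 2 f -> spar true f ->
  std_ge 5 (f - pp true - cbiv c) ->
  second_bracket c (fun i k => bracket_of f (2 * i)%N ((2 * i).+1 - k)%N) = bracket_of f.
Proof.
move=> f2 fo f5.
have low i : (i < 5)%N ->
    comp stddeg i f = comp stddeg i (pp true) + comp stddeg i (cbiv c).
  move=> i5; rewrite -[f in LHS](subrK (pp true)) -[f - _](subrK (cbiv c)).
  rewrite (linD (comp_lin stddeg i) _ (pp true)) (linD (comp_lin stddeg i) _ (cbiv c)).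
  rewrite ((std_geE 5 _).1 f5 i i5) add0r.
  by rewrite addrC.
have f1 : comp stddeg 1 f = pp true.
  rewrite low // (comp_id (@pp_std R true)).
  by rewrite (comp_homog_neq (@cbiv_std R c)) // addr0.
have f3 : comp stddeg 3 f = cbiv c.
  rewrite low // (comp_id (@cbiv_std R c)).
  by rewrite (comp_homog_neq (@pp_std R true)) // add0r.
have even0 n : odd n -> comp stddeg n.+1 f = 0.
  by move=> no; apply: ((sparE true f).1 fo); rewrite /= no.
apply/funext => n; apply/funext => s; rewrite second_bracketE higher_termsE.
have [no|ne] := boolP (odd n).
  have -> : bracket_of f n s = 0.
    by rewrite /bracket_of even0 // (lin0 (@vt_lin R)) (lin0 (@d_th_lin R s)).
  by case: n no => [|[|[|n]]] //= _; rewrite !addr0.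
have [n4|] := leqP 4 n; last first.
  case: n ne => [|[|[|[|n]]]] //= _ _; rewrite /bracket_of.
    rewrite f1 vt_pp /w2 (linD (@d_th_lin R s)) (linZ (@d_th_lin R s)).
    rewrite !(dt_mul_th s _ (@u_super R _)) !addr0.
    by case: s => [|[|s]]; rewrite /= ?scale0r ?scale1r ?scaler0 ?add0r ?addr0.
  rewrite f3 vt_cbiv !(linD (@d_th_lin R s)) !(linZ (@d_th_lin R s)).
  have c0 (a : Cinf R) i : homog superdeg 0 (cf a * u i).
    by apply: (@superM R 0 0); [exact: cf_super|exact: u_super].
  have c1 : homog superdeg 0 (cf (Cderiv (Cderiv c)) * (u 1 * u 1)).
    by apply: (@superM R 0 0); [exact: cf_super|apply: (@superM R 0 0); exact: u_super].
  rewrite (dt_mul_th s 3 (@cf_super R c)) !(dt_mul_th s _ (c0 _ _)) (dt_mul_th s _ c1).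
  by case: s => [|[|[|[|s]]]]; rewrite /= ?scale0r ?scale1r ?scaler0 ?add0r ?addr0.
have n2 : (2 * n./2)%N = n by rewrite mul2n -[RHS]odd_double_half (negPf ne).
have [-> ->] : (n == 0%N) = false /\ (n == 2%N) = false.
  by case: (n) n4 => [|[|[|]]].
rewrite n2 /= !addr0 add0r.
have [sn|ns] := leqP s n.+1; first by rewrite subKn.
by rewrite bracket_of0.
Qed.

Lemma bracket_of_is_bracket f : homog superdeg 2 f -> is_bracket (bracket_of f).
Proof.
move=> f2 n; split=> [s sn|s ns|].
- by split; [exact: bracket_of_super|exact: bracket_of_std].
- exact: bracket_of0.
- exact: bracket_of_skew.
Qed.

Lemma bracket_of_bivector f : homog superdeg 2 f -> comp stddeg 0 f = 0 ->
  bivector (bracket_of f) = Fint f.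
Proof.
move=> f2 f0; rewrite bivectorE; apply/FintP/ieq_sym.
apply: (ieq_trans (euler2 f2)); apply/ieqZ/ieq_eq.
have th_comp k : comp stddeg k (th 0 * vt f) = th 0 * comp stddeg k (vt f).
  rewrite -[k in LHS]addn0; apply: (comp_shift (E := fun g => th 0 * g)) => [r g h|i|i g gi].
  + by rewrite mulrDr -scalerAr.
  + exists i => g /std_geP g0; apply/std_geP.
    by have := std_geM (@std_ge_thvar R 0) ((std_geP _ _).2 g0).
  + by rewrite addnC; apply: stdM => //; exact: th_std.
have -> : asum (density (bracket_of f)) = asum (fun n => comp stddeg n.+1 (th 0 * vt f)).
  apply: eq_asum => n; rewrite /density th_comp vt_comp -(bracket_of_theta f2 n) mulr_sumr; apply: eq_bigr => s _.
  rewrite mulrA (mulC_even (th 0) (par_super (@bracket_of_super f f2 n s))).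
  by rewrite mulrA.
rewrite asum_comp.
by rewrite th_comp vt_comp f0 (lin0 (@vt_lin R)) mulr0 subr0.
Qed.

(** * Classes of functionals *)

Lemma Fint0 : Fint (0 : A) = 0.
Proof. exact: (raddf0 \pi_(Quotient.quot (@dx_image R))%qT). Qed.

Lemma FintB f g : Fint (f - g) = Fint f - Fint g.
Proof. exact: (raddfB \pi_(Quotient.quot (@dx_image R))%qT). Qed.

Lemma Fint_repr (P : Fhat R) : Fint (repr P : A) = P.
Proof. exact: reprK. Qed.

Lemma repr_Fint f : ieq (repr (Fint f) : A) f.
Proof. by apply/FintP; rewrite Fint_repr. Qed.

Lemma schoutenE f g : schouten 2 (Fint f) (Fint g) = Fint (Sch 2 f g).
Proof. by rewrite /schouten SchE (Sch_ieq 2 (repr_Fint f) (repr_Fint g)). Qed.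

Lemma exp_adE x f : exp_ad x (Fint f) = Fint (expad x f).
Proof.
rewrite /exp_ad; apply/FintP; apply: ieq_trans (expad_ieq x (repr_Fint f)).
apply: ieq_eq; congr asum; apply/funext => n; congr (_ *: _).
by elim: n => //= n ->; rewrite SchE.
Qed.

Lemma Fint_eq0 f : Fint f = 0 <-> ieq f 0.
Proof. by rewrite -Fint0; exact: FintP. Qed.

Lemma P1E : P1 R = Fint (pp false).
Proof. by rewrite /P1 amulE tvE. Qed.

Lemma P2E : P2 R = Fint (pp true).
Proof. by rewrite /P2 !amulE tvE uvE. Qed.

Lemma deform_deformation e : deform e -> is_deformation (Fint (e false), Fint (e true)).
Proof.
move=> [e2 ep ee]; split => /=.
- split; [by exists (e false); [exact: e2|]|by exists (e true); [exact: e2|]|].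
  by split; rewrite schoutenE; apply/Fint_eq0.
- by exists (e false - pp false); [exact: ep|rewrite P1E FintB].
- by exists (e true - pp true); [exact: ep|rewrite P2E FintB].
Qed.

Lemma deformation_rep a (P : Fhat R) : Fsuper 2 P -> Fstd_ge 2 (P - Fint (pp a)) ->
  exists f, [/\ homog superdeg 2 f, std_ge 2 (f - pp a) & P = Fint f].
Proof.
move=> [f f2 ->] [h hk]; rewrite -FintB => /FintP fh.
have f2' : homog superdeg 2 (f - pp a) by apply: homogB => //; exact: pp_super.
have [h' [h'2 h'k fh']] : exists h', [/\ homog superdeg 2 h', std_ge 2 h' & ieq (f - pp a) h'].
  by apply: low_super => //; exists h.
exists (pp a + h'); split; first by apply: homogD => //; exact: pp_super.
  by have -> : pp a + h' - pp a = h' by zmodule.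
apply/FintP; have := ieqD (ieq_refl (pp a)) fh'.
by have -> : pp a + (f - pp a) = f by zmodule.
Qed.

Lemma deformation_deform (P : Fhat R * Fhat R) : is_deformation P ->
  exists e, deform e /\ P = (Fint (e false), Fint (e true)).
Proof.
case: P => P1' P2' [] [] /= s1 s2 [b11 b12 b22]; rewrite P1E P2E.
move=> /(deformation_rep s1)[f [f2 fp fE]] /(deformation_rep s2)[g [g2 gp gE]].
exists (fun a => if a then g else f); split; last by rewrite fE gE.
split=> [[]|[]|] //; move: b11 b12 b22; rewrite fE gE !schoutenE.
move=> /Fint_eq0 b11 /Fint_eq0 b12 /Fint_eq0 b22 [] [] //.
by rewrite (SchC g2 f2).
Qed.

Definition Fgam (P : Fhat R * Fhat R) : Cinf R :=
  alpha (repr P.2 : A) - Cid R * alpha (repr P.1 : A).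

Lemma FgamE e : Fgam (Fint (e false), Fint (e true)) = gam e.
Proof. by rewrite /Fgam /gam /= !(alpha_ieq (repr_Fint _)). Qed.

Lemma equivalentE (P Q : Fhat R * Fhat R) : is_deformation P -> is_deformation Q ->
  equivalent P Q <-> Fgam P = Fgam Q.
Proof.
move=> /deformation_deform[e [de ->]] /deformation_deform[q [dq ->]].
split=> [[x [xs x1 /= q1 q2]]|].
  rewrite q1 q2 !exp_adE (FgamE (fun a => expad x (e a))) FgamE.
  by rewrite gam_expad.
rewrite !FgamE => /(classification de dq)[x [xs x1 qx]].
by exists x; split=> //=; rewrite exp_adE; apply/FintP.
Qed.

Lemma standard_form_Fgam c (P Q : Fhat R * Fhat R) :
  standard_form c P -> standard_form c Q -> Fgam P = Fgam Q.
Proof.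
move=> [X [_ BX P1X P2X]] [Y [_ BY P1Y P2Y]].
rewrite /Fgam P1X P1Y P2X P2Y !bivectorE !(alpha_ieq (repr_Fint _)).
rewrite (alpha_bivector BX) (alpha_bivector BY).
have -> : density (second_bracket c X) 2 = density (second_bracket c Y) 2; last by [].
by apply: eq_bigr => s _; rewrite (second_bracket2 c X Y).
Qed.

Lemma first_bracketE : bivector (first_bracket R) = Fint (pp false).
Proof.
rewrite bivectorE; congr (Fint (_ *: _)).
have D n : n != 0%N -> density (first_bracket R) n = 0.
  by move=> /negPf n0; rewrite /density big1 // => s _; rewrite /first_bracket /eps_delta n0 mul0r.
rewrite (@asum1 R _ 0) // => [|n]; last first.
  by case: n => [|n]; [exact: std_ge0|rewrite D].
rewrite /density !big_ord_recl big_ord0 /= /first_bracket /eps_delta /=.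
by rewrite mul0r add0r addr0 cfE coef1 mul1r.
Qed.

End Standard.

Theorem theorem1p2 (R : realType) (c : Cinf R) :
  exists! C : set (Fhat R * Fhat R),
    is_deformation_class C /\ (exists2 P, C P & standard_form c P).
Proof.
have [f [f2 fo f5 f1 ff]] := standard_exists c.
pose e (a : bool) := if a then f else pp R false.
have de : deform e.
  split=> [[]|[]|[] []] //; rewrite /e.
  - exact: pp_super.
  - rewrite -[_ - _](subrK (cbiv c)); apply: std_geD; first exact: std_geW f5.
    by apply: (@std_geW R 3) => //; exact/std_homog_ge/cbiv_std.
  - by rewrite subrr.
  - by rewrite (SchC f2 (pp_super R false)); exact: ieq_trans (Sch_pp false f) f1.
  - exact: ieq_trans (Sch_pp false f) f1.
  - by rewrite Sch_pp_pp; exact: ieq_refl.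
pose S : Fhat R * Fhat R := (Fint (e false), Fint (e true)).
have dS : is_deformation S := deform_deformation de.
have Sc : standard_form c S.
  exists (fun g k => bracket_of f (2 * g)%N ((2 * g).+1 - k)%N).
  rewrite standard_bracket //; split.
  - move=> g k _ kg; rewrite -[k in diffpoly k](subKn kg); split.
      exact: bracket_of_super.
    by apply: bracket_of_std => //; exact: leq_subr.
  - exact: bracket_of_is_bracket.
  - by rewrite first_bracketE.
  - by rewrite bracket_of_bivector //; exact: (sparE true f).1 fo 0%N isT.
(* a class of deformations is a level set of the invariant *)
have classE P : is_deformation P -> Fgam P = Fgam S ->
    [set Q | is_deformation Q /\ equivalent P Q]%classic =
    [set Q | is_deformation Q /\ Fgam Q = Fgam S]%classic.
  move=> dP PS; apply/seteqP; split=> Q [dQ] PQ; split=> //.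
    by rewrite -PS; apply/esym/(equivalentE dP dQ).
  by apply/(equivalentE dP dQ); rewrite PS PQ.
exists [set Q | is_deformation Q /\ Fgam Q = Fgam S]%classic; split.
  split; last by exists S.
  by exists S => //; rewrite classE.
move=> C [[P dP ->] [Q [dQ PQ] Qc]]; rewrite classE //.
by rewrite -(standard_form_Fgam Qc Sc); apply/(equivalentE dP dQ).
Qed.
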